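(* Let $2\le r\le\infty$ and let $(T,\vec\varphi)$, $\vec\varphi=(\varphi_1,\dots,\varphi_d)$, be a $C^r$ Legendre system. For every nonempty compact set $E\subset\mathbb{R}^d$ there exists a $C^r$ nonlinearity $F$ such that $\mathscr{Y}=E$, where $$\mathscr{Y}=(\nabla\mathsf{P})^{-1}(\mathscr{V}),\qquad \mathscr{V}=\{z:\ \mathsf{h}(z)+F(z)=\sup(\mathsf{h}+F)\}.$$ In particular, there are $C^r$ Legendre systems and $C^r$ nonlinearities for which the set of nonlinear equilibrium measures is infinite, even uncountable.
   Context: $T:X\to X$ is a continuous self-map of a compact metric space, $\varphi_1,\dots,\varphi_d:X\to\mathbb{R}$ are continuous functions. $\mathscr{P}(T)$ is the set of $T$-invariant Borel probability measures, $h(T,\mu)$ the Kolmogorov–Sinai entropy, $\mu(\vec\varphi)=(\int\varphi_1d\mu,\dots,\int\varphi_dd\mu)$. A $C^r$ nonlinearity is a $C^r$ function $F:U\to\mathbb{R}$ on an open set $U\subset\mathbb{R}^d$ containing the rotation set $\rho(\vec\varphi)=\{\mu(\vec\varphi):\mu\in\mathscr{P}(T)\}$. A nonlinear equilibrium measure (for $F$) is a measure $\mu\in\mathscr{P}(T)$ maximizing $h(T,\mu)+F(\mu(\vec\varphi))$ over $\mathscr{P}(T)$. The entropy function is $\mathsf{h}(z)=\sup\{h(T,\mu):\mu\in\mathscr{P}(T),\ \mu(\vec\varphi)=z\}$ (with $\sup\varnothing=-\infty$; it is finite exactly on $\rho(\vec\varphi)$, and $\mathsf{h}+F$ is understood as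 $-\infty$ elsewhere). The pressure function is $\mathsf{P}(y)=\sup_{\mu\in\mathscr{P}(T)}\big(h(T,\mu)+\langle y,\mu(\vec\varphi)\rangle\big)$, $y\in\mathbb{R}^d$ (it is differentiable under the assumptions). For $f:\mathbb{R}^d\to\mathbb{R}\cup\{-\infty\}$ let $\mathrm{dom}(f)=f^{-1}(\mathbb{R})$. $f$ is concave of $C^r$ Legendre type (with $r\ge2$) when: (i) $f$ is upper semicontinuous and concave; (ii) the interior of $\mathrm{dom}(f)$ is nonempty and on it $f$ is strictly concave and $C^r$ with everywhere negative definite Hessian; (iii) for every sequence $(x_i)$ in the interior of $\mathrm{dom}(f)$ converging to a boundary point of $\mathrm{dom}(f)$, $|\nabla f(x_i)|\to+\infty$. $(T,\vec\varphi)$ is $C^r$ Legendre when: $\rho(\vec\varphi)$ has nonempty interior in $\mathbb{R}^d$; the topological entropy of $T$ is finite; and $\mathsf{h}$ is concave of $C^r$ Legendre type. *)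

(* Defs.v *)
From HB Require Import structures.
From mathcomp Require Import all_boot all_order all_algebra finmap.
From mathcomp Require Import all_classical all_reals all_analysis.

Set Implicit Arguments.
Unset Strict Implicit.
Unset Printing Implicit Defensive.

Import Order.TTheory GRing.Theory Num.Theory.
Import numFieldNormedType.Exports.

Local Open Scope classical_set_scope.
Local Open Scope ring_scope.

(* The base point only serves the Borel measurable structure below, since
   measurable types are pointed in the library. *)
#[short(type="pointedMetricType")]
HB.structure Definition PointedMetric (R : numDomainType) :=
  { X of Pointed X & Metric R X }.

Notation borel X := (g_sigma_algebraType (@open X)).

Section Calculus.
Variables (R : realType) (d : nat).
Implicit Types (f : 'rV[R]_d -> R) (g : 'rV[R]_d -> \bar R).
Implicit Types (U : set 'rV[R]_d) (x y z : 'rV[R]_d).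

Definition partial (i : 'I_d) f : 'rV[R]_d -> R := 'D_(delta_mx 0 i) f.

Definition gradient f x : 'rV[R]_d := \row_i partial i f x.

Definition hessian f x : 'M[R]_d :=
  \matrix_(i, j) partial i (partial j f) x.

Definition negative_definite (A : 'M[R]_d) : Prop :=
  forall v : 'rV[R]_d, v != 0 -> (v *m A *m v^T) 0 0 < 0.

Definition dotp x y : R := \sum_i x 0 i * y 0 i.

(* f is meant to be used with U open: f has continuous iterated partial
   derivatives of all orders <= k on U. *)
Fixpoint Ck (k : nat) f U : Prop :=
  (forall x, U x -> {for x, continuous f}) /\
  (if k is k'.+1 then
     forall i : 'I_d,
       (forall x, U x -> derivable f x (delta_mx 0 i)) /\ Ck k' (partial i f) U
   else True).

(* A smoothness class r is an element of nat + {oo}, oo being None. *)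
Definition Cr (r : option nat) f U : Prop :=
  if r is Some k then Ck k f U else forall k, Ck k f U.

Definition dom g : set 'rV[R]_d := [set x | g x \is a fin_num].

Definition upper_semicontinuous g : Prop :=
  lower_semicontinuous (fun x => (- g x)%E).

(* For functions without the value +oo. At t = 0 or 1 the library convention
   0 * -oo = 0 makes the inequality trivial, as it should be. *)
Definition concave g : Prop :=
  forall x y (t : R), 0 <= t <= 1 ->
    (t%:E * g x + (1 - t)%:E * g y <= g (t *: x + (1 - t) *: y)%R)%E.

Definition strictly_concave_on U g : Prop :=
  forall x y (t : R), U x -> U y -> x != y -> 0 < t < 1 ->
    (t%:E * g x + (1 - t)%:E * g y < g (t *: x + (1 - t) *: y)%R)%E.

Definition boundary U : set 'rV[R]_d := closure U `\` U°.

(* The first conjunct says that g takes its values in R + {-oo}. The norm in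
   the last one is the sup norm of 'rV[R]_d, equivalent to the Euclidean one. *)
Definition concave_legendre_type (r : option nat) g : Prop :=
  [/\ forall x, (g x < +oo)%E,
      upper_semicontinuous g /\ concave g,
      [/\ (dom g)° !=set0,
          strictly_concave_on (dom g)° g,
          Cr r (fine \o g) (dom g)° &
          forall x, (dom g)° x -> negative_definite (hessian (fine \o g) x)] &
      forall (x : nat -> 'rV[R]_d) z,
        (forall n, (dom g)° (x n)) -> x @ \oo --> z -> boundary (dom g) z ->
        `|gradient (fine \o g) (x n)| @[n --> \oo] --> +oo].

End Calculus.

Section Dynamics.
Variables (R : realType) (X : pointedMetricType R) (T : X -> X).
Implicit Types (mu : probability (borel X) R).

Definition invariant mu : Prop :=
  forall A : set (borel X), measurable A -> mu (T @^-1` A) = mu A.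

Definition finite_partition (k : nat) (A : 'I_k -> set (borel X)) : Prop :=
  [/\ forall i, measurable (A i), trivIset setT A & \bigcup_i A i = setT].

(* The entropy of the join of the T^{-i} A, 0 <= i < n; the atoms of the join
   are indexed by words of length n, and ln 0 = 0 in the library. *)
Definition join_entropy mu (k : nat) (A : 'I_k -> set (borel X)) (n : nat) : R :=
  - \sum_(w : {ffun 'I_n -> 'I_k})
      let p := fine (mu (\bigcap_(i in [set: 'I_n]) iter i T @^-1` A (w i))) in
      p * ln p.

Definition partition_entropy mu (k : nat) (A : 'I_k -> set (borel X)) : R :=
  limn (fun n => n%:R^-1 * join_entropy mu A n).

Definition ks_entropy mu : \bar R :=
  ereal_sup [set e | exists k, exists2 A : 'I_k -> set (borel X),
    finite_partition A & e = (partition_entropy mu A)%:E].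

Definition bowen_dist (n : nat) (x y : X) : R :=
  \big[Num.max/0]_(i < n) mdist (iter i T x) (iter i T y).

Definition separated (n : nat) (eps : R) (S : {fset X}) : Prop :=
  {in S &, forall x y, x != y -> eps < bowen_dist n x y}.

Definition max_separated (n : nat) (eps : R) : \bar R :=
  ereal_sup [set (#|` S|%:R)%:E | S in [set S | separated n eps S]].

Definition topological_entropy : \bar R :=
  ereal_sup [set limn_esup (fun n => (n%:R^-1)%:E * lne (max_separated n eps))%E
            | eps in [set eps : R | 0 < eps]].

Variables (d : nat) (phi : 'I_d -> X -> R).

Definition mean mu : 'rV[R]_d :=
  \row_i (\int[mu]_(x in [set: borel X]) phi i x).

Definition rotation_set : set 'rV[R]_d :=
  [set mean mu | mu in [set mu | invariant mu]].

Definition entropy_function (z : 'rV[R]_d) : \bar R :=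
  ereal_sup [set ks_entropy mu | mu in [set mu | invariant mu /\ mean mu = z]].

Definition pressure (y : 'rV[R]_d) : \bar R :=
  ereal_sup [set ks_entropy mu + (dotp y (mean mu))%:E
            | mu in [set mu | invariant mu]]%E.

Definition legendre_system (r : option nat) : Prop :=
  [/\ rotation_set° !=set0,
      topological_entropy \is a fin_num &
      concave_legendre_type r entropy_function].

(* A function F : U -> R is represented by a total function, whose values
   outside U play no role. *)
Definition nonlinearity (r : option nat) (U : set 'rV[R]_d)
    (F : 'rV[R]_d -> R) : Prop :=
  [/\ open U, rotation_set `<=` U & Cr r F U].

(* h + F, equal to -oo outside the rotation set because h is. *)
Definition nonlinear_objective (F : 'rV[R]_d -> R) (z : 'rV[R]_d) : \bar R :=
  (entropy_function z + (F z)%:E)%E.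

Definition maximizing_values (F : 'rV[R]_d -> R) : set 'rV[R]_d :=
  [set z | nonlinear_objective F z = ereal_sup (range (nonlinear_objective F))].

(* The preimage of the maximizing values by the gradient of the pressure. *)
Definition maximizing_parameters (F : 'rV[R]_d -> R) : set 'rV[R]_d :=
  [set y | differentiable (fine \o pressure) y /\
           maximizing_values F (gradient (fine \o pressure) y)].

Definition equilibrium_measures (F : 'rV[R]_d -> R) :
    set (probability (borel X) R) :=
  [set mu | invariant mu /\
    forall nu, invariant nu ->
      (ks_entropy nu + (F (mean nu))%:E <= ks_entropy mu + (F (mean mu))%:E)%E].

End Dynamics.

(* Main.v *)
Require Import Defs.
From HB Require Import structures.
From mathcomp Require Import all_boot all_order all_algebra finmap.
From mathcomp Require Import all_classical all_reals all_analysis.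
From mathcomp Require Import ring lra.

Set Implicit Arguments.
Unset Strict Implicit.
Unset Printing Implicit Defensive.

Import Order.TTheory GRing.Theory Num.Theory.
Import numFieldNormedType.Exports.

Local Open Scope classical_set_scope.
Local Open Scope ring_scope.

(* Let h be the entropy function, P the pressure, M a constant strictly above
   the values of h, K the image of E under the gradient of P, and chi a smooth
   function with values in [0, 1], compactly supported in the interior of the
   domain of h and equal to 1 exactly on K. For F = chi (M - h) - M the function
   h + F = (1 - chi) (h - M) is nonpositive and vanishes exactly on K. As h is of
   Legendre type, the gradient of P is an injective continuous map into the
   interior of the domain of h, sending y to the unique maximizer of h + <y,.>;
   hence K is compact and its preimage is E.

   For the example, take the full shift on two symbols and the first letter as
   potential. Its entropy function is the binary entropy: Bernoulli measures,
   realized as images of the Lebesgue measure under the itineraries of a skew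
   doubling map, attain it, and Gibbs' inequality against the code of
   independent letters bounds all other measures. For E the closed unit ball,
   distinct parameters give equilibrium measures with distinct means. *)

(** * Functions of class C^k *)

(** The level set of [chi] at 1 has to be an arbitrary compact set, so smooth functions with a
    prescribed closed zero set are needed: a weighted sum of bumps over the rational boxes that miss
    the set, with explicit bounds on all derivatives so that the sum can be differentiated termwise.
    Since [chi] vanishes off a closed set inside the interior of the domain of h, F is of class C^r
    on the whole space although h is smooth only in that interior. P is not differentiated from its
    definition: it is the conjugate of h, and continuity of the maximizer yields its first-order
    expansion. In the example the entropy is a supremum over all finite measurable partitions, and
    no generator theorem is invoked. An arbitrary partition is approximated by one read off finitely
    many letters, and its names are compared with a noisy image of independent letters; the noise
    pays for the approximation error. *)

Lemma is_derive_line (R : realType) (V : normedModType R) (f : V -> R) (x v : V) (df : R) :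
  is_derive x v f df <-> is_derive (0 : R) 1 (fun h : R => f (h *: v + x)) df.
Proof.
have E : (fun h : R => h^-1 *: ((f \o shift x) (h *: v) - f x)) =
    (fun h : R => h^-1 *: (((fun h => f (h *: v + x)) \o shift 0) (h *: 1) -
      f (0 *: v + x))).
  by apply/funext => h /=; rewrite addr0 scale0r add0r [_%:A]mulr1.
by split=> -[fd <-]; constructor; rewrite /derivable /derive ?E// -E.
Qed.

(** On the line through x the composition has one real variable, where the chain rule applies. *)
Lemma is_derive_ln_comp (R : realType) (V : normedModType R) (f : V -> R) (x v : V) :
  0 < f x -> derivable f x v ->
  is_derive x v (fun y => ln (f y)) ((f x)^-1 * 'D_v f x).
Proof.
move=> fx0 /derivableP/is_derive_line fd; apply/is_derive_line.
have fx0' : 0 < f (0 *: v + x) by rewrite scale0r add0r.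
have := @is_derive1_comp _ (@ln R) _ 0 _ _ (is_derive1_ln fx0') fd.
by rewrite scale0r add0r.
Qed.

Section CkTheory.
Variables (R : realType) (d : nat).
Implicit Types (f g : 'rV[R]_d -> R) (U V : set 'rV[R]_d) (k : nat).

Lemma Ck_cont k f U : Ck k f U -> forall x, U x -> {for x, continuous f}.
Proof. by case: k => [|k] []. Qed.

Lemma Ck_sub k f U V : V `<=` U -> Ck k f U -> Ck k f V.
Proof.
move=> VU; elim: k f => [|k IH] f [fc fd]; 
  (split=> [x /VU/fc//|]) => // i.
by have [fid fiC] := fd i; split=> [x /VU/fid//|]; exact: IH fiC.
Qed.

Lemma near_eq_continuous_for f g x :
  (\near x, f x = g x) -> {for x, continuous f} -> {for x, continuous g}.
Proof.
move=> fg; have fgx : f x = g x by exact: nbhs_singleton fg.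
rewrite /prop_for /continuous_at -fgx.
by move: fg => /near_eq_cvg/cvg_trans; exact.
Qed.

(** The rules of differentiation are known only at points of U, while [partial i f] is a total
    function. Openness of U lets equality on U survive differentiation, so each induction below may
    replace a derivative by its formula. *)
Lemma Ck_eq k f g U : open U -> {in U, f =1 g} -> Ck k f U -> Ck k g U.
Proof.
move=> oU; elim: k f g => [|k IH] f g fg [fc fd];
  have nfg x : U x -> \near x, f x = g x by move=> Ux;
    apply: filterS (open_nbhs_nbhs (conj oU Ux)) => y Uy; exact/fg/mem_set.
  by split=> // x Ux; apply: near_eq_continuous_for (fc _ Ux); exact: nfg.
split=> [x Ux|i]; first by apply: near_eq_continuous_for (fc _ Ux); exact: nfg.
have [fid fiC] := fd i; split=> [x Ux|].
  by apply: near_eq_derivable (fid _ Ux); exact: nfg.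
by apply: IH fiC => x /set_mem Ux; apply: near_eq_derive; exact: nfg.
Qed.

Lemma CkW k f U : Ck k.+1 f U -> Ck k f U.
Proof.
elim: k f => [|k IH] f [fc fd]; split=> // i; have [fid fiC] := fd i.
by split=> //; exact: IH.
Qed.

Lemma Ck_le k l f U : (k <= l)%N -> Ck l f U -> Ck k f U.
Proof.
move=> /subnK <-; elim: (l - k)%N => // n IH; rewrite addSn => /CkW; exact: IH.
Qed.

Lemma Ck_cst k (c : R) U : Ck k (cst c) U.
Proof.
elim: k c => [|k IH] c; (split=> [x _|]; first exact: cst_continuous) => // i.
split=> [x _|]; first exact: derivable_cst.
suff -> : partial i (cst c) = cst 0 by exact: IH.
by apply/funext => x; exact: derive_cst.
Qed.

Lemma CkD k f g U : open U -> Ck k f U -> Ck k g U -> Ck k (f + g) U.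
Proof.
move=> oU; elim: k f g => [|k IH] f g [fc fd] [gc gd];
  (split=> [x Ux|]; first exact: (continuousD (fc _ Ux) (gc _ Ux))) => // i.
have [fid fiC] := fd i; have [gid giC] := gd i.
split=> [x Ux|]; first exact: derivableD (fid _ Ux) (gid _ Ux).
apply: (Ck_eq oU _ (IH _ _ fiC giC)) => x /set_mem Ux.
by rewrite /partial deriveD//; [exact: fid|exact: gid].
Qed.

Lemma CkM k f g U : open U -> Ck k f U -> Ck k g U -> Ck k (f * g) U.
Proof.
move=> oU; elim: k f g => [|k IH] f g fC gC;
  have [fc fd] := fC; have [gc gd] := gC;
  (split=> [x Ux|]; first exact: (continuousM (fc _ Ux) (gc _ Ux))) => // i.
have [fid fiC] := fd i; have [gid giC] := gd i.
split=> [x Ux|]; first exact: derivableM (fid _ Ux) (gid _ Ux).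
apply: (Ck_eq oU _ (CkD oU (IH _ _ (CkW fC) giC) (IH _ _ (CkW gC) fiC))).
by move=> x /set_mem Ux; rewrite /partial deriveM//; [exact: fid|exact: gid].
Qed.

Lemma CkN k f U : open U -> Ck k f U -> Ck k (- f) U.
Proof.
move=> oU fC; apply: (Ck_eq oU _ (CkM oU (Ck_cst k (-1) U) fC)) => x _.
by rewrite [LHS]mulN1r.
Qed.

Lemma CkB k f g U : open U -> Ck k f U -> Ck k g U -> Ck k (f - g) U.
Proof. by move=> oU fC gC; apply: CkD => //; exact: CkN. Qed.

Lemma CkV k f U : open U -> (forall x, U x -> f x != 0) ->
  Ck k f U -> Ck k (fun x => (f x)^-1) U.
Proof.
move=> oU f0; elim: k => [|k IH] fC; have [fc fd] := fC;
  (split=> [x Ux|]; first exact: (continuousV (f0 _ Ux) (fc _ Ux))) => // i.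
have [fid fiC] := fd i.
split=> [x Ux|]; first exact: derivableV (f0 _ Ux) (fid _ Ux).
have iC := IH (CkW fC).
apply: (Ck_eq oU _ (CkN oU (CkM oU (CkM oU iC iC) fiC))).
move=> x /set_mem Ux; rewrite /partial deriveV//; last 2 first.
- exact: f0.
- exact: fid.
by rewrite [LHS]/= scaleNr /GRing.scale/= expr2 invfM.
Qed.

Lemma Ck_ln k f U : open U -> (forall x, U x -> 0 < f x) ->
  Ck k f U -> Ck k (fun x => ln (f x)) U.
Proof.
move=> oU f0; elim: k => [|k IH] fC; have [fc fd] := fC;
  (split=> [x Ux|]; first exact: (continuous_comp (fc _ Ux) (continuous_ln (f0 _ Ux)))) => // i.
have [fid fiC] := fd i.
split=> [x Ux|]; first by have [] := is_derive_ln_comp (f0 _ Ux) (fid _ Ux).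
have fV : Ck k (fun x => (f x)^-1) U.
  by apply: (CkV oU _ (CkW fC)) => x /f0; exact: lt0r_neq0.
apply: (Ck_eq oU _ (CkM oU fV fiC)) => x /set_mem Ux.
by have [_ E] := is_derive_ln_comp (f0 _ Ux) (fid _ Ux); exact/esym.
Qed.

(** Glues two descriptions of the nonlinearity: an explicit formula on one open set, a constant on
    the other. *)
Lemma CkU k f U V : Ck k f U -> Ck k f V -> Ck k f (U `|` V).
Proof.
elim: k f => [|k IH] f [fUc fUd] [fVc fVd];
  (split=> [x []|]; [exact: fUc|exact: fVc|]) => // i.
have [fiU fiUC] := fUd i; have [fiV fiVC] := fVd i.
by split=> [x []|]; [exact: fiU|exact: fiV|exact: IH].
Qed.

Lemma is_derive_coord (i j : 'I_d) (x : 'rV[R]_d) :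
  is_derive x (delta_mx 0 j) (fun y : 'rV[R]_d => y 0 i) (j == i)%:R.
Proof.
have H : derivable (fun y : 'rV[R]_d => y 0 i) x (delta_mx 0 j).
  by apply: diff_derivable; exact: differentiable_coord.
apply: DeriveDef => //; apply: cvg_lim => //.
apply: (@cvg_trans _ ((cst (j == i)%:R : R -> R) @ 0^')); last exact: cvg_cst.
apply: near_eq_cvg; near=> h.
have h0 : h != 0 by near: h; exact: nbhs_dnbhs_neq.
rewrite /= !mxE eqxx /= addrK /GRing.scale/= mulrA mulVf// mul1r.
by rewrite eq_sym.
Unshelve. all: by end_near. Qed.

Lemma Ck_coord k (i : 'I_d) U : Ck k (fun y : 'rV[R]_d => y 0 i) U.
Proof.
case: k => [|k]; (split=> [x _|]; first exact: coord_continuous) => // j.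
split=> [x _|]; first by have [] := is_derive_coord i j x.
suff -> : partial j (fun y : 'rV[R]_d => y 0 i) = cst (j == i)%:R by exact: Ck_cst.
by apply/funext => x; have [_] := is_derive_coord i j x.
Qed.

Lemma Cr_Ck (r : option nat) f U : (forall k, Ck k f U) -> Cr r f U.
Proof. by case: r => [k|]; exact. Qed.

End CkTheory.

(** * A smooth bump *)

Section OneDimensionalBump.
Variable R : realType.
Implicit Types (p q : {poly R}) (s t : R).

(** One term of the exponential series: s^n / n! <= e^s. *)
Lemma exprn_expRN_le n s : 0 <= s -> s ^+ n * expR (- s) <= n`!%:R.
Proof.
move=> s0; rewrite expRN ler_pdivrMr ?expR_gt0//.
case: n => [|n]; first by rewrite expr0 fact0 mul1r -expR0 ler_expR.
have f0 : 0 < (n.+1)`!%:R :> R by rewrite ltr0n fact_gt0.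
have := expR_ge1Dxn n s0; rewrite -(ler_pM2l f0) mulrDr mulr1.
by apply: le_trans; rewrite mulrCA divff ?gt_eqF// mulr1 lerDr ltW.
Qed.

Lemma poly_expR_bounded p :
  exists2 C, 0 <= C & forall s, 0 <= s -> `|p.[s] * expR (- s)| <= C.
Proof.
exists (\sum_(i < size p) `|p`_i| * i`!%:R); first exact: sumr_ge0.
move=> s s0; rewrite horner_coef mulr_suml.
apply: le_trans (ler_norm_sum _ _ _) _; apply: ler_sum => i _.
rewrite -mulrA normrM ler_wpM2l// ger0_norm ?exprn_expRN_le//.
by rewrite mulr_ge0 ?exprn_ge0 ?expR_ge0.
Qed.

(** The functions p(1/t) e^(-1/t), extended by 0 to t <= 0, form a class stable under
    differentiation; p = 1 gives the classical flat function. *)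
Definition flat p t : R := if 0 < t then p.[t^-1] * expR (- t^-1) else 0.

(** With s = 1/t one has d/dt = - s^2 d/ds, which turns p(s) e^(-s) into s^2 (p - p')(s) e^(-s). *)
Definition flat_deriv p : {poly R} := 'X^2 * (p - p^`()).

Lemma flat_bounded p : exists2 C, 0 <= C & forall t, `|flat p t| <= C.
Proof.
have [C C0 pC] := poly_expR_bounded p; exists C => // t; rewrite /flat.
by case: ifPn => [t0|_]; [apply: pC; rewrite invr_ge0 ltW|rewrite normr0].
Qed.

Lemma is_derive_flat p t : is_derive t 1 (flat p) (flat (flat_deriv p) t).
Proof.
have [t0|t0|->] := ltgtP t 0.
- rewrite {2}/flat ltNge ltW//=.
  apply: (@near_eq_is_derive _ _ _ (cst 0)).
  have /= : open_nbhs t [set u : R | u < 0] by split=> //; exact: open_lt.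
  move=> /open_nbhs_nbhs; apply: filterS => u /= u0.
  by rewrite /flat ltNge ltW.
- rewrite {2}/flat t0.
  have dV : is_derive t 1 (fun u : R => u^-1) (- t ^- 2 * 1).
    by apply: is_deriveV; rewrite ?gt_eqF//; exact: is_derive_id.
  have dp := @is_derive1_comp _ (horner p) _ _ _ _ (is_derive_poly _ _) dV.
  have dE := @is_derive1_comp _ expR _ _ _ _ (is_derive_expR _) (is_deriveN dV).
  have D : is_derive t 1 (fun u => p.[u^-1] * expR (- u^-1))
      ((flat_deriv p).[t^-1] * expR (- t^-1)).
    apply: is_derive_eq (is_deriveM dp dE) _.
    rewrite /GRing.scale/= /flat_deriv !hornerE/=.
    by rewrite exprVn; ring.
  apply: near_eq_is_derive D.
  have /= : open_nbhs t [set u : R | 0 < u] by split=> //; exact: open_gt.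
  move=> /open_nbhs_nbhs; apply: filterS => u /= u0.
  by rewrite /flat u0.
- rewrite {2}/flat ltxx; have [C C0 pC] := flat_bounded ('X^2 * p).
  (* Boundedness of the flat function of ['X^2 * p] says that [flat p] is O(h^2) at 0, whence a zero
     derivative there. *)
  have pC2 h : `|flat p h| <= C * h ^+ 2.
    rewrite {1}/flat; case: ifPn => [h0|_]; last by rewrite normr0 mulr_ge0// sqr_ge0.
    rewrite -ler_pdivrMr ?exprn_gt0//.
    apply: le_trans (pC h); rewrite /flat h0 !hornerE -mulrA normrM mulrC.
    by rewrite exprVn !normrM (@ger0_norm _ (h ^- 2))// invr_ge0 exprn_ge0// ltW.
  suff cv : (fun h : R => h^-1 *: ((flat p \o shift 0) (h *: 1) - flat p 0)) @ 0^' --> (0 : R).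
    by constructor; [apply/cvg_ex; exists 0; exact: cv|exact: cvg_lim cv].
  apply/cvgr0Pnorm_le => e e0.
  near=> h.
  have h0 : h != 0 by near: h; exact: nbhs_dnbhs_neq.
  rewrite /= addr0 {2}/flat ltxx subr0 /GRing.scale/= mulr1 normrM normfV.
  rewrite ler_pdivrMl ?normr_gt0//; apply: le_trans (pC2 h) _.
  rewrite -(real_normK (num_real h)) expr2 mulrA [leRHS]mulrC ler_wpM2r//.
  have : `|h| <= e / (C + 1).
    near: h; apply: dnbhs0_le; by rewrite divr_gt0// ltr_wpDl.
  rewrite ler_pdivlMr ?ltr_wpDl//; apply: le_trans.
  by rewrite [leRHS]mulrC ler_wpM2r// lerDl.
Unshelve. all: by end_near. Qed.

Lemma flatN p t : flat (- p) t = - flat p t.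
Proof. by rewrite /flat; case: ifP; rewrite ?oppr0// hornerN mulNr. Qed.

(** Every derivative of a product of two flat functions, one at each end of the interval, is a
    finite sum of such products. The list stores the pairs of polynomials, so that differentiation
    becomes symbolic. *)
Definition bump_sum (a b : R) (L : seq ({poly R} * {poly R})) t : R :=
  \sum_(pq <- L) flat pq.1 (t - a) * flat pq.2 (b - t).

(** Leibniz's rule on each pair; the minus sign comes from the second factor being a function of b -
    t. *)
Definition bump_deriv (L : seq ({poly R} * {poly R})) :=
  flatten [seq [:: (flat_deriv pq.1, pq.2); (pq.1, - flat_deriv pq.2)]
    | pq <- L].

(** The derivative of order n of the bump e^(-1/(t-a)) e^(-1/(b-t)) supported in [a, b]. *)
Definition smooth_bump (a b : R) n : R -> R := bump_sum a b (iter n bump_deriv [:: (1, 1)]).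

Lemma is_derive_bump_sum a b L t :
  is_derive t 1 (bump_sum a b L) (bump_sum a b (bump_deriv L) t).
Proof.
elim: L => [|[p q] L IH].
  have -> : bump_sum a b [::] = cst 0 by apply/funext => s; rewrite /bump_sum big_nil.
  exact: is_derive_cst.
have d1 : is_derive t 1 (fun u : R => u - a) 1.
  exact: is_derive_eq (is_deriveB (is_derive_id t 1) (is_derive_cst a t 1)) (subr0 1).
have d2 : is_derive t 1 (fun u : R => b - u) (- 1).
  exact: is_derive_eq (is_deriveB (is_derive_cst b t 1) (is_derive_id t 1)) (add0r _).
have dp := @is_derive1_comp _ (flat p) _ _ _ _ (is_derive_flat _ _) d1.
have dq := @is_derive1_comp _ (flat q) _ _ _ _ (is_derive_flat _ _) d2.
have -> : bump_sum a b (bump_deriv ((p, q) :: L)) t =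
    (flat p (t - a) * (flat (flat_deriv q) (b - t) * -1) +
    flat q (b - t) * (flat (flat_deriv p) (t - a) * 1)) +
    bump_sum a b (bump_deriv L) t.
  rewrite /bump_deriv/= /bump_sum !big_cons/= flatN; ring.
suff -> : bump_sum a b ((p, q) :: L) =
    (flat p \o (fun u : R => u - a)) * (flat q \o (fun u : R => b - u)) + bump_sum a b L.
  exact: is_deriveD (is_deriveM dp dq) IH.
by apply/funext => s; rewrite /bump_sum big_cons.
Qed.

Lemma is_derive_smooth_bump a b n t : is_derive t 1 (smooth_bump a b n) (smooth_bump a b n.+1 t).
Proof. exact: is_derive_bump_sum. Qed.

Lemma smooth_bump_bounded a b n : exists C, forall t, `|smooth_bump a b n t| <= C.
Proof.
rewrite /smooth_bump; elim: (iter _ _ _) => [|[p q] L [C CL]].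
  by exists 0 => t; rewrite /bump_sum big_nil normr0.
have [Cp _ pC] := flat_bounded p; have [Cq _ qC] := flat_bounded q.
exists (Cp * Cq + C) => t; rewrite /bump_sum big_cons.
by apply: le_trans (ler_normD _ _) _; rewrite lerD ?CL//= normrM ler_pM.
Qed.

Lemma smooth_bump_gt0 a b t : (0 < smooth_bump a b 0 t) = (a < t < b).
Proof.
rewrite /smooth_bump /bump_sum/= big_cons big_nil addr0/= /flat !subr_gt0.
case: (ltP a t) => ta; last by rewrite mul0r ltxx.
by case: (ltP t b) => tb; rewrite ?mulr0 ?ltxx// !hornerC !mul1r mulr_gt0 ?expR_gt0.
Qed.

Lemma smooth_bump_ge0 a b t : 0 <= smooth_bump a b 0 t.
Proof.
rewrite /smooth_bump /bump_sum/= big_cons big_nil addr0/= /flat.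
by apply: mulr_ge0; case: ifP => // _; rewrite hornerC mul1r expR_ge0.
Qed.

Lemma MVT_nbhs (f df : R -> R) : (forall t, is_derive t 1 f (df t)) ->
  forall x y, exists2 c, `|c - x| <= `|y - x| & f y - f x = df c * (y - x).
Proof.
move=> fdf x y; have fc : continuous f.
  by move=> t; apply/differentiable_continuous/derivable1_diffP; have [] := fdf t.
have [xy|yx|->] := ltgtP x y; last by exists y; rewrite // !subrr mulr0.
- have [|c] := @MVT _ f df _ _ xy (fun x _ => fdf x).
    exact: continuous_subspaceT.
  rewrite in_itv/= => /andP[xc cy] E; exists c => //.
  by rewrite !ger0_norm ?subr_ge0 ?(ltW xy) ?(ltW xc)// lerD2r ltW.
- have [|c] := @MVT _ f df _ _ yx (fun x _ => fdf x).
    exact: continuous_subspaceT.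
  rewrite in_itv/= => /andP[yc cx] E; exists c.
    by rewrite !ler0_norm ?subr_le0 ?(ltW yx) ?(ltW cx)// lerN2 lerD2r ltW.
  by rewrite -[LHS]opprB E -mulrN opprB.
Qed.

Lemma lipschitz_of_derive_bounded (f df : R -> R) (C : R) :
  (forall t, is_derive t 1 f (df t)) -> (forall t, `|df t| <= C) ->
  forall s t, `|f s - f t| <= C * `|s - t|.
Proof.
move=> fdf dfC s t; have [c _ ->] := MVT_nbhs fdf t s.
by rewrite normrM ler_wpM2r.
Qed.

(** Two successive mean value estimates, at the price of a factor 2 over the sharp constant. *)
Lemma taylor_of_derive_bounded (f df ddf : R -> R) (C : R) :
  (forall t, is_derive t 1 f (df t)) -> (forall t, is_derive t 1 df (ddf t)) ->
  (forall t, `|ddf t| <= C) ->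
  forall s t, `|f (s + t) - f s - t * df s| <= C * t ^+ 2.
Proof.
move=> fdf dfddf ddfC s t.
have C0 : 0 <= C by apply: le_trans (ddfC 0).
have [c cs ->] := MVT_nbhs fdf s (s + t).
have sts : s + t - s = t by ring.
rewrite sts in cs *; rewrite mulrC -mulrBr normrM -real_normK ?num_real//.
rewrite expr2 mulrCA ler_wpM2l//.
apply: le_trans (lipschitz_of_derive_bounded dfddf ddfC _ _) _.
by rewrite ler_wpM2l.
Qed.

End OneDimensionalBump.

(** * Families of functions with explicit bounds on all derivatives *)

Section SmoothFamilies.
Variables (R : realType) (d : nat).
Implicit Types (g : seq 'I_d -> 'rV[R]_d -> R) (C : seq 'I_d -> R).

(* g w plays the role of the partial derivative of g [::] along the word w. *)
Definition smooth_family g C := forall w,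
  [/\ forall x, `|g w x| <= C w,
      forall x y, `|g w x - g w y| <= C w * `|x - y| &
      forall i x t,
        `|g w (x + t *: delta_mx 0 i) - g w x - t * g (i :: w) x| <= C w * t ^+ 2].

Lemma smooth_family_ge0 g C w : smooth_family g C -> 0 <= C w.
Proof. by move=> /(_ w) [gC _ _]; apply: le_trans (gC 0). Qed.

Lemma lipschitz_continuous_for (f : 'rV[R]_d -> R) (c : R) :
  (forall x y, `|f x - f y| <= c * `|x - y|) -> continuous f.
Proof.
move=> fc x; apply: (@cvgrPdist_le _ _ _ (nbhs x) (nbhs_filter x) _ _).2 => e e0.
have c1 : 0 < `|c| + 1 by rewrite ltr_wpDl.
have /cvgrPdist_le/(_ (e / (`|c| + 1))) := @cvg_id _ (nbhs x).
rewrite divr_gt0// => /(_ isT); apply: filterS => y.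
rewrite ler_pdivlMr// => xy; apply: le_trans (fc _ _) _.
apply: le_trans xy; rewrite mulrC ler_wpM2l//.
by rewrite (le_trans (ler_norm _))// lerDl.
Qed.

(** The third condition is a first-order expansion with quadratic remainder: the difference quotient
    at step h is within [C w * |h|] of [g (i :: w) x]. *)
Lemma is_derive_smooth_family g C w i x : smooth_family g C ->
  is_derive x (delta_mx 0 i) (g w) (g (i :: w) x).
Proof.
move=> gC; have C0 := smooth_family_ge0 w gC.
suff cv : (fun h : R => h^-1 *: ((g w \o shift x) (h *: delta_mx 0 i) - g w x)) @ 0^' -->
    g (i :: w) x.
  by constructor; [apply/cvg_ex; exists (g (i :: w) x); exact: cv|exact: cvg_lim cv].
apply/cvgrPdist_le => e e0; near=> h.
have h0 : h != 0 by near: h; exact: nbhs_dnbhs_neq.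
have hn0 : 0 < `|h| by rewrite normr_gt0.
have [_ _ /(_ i x h) T] := gC w.
rewrite -(ler_pM2l hn0) -normrM mulrBr /GRing.scale/= mulrA mulfV// mul1r.
rewrite distrC [h *: _ + x]addrC; apply: le_trans T _.
rewrite -(real_normK (num_real h)) expr2 mulrCA ler_wpM2l//.
have : `|h| <= e / (C w + 1).
  by near: h; apply: dnbhs0_le; rewrite divr_gt0// ltr_wpDl.
rewrite ler_pdivlMr ?ltr_wpDl//; apply: le_trans.
by rewrite mulrC ler_wpM2l// lerDl.
Unshelve. all: by end_near. Qed.

Lemma smooth_family_Ck g C k w U : smooth_family g C -> Ck k (g w) U.
Proof.
move=> gC; elim: k w => [|k IH] w;
  (split=> [x _|]; first by have [_ /lipschitz_continuous_for + _] := gC w; exact) => // i.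
split=> [x _|]; first by have [] := is_derive_smooth_family w i x gC.
suff -> : partial i (g w) = g (i :: w) by exact: IH.
by apply/funext => x; have [_] := is_derive_smooth_family w i x gC.
Qed.

End SmoothFamilies.

Section Series.
Variable R : realType.
Implicit Types u v : R ^nat.

Lemma is_cvg_series_dominated u v : (forall n, `|u n| <= v n) ->
  cvgn (series v) -> cvgn (series u).
Proof.
move=> uv vc; apply: normed_cvg; apply: (series_le_cvg _ _ uv vc) => n //.
exact: le_trans (uv n).
Qed.

Lemma cvg_series_dominated u v (l c : R) : series u @ \oo --> l ->
  cvgn (series v) -> 0 <= c -> (forall n, `|u n| <= v n * c) ->
  `|l| <= limn (series v) * c.
Proof.
move=> ul vc c0 uvc.
have ncv : (fun n => `|series u n|) @ \oo --> `|l| by exact: cvg_norm.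
have vcc : (fun n => series v n * c) @ \oo --> limn (series v) * c.
  by apply: cvgM; [exact: vc|exact: cvg_cst].
rewrite -(cvg_lim _ ncv)// -(cvg_lim _ vcc)//.
apply: ler_lim; [exact: (cvgP _ ncv)|exact: (cvgP _ vcc)|].
apply: nearW => n; rewrite /series/= mulr_suml.
by apply: le_trans (ler_norm_sum _ _ _) _; exact: ler_sum.
Qed.

Lemma is_cvg_series_half u m : (forall n, 0 <= u n) ->
  (forall n, (m <= n)%N -> u n <= 2^-1 ^+ n) -> cvgn (series u).
Proof.
(* A is large enough for A / 2^n to bound also the finitely many terms of rank below m. *)
move=> u0 um; pose A := 1 + \sum_(k < m) u k * 2 ^+ k.
apply: (@is_cvg_series_dominated _ (geometric A 2^-1)); last first.
  by apply: is_cvg_geometric_series; rewrite ger0_norm ?invr_ge0// invf_lt1 ?ltr1n.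
have S0 : 0 <= \sum_(k < m) u k * 2 ^+ k.
  by apply: sumr_ge0 => k _; rewrite mulr_ge0// exprn_ge0.
move=> n; rewrite ger0_norm//=; have [nm|mn] := ltnP n m; last first.
  by apply: le_trans (um _ mn) _; rewrite ler_peMl ?exprn_ge0 ?invr_ge0// lerDl.
rewrite exprVn ler_pdivlMr ?exprn_gt0//.
rewrite /A (bigD1 (Ordinal nm))//= addrCA lerDl addr_ge0//.
by apply: sumr_ge0 => k _; rewrite mulr_ge0// exprn_ge0.
Qed.

End Series.

(** * Termwise differentiation of a weighted series *)

Section WeightedSum.
Variables (R : realType) (d : nat).
Variables (g : nat -> seq 'I_d -> 'rV[R]_d -> R) (C : nat -> seq 'I_d -> R).
Hypothesis gC : forall n, smooth_family (g n) (C n).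

(** Numbering the words makes the bounds for all words of code at most n a finite sum. *)
Definition code_bound n j : R :=
  if @choice.unpickle (seq 'I_d) j is Some w then C n w else 0.

(* Small enough for the series of derivatives along every single word w to
   converge: its tail from the rank [pickle w] on is geometric. *)
Definition weight n : R := 2^-1 ^+ n / (1 + \sum_(j < n.+1) code_bound n j).

Let C0 n w : 0 <= C n w. Proof. exact: smooth_family_ge0 (gC n). Qed.

Let code_bound_ge0 n j : 0 <= code_bound n j.
Proof. by rewrite /code_bound; case: choice.unpickle. Qed.

Lemma weight_gt0 n : 0 < weight n.
Proof. by rewrite /weight divr_gt0 ?exprn_gt0 ?invr_gt0 ?ltr_wpDr ?sumr_ge0. Qed.

Lemma weight_tail (w : seq 'I_d) n :
  (choice.pickle w <= n)%N -> weight n * C n w <= 2^-1 ^+ n.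
Proof.
move=> wn; rewrite /weight mulrAC ler_pdivrMr ?ltr_wpDr ?sumr_ge0// ler_wpM2l//.
have -> : C n w = code_bound n (choice.pickle w) by rewrite /code_bound choice.pickleK.
have wn1 : (choice.pickle w < n.+1)%N by [].
by rewrite (bigD1 (Ordinal wn1))//= addrCA lerDl addr_ge0// sumr_ge0.
Qed.

Lemma is_cvg_weighted_bound w : cvgn (series (fun n => weight n * C n w)).
Proof.
apply: (@is_cvg_series_half _ _ (choice.pickle w)) => [n|]; last exact: weight_tail.
by rewrite mulr_ge0// ltW// weight_gt0.
Qed.

Definition weighted_sum w x : R := limn (series (fun n => weight n * g n w x)).

Let term_le n w x : `|weight n * g n w x| <= weight n * C n w.
Proof.
rewrite normrM gtr0_norm ?weight_gt0// ler_wpM2l ?(ltW (weight_gt0 n))//.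
by have [+ _ _] := gC n w; exact.
Qed.

Lemma is_cvg_weighted_sum w x : cvgn (series (fun n => weight n * g n w x)).
Proof.
exact: (is_cvg_series_dominated (fun n => term_le n w x) (@is_cvg_weighted_bound w)).
Qed.

Let bound w : R := limn (series (fun n => weight n * C n w)).

Let cvg_weighted_sum w x :
  series (fun n => weight n * g n w x) @ \oo --> weighted_sum w x.
Proof. exact: (@is_cvg_weighted_sum w x). Qed.

(** The three conditions are inequalities between expressions linear in the family, so they hold for
    partial sums and pass to the limit. *)
Lemma smooth_family_weighted_sum : smooth_family weighted_sum bound.
Proof.
move=> w; split.
- move=> x; rewrite -[bound w]mulr1.
  apply: (cvg_series_dominated (@cvg_weighted_sum w x) (@is_cvg_weighted_bound w)) => // n.
  by rewrite mulr1 term_le.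
- move=> x y.
  apply: (@cvg_series_dominated _ (fun n => weight n * (g n w x - g n w y)) _ _ _ _
    (@is_cvg_weighted_bound w)) => // [|n].
    rewrite (_ : series _ = series (fun n => weight n * g n w x) -
        series (fun n => weight n * g n w y)).
      exact: cvgB (@cvg_weighted_sum w x) (@cvg_weighted_sum w y).
    apply/funext => n; rewrite /series/= !fctE -sumrB.
    by apply: eq_bigr => k _; rewrite mulrBr.
  rewrite normrM gtr0_norm ?weight_gt0// -mulrA.
  by rewrite ler_wpM2l ?(ltW (weight_gt0 n))//; have [_ + _] := gC n w; exact.
- move=> i x t.
  apply: (@cvg_series_dominated _ (fun n => weight n *
    (g n w (x + t *: delta_mx 0 i) - g n w x - t * g n (i :: w) x)) _ _ _ _
    (@is_cvg_weighted_bound w)) => [||n].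
  + have ct : (fun n => t * series (fun n => weight n * g n (i :: w) x) n) @ \oo -->
        t * weighted_sum (i :: w) x.
      by apply: cvgM; [exact: cvg_cst|exact: cvg_weighted_sum].
    rewrite (_ : series _ = series (fun n => weight n * g n w (x + t *: delta_mx 0 i)) -
        series (fun n => weight n * g n w x) -
        (fun n => t * series (fun n => weight n * g n (i :: w) x) n)).
      exact: cvgB (cvgB (@cvg_weighted_sum w _) (@cvg_weighted_sum w x)) ct.
    apply/funext => n; rewrite /series/= !fctE mulr_sumr -!sumrB.
    by apply: eq_bigr => k _; rewrite !mulrBr [t * (_ * _)]mulrCA.
  + exact: sqr_ge0.
  + rewrite normrM gtr0_norm ?weight_gt0// -mulrA.
    by rewrite ler_wpM2l ?(ltW (weight_gt0 n))//; have [_ _] := gC n w; exact.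
Qed.

End WeightedSum.

Section BoxBump.
Variables (R : realType) (d : nat).
Implicit Types (a b x y : 'rV[R]_d).

(** In a product of functions of separate variables, differentiating along the word w differentiates
    the i-th factor as many times as i occurs in w. *)
Definition box_bump a b (w : seq 'I_d) x : R :=
  \prod_i smooth_bump (a 0 i) (b 0 i) (count_mem i w) (x 0 i).

(** Telescoping: the factors are changed one at a time, and each change costs at most e times the
    product of all bounds. *)
Lemma prod_lipschitz (I : Type) (r : seq I) (u v B : I -> R) (e : R) :
  0 <= e -> (forall i, 1 <= B i) ->
  (forall i, `|u i| <= B i) -> (forall i, `|v i| <= B i) ->
  (forall i, `|u i - v i| <= B i * e) ->
  `|\prod_(i <- r) u i - \prod_(i <- r) v i| <=
    (size r)%:R * \prod_(i <- r) B i * e.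
Proof.
move=> e0 B1 uB vB uvB; elim: r => [|i r IH].
  by rewrite !big_nil subrr normr0 !mul0r.
rewrite !big_cons; set U := \prod_(j <- r) u j; set V := \prod_(j <- r) v j.
set P := \prod_(j <- r) B j.
have -> : u i * U - v i * V = u i * (U - V) + (u i - v i) * V by ring.
apply: le_trans (ler_normD _ _) _; rewrite !normrM.
have VP : `|V| <= P by rewrite /V normr_prod ler_prod// => j _; rewrite normr_ge0 vB.
have -> : (size (i :: r))%:R * (B i * P) * e =
    B i * ((size r)%:R * P * e) + B i * e * P by rewrite /= -natr1; ring.
by rewrite lerD// ler_pM.
Qed.

Lemma norm_coord_le x i : `|x 0 i| <= `|x|.
Proof. by rewrite [leRHS]/Num.norm/= mx_normrE; exact: (le_bigmax _ (fun ij : 'I_1 * 'I_d => `|x ij.1 ij.2|) (0, i)). Qed.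

Lemma box_bump_smooth a b : exists C, smooth_family (box_bump a b) C.
Proof.
pose D i n t := smooth_bump (a 0 i) (b 0 i) n t.
have /choice[B' B'D] : forall ij : 'I_d * nat, exists C, forall t, `|D ij.1 ij.2 t| <= C.
  by move=> [i n]; exact: smooth_bump_bounded.
(* One number bounds three consecutive derivatives: for the size, the Lipschitz estimate and the
   Taylor remainder of order two. The summand 1 provides the lower bound asked by
   [prod_lipschitz]. *)
pose B i n := 1 + `|B' (i, n)| + `|B' (i, n.+1)| + `|B' (i, n.+2)|.
have DB i n k t : (k < 3)%N -> `|D i (k + n)%N t| <= B i n.
  have [h0 [h1 h2]] := (normr_ge0 (B' (i, n)), (normr_ge0 (B' (i, n.+1)), normr_ge0 (B' (i, n.+2)))).
  case: k => [|[|[|//]]] _; rewrite ?add0n ?add1n ?add2n;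
    apply: le_trans (B'D (i, _) t) _; apply: le_trans (ler_norm _) _; rewrite /B; lra.
have B1 i n : 1 <= B i n by rewrite /B -!addrA lerDl !addr_ge0.
have B0 i n : 0 <= B i n := le_trans ler01 (B1 i n).
have dD i n t := is_derive_smooth_bump (a 0 i) (b 0 i) n t.
pose P w := \prod_i B i (count_mem i w).
have P1 w : 0 <= P w by apply: prodr_ge0.
(* The Lipschitz estimate costs a factor d, the other two a factor 1; d + 1 covers all three, also
   for d = 0. *)
exists (fun w => d.+1%:R * P w) => w; split.
- move=> x; rewrite /box_bump normr_prod; apply: (@le_trans _ _ (P w)).
    by apply: ler_prod => i _; rewrite normr_ge0; exact: (@DB _ _ 0%N).
  by rewrite ler_peMl// ler1n.
- move=> x y; apply: le_trans (@prod_lipschitz _ (index_enum 'I_d)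
    (fun i => D i (count_mem i w) (x 0 i)) (fun i => D i (count_mem i w) (y 0 i))
    (fun i => B i (count_mem i w)) `|x - y| (normr_ge0 _) _ _ _ _) _ => //.
  + by move=> i; exact: (@DB _ _ 0%N).
  + by move=> i; exact: (@DB _ _ 0%N).
  + move=> i; apply: le_trans (lipschitz_of_derive_bounded (dD i _)
      (fun t => @DB i (count_mem i w) 1%N t isT) _ _) _.
    by rewrite ler_wpM2l//; have := norm_coord_le (x - y) i; rewrite !mxE.
  + apply: ler_wpM2r => //; apply: ler_wpM2r; [exact: P1|rewrite ler_nat].
    by rewrite -[size _]/(size (index_enum 'I_d)) /index_enum -enumT size_enum_ord.
- move=> i x t; pose Q := \prod_(j | j != i) D j (count_mem j w) (x 0 j).
  have -> : box_bump a b w (x + t *: delta_mx 0 i) =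
      D i (count_mem i w) (x 0 i + t) * Q.
    rewrite /box_bump (bigD1 i)//= !mxE !eqxx mulr1; congr (_ * _).
    by apply: eq_bigr => j ji; rewrite !mxE eqxx (negbTE ji) mulr0 addr0.
  have -> : box_bump a b w x = D i (count_mem i w) (x 0 i) * Q.
    by rewrite /box_bump (bigD1 i).
  have -> : box_bump a b (i :: w) x = D i (count_mem i w).+1 (x 0 i) * Q.
    rewrite /box_bump (bigD1 i)//= eqxx add1n; congr (_ * _).
    by apply: eq_bigr => j ji; rewrite eq_sym (negbTE ji).
  rewrite mulrA -!mulrBl normrM.
  have -> : d.+1%:R * P w * t ^+ 2 = d.+1%:R * (B i (count_mem i w) * t ^+ 2 *
      \prod_(j | j != i) B j (count_mem j w)).
    by rewrite /P (bigD1 i)//=; ring.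
  rewrite -[leLHS]mul1r; apply: ler_pM => //; rewrite ?ler1n//; apply: ler_pM => //.
    apply: taylor_of_derive_bounded (dD i _) (dD i _) _ _ _ => u.
    exact: (@DB _ _ 2%N).
  by rewrite /Q normr_prod; apply: ler_prod => j _; rewrite normr_ge0; exact: (@DB _ _ 0%N).
Qed.

Lemma box_bump_ge0 a b x : 0 <= box_bump a b [::] x.
Proof. by apply: prodr_ge0 => i _; exact: smooth_bump_ge0. Qed.

Lemma box_bump_gt0 a b x :
  (forall i, a 0 i < x 0 i < b 0 i) -> 0 < box_bump a b [::] x.
Proof. by move=> axb; apply: prodr_gt0 => i _; rewrite smooth_bump_gt0. Qed.

Lemma box_bump_neq0 a b x :
  box_bump a b [::] x != 0 -> forall i, a 0 i < x 0 i < b 0 i.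
Proof.
move=> nz i; rewrite -smooth_bump_gt0 lt_neqAle smooth_bump_ge0 andbT eq_sym.
by apply: contraNneq nz => z; rewrite /box_bump (bigD1 i)//= z mul0r.
Qed.

End BoxBump.

(** * Smooth functions with a prescribed zero set *)

Section SmoothZeroSet.
Variables (R : realType) (d : nat).

Definition box (a b : 'rV[R]_d) : set 'rV[R]_d :=
  [set x | forall i, a 0 i < x 0 i < b 0 i].

Lemma smooth_family0 : smooth_family (fun (_ : seq 'I_d) (_ : 'rV[R]_d) => 0) (fun=> 0).
Proof. by move=> w; split=> *; rewrite ?mulr0 ?subr0 ?normr0 ?mul0r. Qed.

Lemma rational_box (A : set 'rV[R]_d) x : open A -> A x ->
  exists ab : 'rV[rat]_d * 'rV[rat]_d,
    box (map_mx ratr ab.1) (map_mx ratr ab.2) x /\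
    box (map_mx ratr ab.1) (map_mx ratr ab.2) `<=` A.
Proof.
move=> oA Ax; have /nbhs_ballP[e /= e0 eA] := open_nbhs_nbhs (conj oA Ax).
have /choice[a aP] i : exists q : rat, x 0 i - e < ratr q < x 0 i.
  have [|q] := @rat_in_itvoo R (x 0 i - e) (x 0 i); first by rewrite ltrBlDr ltrDl.
  by rewrite in_itv; exists q.
have /choice[b bP] i : exists q : rat, x 0 i < ratr q < x 0 i + e.
  have [|q] := @rat_in_itvoo R (x 0 i) (x 0 i + e); first by rewrite ltrDl.
  by rewrite in_itv; exists q.
exists (\row_i a i, \row_i b i); split=> [i|y xy].
  by rewrite !mxE/=; have /andP[_ ->] := aP i; have /andP[-> _] := bP i.
apply: eA; split=> // i j; rewrite (ord1 i) /ball/= ltr_norml.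
have := xy j; rewrite !mxE/= => /andP[ay yb].
have /andP[xa _] := aP j; have /andP[_ bx] := bP j.
by apply/andP; split; lra.
Qed.

(** The rational boxes that miss A cover its complement. With positive weights, a sum of nonnegative
    bumps vanishes exactly where all of them do; codes of other boxes contribute the zero
    function. *)
Theorem smooth_zero_set (A : set 'rV[R]_d) : closed A ->
  exists f : 'rV[R]_d -> R,
    [/\ forall k, Ck k f setT, forall x, 0 <= f x & forall x, f x = 0 <-> A x].
Proof.
move=> cA.
pose in_box (ab : 'rV[rat]_d * 'rV[rat]_d) :=
  box (map_mx ratr ab.1) (map_mx ratr ab.2) `<=` ~` A.
pose g n : seq 'I_d -> 'rV[R]_d -> R :=
  if @choice.unpickle ('rV[rat]_d * 'rV[rat]_d)%type n is Some ab then
    if pselect (in_box ab) then box_bump (map_mx ratr ab.1) (map_mx ratr ab.2)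
    else fun _ _ => 0
  else fun _ _ => 0.
have /choice[C gC] n : exists C, smooth_family (g n) C.
  rewrite /g; case: choice.unpickle => [ab|]; last by exists (fun=> 0); exact: smooth_family0.
  case: (pselect (in_box ab)) => ? /=; last by exists (fun=> 0); exact: smooth_family0.
  exact: box_bump_smooth.
have g0 n x : 0 <= g n [::] x.
  rewrite /g; case: choice.unpickle => [ab|]//.
  by case: (pselect (in_box ab)) => ? /=; [exact: box_bump_ge0|].
have gA n x : A x -> g n [::] x = 0.
  move=> Ax; rewrite /g; case: choice.unpickle => [ab|]//.
  case: (pselect (in_box ab)) => abA /=; last by []; apply: contrapT => /eqP nz.
  by apply: (abA x) => //; exact: box_bump_neq0.
have sc x := @is_cvg_weighted_sum _ _ _ _ gC [::] x.
have W n := weight_gt0 gC n.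
exists (weighted_sum g C [::]); split.
- by move=> k; exact: (smooth_family_Ck _ _ _ (smooth_family_weighted_sum gC)).
- move=> x; apply: limr_ge; first exact: sc.
  by apply: nearW => n; apply: sumr_ge0 => k _; rewrite mulr_ge0// ltW.
- move=> x; split=> [fx0|Ax]; last first.
    rewrite /weighted_sum (_ : series _ = cst 0) ?lim_cst//.
    by apply/funext => n; rewrite /series/= big1// => k _; rewrite gA// mulr0.
  apply: contrapT => nAx.
  have oA : open (~` A) by exact: closed_openC.
  have [ab [xab abA]] := rational_box oA nAx.
  pose N := choice.pickle ab.
  have gN : 0 < g N [::] x.
    rewrite /g /N choice.pickleK; case: (pselect (in_box ab)) => [?/=|//].
    exact: box_bump_gt0.
  have : 0 < weighted_sum g C [::] x.
    apply: (@lt_le_trans _ _ (weight C N * g N [::] x)); first by rewrite mulr_gt0.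
    apply: limr_ge; first exact: sc.
    exists N.+1 => // n /= Nn; rewrite /series/=.
    rewrite big_mkord (bigD1 (Ordinal Nn))//= lerDl.
    by apply: sumr_ge0 => k _; rewrite mulr_ge0// ltW.
  by rewrite fx0 ltxx.
Qed.

Lemma Ck_continuous k (f : 'rV[R]_d -> R) : Ck k f setT -> continuous f.
Proof. by move=> fC x; exact: Ck_cont fC x I. Qed.

(* The quotient f/(f+g) of two functions with prescribed zero sets. *)
Theorem smooth_cutoff (K O : set 'rV[R]_d) :
  compact K -> K !=set0 -> open O -> K `<=` O ->
  exists (chi : 'rV[R]_d -> R) (S : set 'rV[R]_d),
    [/\ forall k, Ck k chi setT, forall x, 0 <= chi x <= 1,
        forall x, chi x = 1 <-> K x &
        [/\ closed S, S `<=` O & forall x, ~ S x -> chi x = 0]].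
Proof.
move=> cK K0 oO KO; have [u [uC u0 uO]] := smooth_zero_set (open_closedC oO).
have uc := Ck_continuous (uC 0).
have [x1 /set_mem Kx1 umin] := EVT_min_rV K0 cK (continuous_subspaceT uc).
have m0 : 0 < u x1.
  by rewrite lt_neqAle u0 andbT eq_sym; apply/eqP => /uO; apply; exact: KO.
have m20 : u x1 / 2 < u x1 by rewrite ltr_pdivrMr// ltr_pMr// ltr1n.
(* As u vanishes exactly off O, half its minimum over K gives an open V and a closed S with K inside
   V, V inside S and S inside O. *)
pose V := [set x | u x1 / 2 < u x]; pose S := [set x | u x1 / 2 <= u x].
have oV : open V.
  exact: (@open_comp _ _ u [set t | u x1 / 2 < t] (fun w _ => uc w) (@open_gt _ _)).
have cS : closed S.
  exact: (@closed_comp _ _ u [set t | u x1 / 2 <= t] (fun w _ => uc w) (@closed_ge _ _)).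
have SO : S `<=` O.
  move=> x; rewrite /S/= => ux; apply: contrapT => /uO ux0.
  by move: ux; rewrite ux0 leNgt divr_gt0.
have KV : K `<=` V by move=> x Kx; apply: lt_le_trans m20 (umin _ (mem_set Kx)).
(* f vanishes exactly off V and g exactly on K, hence never together. *)
have [f [fC f0 fV]] := smooth_zero_set (open_closedC oV).
have [g [gC g0 gK]] := smooth_zero_set (compact_closed (@norm_hausdorff _ _) cK).
have fg x : 0 < f x + g x.
  rewrite lt_neqAle addr_ge0// andbT eq_sym paddr_eq0//.
  apply/negP => /andP[/eqP/fV nVx /eqP/gK Kx]; exact: nVx (KV _ Kx).
exists (fun x => f x / (f x + g x)), S; split.
- move=> k; apply: (@CkM _ _ _ f (fun x => (f x + g x)^-1)) => //; first exact: openT.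
  apply: (@CkV _ _ _ (f + g)); first exact: openT.
    by move=> x _; rewrite gt_eqF// fg.
  by apply: CkD => //; exact: openT.
- by move=> x; rewrite divr_ge0 ?(ltW (fg x))//= ler_pdivrMr// mul1r lerDl.
- move=> x; rewrite -gK; split=> [/divr1_eq fE|gx0].
    by move: (subrr (f x)); rewrite {1}fE addrAC subrr add0r.
  by rewrite gx0 addr0 divff//; have := fg x; rewrite gx0 addr0 => /gt_eqF ->.
- split=> // x nSx; have /fV -> : ~ V x by move=> /ltW.
  by rewrite mul0r.
Qed.

End SmoothZeroSet.

(** * Concave functions of Legendre type *)

Section Dotp.
Variables (R : realType) (d : nat).
Implicit Types x y z : 'rV[R]_d.

Lemma dotpC x y : dotp x y = dotp y x.
Proof. by apply: eq_bigr => i _; rewrite mulrC. Qed.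

Lemma dotp_is_linear x : linear (dotp x).
Proof.
move=> a y z; rewrite /dotp scaler_sumr -big_split/=; apply: eq_bigr => i _.
by rewrite !mxE mulrDr mulrCA.
Qed.

HB.instance Definition _ x :=
  GRing.isLinear.Build R 'rV[R]_d R _ (dotp x) (dotp_is_linear x).

Lemma dotpDl x y z : dotp (x + y) z = dotp x z + dotp y z.
Proof. by rewrite dotpC linearD/= !(dotpC z). Qed.

Lemma dotpBl x y z : dotp (x - y) z = dotp x z - dotp y z.
Proof. by rewrite dotpC linearB/= !(dotpC z). Qed.

Lemma dotpDr x y z : dotp z (x + y) = dotp z x + dotp z y.
Proof. exact: linearD. Qed.

Lemma dotpBr x y z : dotp z (x - y) = dotp z x - dotp z y.
Proof. exact: linearB. Qed.

Lemma dotpNr x z : dotp z (- x) = - dotp z x.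
Proof. exact: linearN. Qed.

Lemma dotpZr a x z : dotp z (a *: x) = a * dotp z x.
Proof. exact: linearZ. Qed.

Lemma dotp_delta x i : dotp x (delta_mx 0 i) = x 0 i.
Proof.
rewrite /dotp (bigD1 i)//= mxE !eqxx mulr1 big1 ?addr0// => j ji.
by rewrite mxE (negbTE ji) mulr0.
Qed.

Lemma norm_dotp_le x y : `|dotp x y| <= d%:R * `|x| * `|y|.
Proof.
apply: le_trans (ler_norm_sum _ _ _) _.
apply: (@le_trans _ _ (\sum_(i < d) `|x| * `|y|)).
  by apply: ler_sum => i _; rewrite normrM ler_pM// norm_coord_le.
by rewrite sumr_const card_ord -mulrA mulr_natl.
Qed.

Lemma dotp_continuous x : continuous (dotp x).
Proof.
apply: (@lipschitz_continuous_for _ _ _ (d%:R * `|x|)) => y z.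
by rewrite -linearB norm_dotp_le.
Qed.

Lemma rV_norm_le x (e : R) : 0 <= e -> (forall i, `|x 0 i| <= e) -> `|x| <= e.
Proof.
move=> e0 xe; rewrite [leLHS]/Num.norm/= mx_normrE; apply: bigmax_le => // -[i j] _ /=.
by rewrite (ord1 i).
Qed.

End Dotp.

(** * Maxima of upper semicontinuous functions *)

Section SemicontinuousMax.
Variables (R : realType) (d : nat).
Implicit Types u : 'rV[R]_d -> \bar R.

Lemma upper_semicontinuousP u :
  upper_semicontinuous u <-> forall a : R, open [set x | (u x < a%:E)%E].
Proof.
rewrite /upper_semicontinuous lower_semicontinuousP; split=> H a; have := H (- a).
  by under eq_set do rewrite EFinN lteN2.
by under [X in _ -> open X]eq_set do rewrite lteNr -EFinN.
Qed.

(** Without a maximum, the open sets where u < u y, for y in A, would cover A; among the finitely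
    many y of a subcover, one with the largest value lies in none of them. *)
Lemma usc_compact_max u (A : set 'rV[R]_d) : upper_semicontinuous u ->
  compact A -> A !=set0 -> exists2 x, A x & forall y, A y -> (u y <= u x)%E.
Proof.
move=> /upper_semicontinuousP uo cA [x0 Ax0]; apply: contrapT => nmax.
have {}nmax x : A x -> exists2 y, A y & (u x < u y)%E.
  move=> Ax; apply: contrapT => nxy; apply: nmax; exists x => // y Ay.
  by rewrite leNgt; apply/negP => xy; apply: nxy; exists y.
have oU y : open [set x | (u x < u y)%E].
  case uy : (u y) => [r||].
  - exact: uo.
  - rewrite (_ : mkset _ = \bigcup_(a : R) [set x | (u x < a%:E)%E]).
      by apply: bigcup_open => a _; exact: uo.
    apply/seteqP; split => x /=; last by move=> [a _] /lt_trans; apply; exact: ltry.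
    case ux : (u x) => [r||]// _; last by exists 0 => //=; rewrite ux ltNyr.
    by exists (r + 1) => //=; rewrite ux lte_fin ltrDl.
  - by rewrite (_ : mkset _ = set0); [exact: open0|apply/seteqP; split => x //=; rewrite ltNge leNye].
move: cA; rewrite compact_cover => /(_ _ A (fun y => [set x | (u x < u y)%E])).
move=> /(_ (fun y _ => oU y)) [x /nmax[y Ay xy]|D DA cov]; first by exists y.
have [y1 y1D _] := cov _ Ax0.
have [y yD ymax] : exists2 y, y \in D & forall z, z \in D -> (u z <= u y)%E.
  suff H (s : seq 'rV[R]_d) y2 : y2 \in s ->
      exists2 y, y \in s & forall z, z \in s -> (u z <= u y)%E by exact: H y1D.
  elim: s y2 => // z s IH y2 _.
  have [->|[y3 y3s]] : s = [::] \/ exists y3, y3 \in s.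
  - by case: s {IH} => [|y3 s]; [left|right; exists y3; rewrite mem_head].
  - by exists z => [|t]; rewrite inE// => /eqP ->.
  have [y ys ymax] := IH _ y3s.
  have [zy|yz] := leP (u z) (u y).
    by exists y => [|t]; rewrite inE ?ys ?orbT// => /orP[/eqP ->|/ymax].
  exists z => [|t]; rewrite inE ?eqxx// => /orP[/eqP ->//|/ymax ty].
  exact: le_trans ty (ltW yz).
have /set_mem Ay := DA _ yD.
have [z zD /=] := cov _ Ay.
by rewrite ltNge ymax.
Qed.

End SemicontinuousMax.

Lemma derivable_littleo (R : realType) (V : normedModType R) (f : V -> R) (x v : V) :
  derivable f x v -> forall e, 0 < e -> exists2 D : R, 0 < D &
    forall h, `|h| <= D -> `|f (x + h *: v) - f x - h * 'D_v f x| <= e * `|h|.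
Proof.
move=> fd e e0.
have /cvgrPdist_le/(_ _ e0)[D /= D0 DP] :
  (fun h : R => h^-1 *: ((f \o shift x) (h *: v) - f x)) @ 0^' --> 'D_v f x by [].
exists (D / 2); first by rewrite divr_gt0.
move=> h hD; have [->|h0] := eqVneq h 0.
  by rewrite scale0r addr0 subrr mul0r subrr normr0 mulr0.
have hD' : `|0 - h| < D.
  by rewrite sub0r normrN (le_lt_trans hD)// ltr_pdivrMr// ltr_pMr// ltr1n.
have := DP h hD' h0; rewrite -(ler_pM2r (_ : 0 < `|h|)) ?normr_gt0//.
rewrite -normrM mulrBl /GRing.scale/= mulrAC mulVf// mul1r distrC.
by rewrite [h *: v + x]addrC ['D_v f x * h]mulrC.
Qed.

(** * The gradient inequality for concave functions *)

Section ConcaveCalculus.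
Variables (R : realType) (d : nat) (g : 'rV[R]_d -> \bar R).
Hypotheses (g_lty : forall x, (g x < +oo)%E) (g_concave : concave g).
Implicit Types x y z w : 'rV[R]_d.

Local Notation f := (fine \o g).

Lemma domE x : dom g x -> g x = (f x)%:E.
Proof. by move=> xg; rewrite /= fineK. Qed.

Lemma domP x : dom g x <-> (-oo < g x)%E.
Proof.
rewrite /dom/= fin_numElt; split=> [/andP[]//|->]; by rewrite g_lty.
Qed.

Lemma concave_dom x y t : dom g x -> dom g y -> 0 <= t <= 1 ->
  dom g (t *: x + (1 - t) *: y).
Proof.
move=> dx dy t01; apply/domP; apply: lt_le_trans (g_concave _ _ t01).
by rewrite (domE dx) (domE dy) -!EFinM -EFinD ltNyr.
Qed.

Lemma concave_fine x y t : dom g x -> dom g y -> 0 <= t <= 1 ->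
  t * f x + (1 - t) * f y <= f (t *: x + (1 - t) *: y).
Proof.
move=> dx dy t01; have dz := concave_dom dx dy t01.
have := g_concave x y t01.
by rewrite (domE dx) (domE dy) (domE dz) -!EFinM -EFinD lee_fin.
Qed.

Lemma jensen_mean (I : Type) (i0 : I) (s : seq I) (p : I -> 'rV[R]_d) :
  (forall i, dom g (p i)) ->
  let n := (size (i0 :: s))%:R : R in
  dom g (n^-1 *: \sum_(i <- i0 :: s) p i) /\
  n^-1 * \sum_(i <- i0 :: s) f (p i) <= f (n^-1 *: \sum_(i <- i0 :: s) p i).
Proof.
move=> pd; elim: s i0 => [|i1 s IH] i0.
  by rewrite /= !big_cons !big_nil !addr0 invr1 scale1r mul1r; split.
set m := (size (i1 :: s))%:R : R in IH.
have m0 : 0 < m by rewrite ltr0n.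
rewrite /= -[_.+2]/((size (i1 :: s)).+1) -natr1 -/m.
have mE : m / (m + 1) = 1 - (m + 1)^-1 by field; rewrite gt_eqF// addr_gt0.
have m10 : 0 < m + 1 by rewrite addr_gt0.
have t01 : 0 <= (m + 1)^-1 <= 1.
  by rewrite invr_ge0 (ltW m10)/= invf_le1// lerDr ltW.
have [IHd IHf] := IH i1; rewrite big_cons [in leLHS]big_cons.
set P := \sum_(i <- i1 :: s) p i in IHd IHf *.
have -> : (m + 1)^-1 *: (p i0 + P) =
    (m + 1)^-1 *: p i0 + (1 - (m + 1)^-1) *: (m^-1 *: P).
  rewrite scalerDr scalerA -mE; congr (_ + _ *: _).
  by field; rewrite !gt_eqF// addr_gt0.
split; first exact: concave_dom.
apply: le_trans (concave_fine (pd i0) IHd t01).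
rewrite mulrDr lerD2l -mE; apply: le_trans (ler_wpM2l _ IHf); last first.
  by rewrite divr_ge0 ?(ltW m0) ?(ltW m10).
by rewrite le_eqVlt; apply/orP; left; apply/eqP; field; rewrite !gt_eqF.
Qed.

(* Chord slopes at x in the direction v are bounded, through a midpoint and
   Jensen's inequality, by the mean of the slopes along the coordinate axes. *)
Lemma tangent_le x w : (0 < d)%N -> (dom g)° x -> dom g w ->
  (forall i, derivable f x (delta_mx 0 i)) ->
  f w <= f x + dotp (gradient f x) (w - x).
Proof.
move=> d0 Ox dw fd; set v := w - x.
suff H e : 0 < e -> f w - f x - dotp (gradient f x) v <= e * \sum_i `|v 0 i|.
  rewrite -lerBlDl -subr_le0; set S := \sum_i _ in H.
  have S0 : 0 <= S by exact: sumr_ge0.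
  apply/ler_addgt0Pl => e e0; rewrite addr0.
  apply: le_trans (H (e / (S + 1)) _) _; first by rewrite divr_gt0// ltr_wpDl.
  by rewrite mulrAC ler_pdivrMr ?ltr_wpDl// ler_wpM2l ?(ltW e0)// lerDl.
move=> e0.
have /choice[D DP] i : exists D, 0 < D /\ forall h, `|h| <= D ->
    `|f (x + h *: delta_mx 0 i) - f x - h * partial i f x| <= e * `|h|.
  by have [D D0 DP] := derivable_littleo (fd i) e0; exists D.
have [r0 /= r00 rO] : exists2 r0, 0 < r0 & forall y, `|y - x| < r0 -> dom g y.
  have /nbhs_ballP[r0 /= r00 rO] := Ox; exists r0 => // y xy; apply: rO.
  by rewrite -ball_normE /= distrC.
pose D0 := \big[Order.min/r0]_i D i.
have D00 : 0 < D0 by apply: lt_bigmin => // i _; have [] := DP i.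
pose V := d%:R * `|v| + 1.
have dn0 : 0 < d%:R :> R by rewrite ltr0n.
have V0 : 0 < V by rewrite ltr_wpDl// mulr_ge0 ?ltW.
(* The bound s V < D0 keeps all points used below in the domain and within reach of the first-order
   expansions. *)
pose s := Num.min 1 (D0 / (2 * V)).
have s0 : 0 < s by rewrite lt_min ltr01 divr_gt0// mulr_gt0.
have s1 : s <= 1 by rewrite ge_min lexx.
have sV : s * V < D0.
  apply: (@le_lt_trans _ _ (D0 / (2 * V) * V)).
    by rewrite ler_wpM2r ?ge_min ?lexx ?orbT// ltW.
  by rewrite invfM mulrA mulfVK ?gt_eqF// ltr_pdivrMr// ltr_pMr// ltr1n.
have Dr0 : D0 <= r0 by exact: bigmin_le_id.
have vV : `|v| <= V.
  rewrite /V ler_wpDr// ler_peMl// ler1n//.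
have viV i : d%:R * `|v 0 i| <= V.
  by rewrite /V ler_wpDr// ler_wpM2l ?(ltW dn0)// norm_coord_le.
have domv c : `|c| <= s -> dom g (x + c *: v).
  move=> cs; apply: rO; rewrite addrAC subrr add0r normrZ.
  apply: lt_le_trans Dr0; apply: le_lt_trans sV; exact: ler_pM.
(* The factor d makes x - s v the barycentre of the d points x + h_i e_i. *)
pose h i := - (d%:R * s * v 0 i).
have hV i : `|h i| < D0.
  rewrite normrN normrM (gtr0_norm (mulr_gt0 dn0 s0)) mulrAC mulrC.
  by apply: le_lt_trans sV; rewrite ler_wpM2l// (ltW s0).
have domi i : dom g (x + h i *: delta_mx 0 i).
  apply: rO; rewrite addrAC subrr add0r normrZ.
  apply: lt_le_trans Dr0; apply: le_lt_trans (hV i).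
  rewrite ler_piMr//; apply: rV_norm_le => // j; rewrite mxE.
  by case: (_ && _); rewrite ?normr1 ?normr0.
(* The chain is s (f w - f x) <= f (x + s v) - f x <= f x - f (x - s v), and f (x - s v) is at least
   the mean of the f (x + h_i e_i), which the partial derivatives control. *)
have E1 : s * (f w - f x) <= f (x + s *: v) - f x.
  have s01 : 0 <= s <= 1 by rewrite ltW.
  have := concave_fine dw (interior_subset Ox) s01.
  have -> : s *: w + (1 - s) *: x = x + s *: v.
    by rewrite /v scalerBr scalerBl scale1r addrCA.
  by lra.
have E2 : f (x + s *: v) + f (x + (- s) *: v) <= 2 * f x.
  have s12 : 0 <= (2^-1 : R) <= 1 by lra.
  have ns : `|s| <= s by rewrite gtr0_norm.
  have ns' : `|- s| <= s by rewrite normrN.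
  have := concave_fine (domv _ ns) (domv _ ns') s12.
  have -> : 2^-1 *: (x + s *: v) + (1 - 2^-1) *: (x + (- s) *: v) = x.
    by apply/rowP => j; rewrite !mxE; field.
  by lra.
have E3 : d%:R^-1 * \sum_i f (x + h i *: delta_mx 0 i) <= f (x + (- s) *: v).
  have [i0 [t tE]] : exists i0 t, index_enum 'I_d = i0 :: t.
    case: (index_enum 'I_d) (mem_index_enum (Ordinal d0)) => // i0 t _.
    by exists i0, t.
  have st : size (i0 :: t) = d.
    by rewrite -tE -[size _]/(size (index_enum 'I_d)) /index_enum -enumT size_enum_ord.
  have [_] := jensen_mean i0 t domi; rewrite st -tE.
  congr (_ <= f _); apply/rowP => j; rewrite mxE summxE.
  under eq_bigr do rewrite mxE.
  rewrite big_split/= sumr_const card_ord (bigD1 j)//= big1 => [|k kj].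
    by rewrite /h /v !mxE !eqxx -[x 0 j *+ d]mulr_natl /=; field; rewrite gt_eqF.
  by rewrite !mxE eqxx eq_sym (negbTE kj) !mulr0.
have E4 i : f x - f (x + h i *: delta_mx 0 i) <= d%:R * s * (partial i f x * v 0 i + e * `|v 0 i|).
  have [Di0 /(_ (h i))] := DP i.
  have hD : `|h i| <= D i by apply/ltW/(lt_le_trans (hV i)); exact: bigmin_le_cond.
  move=> /(_ hD).
  have -> : h i * partial i f x = - (d%:R * s * v 0 i) * partial i f x by [].
  have -> : `|h i| = d%:R * s * `|v 0 i|.
    by rewrite normrN normrM (gtr0_norm (mulr_gt0 dn0 s0)).
  by rewrite ler_norml => /andP[+ _]; lra.
have E5 : f x - d%:R^-1 * \sum_i f (x + h i *: delta_mx 0 i) <=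
    s * (dotp (gradient f x) v + e * \sum_i `|v 0 i|).
  have -> : f x = d%:R^-1 * \sum_(i < d) f x.
    by rewrite sumr_const card_ord -[f x *+ d]mulr_natl mulKf ?gt_eqF.
  rewrite -mulrBr -sumrB ler_pdivrMl// mulrA /dotp mulr_sumr -big_split/= mulr_sumr.
  by apply: ler_sum => i _; rewrite [gradient f x 0 i]mxE; exact: E4.
have : s * (f w - f x) <= s * (dotp (gradient f x) v + e * \sum_i `|v 0 i|).
  by apply: le_trans E1 _; apply: le_trans E5; lra.
by rewrite (ler_pM2l s0) /=; lra.
Qed.

End ConcaveCalculus.

(** * Maximizers of g + <y,.> and the gradient of the conjugate *)

Section LegendreTransform.
Variables (R : realType) (d : nat) (g : 'rV[R]_d -> \bar R) (B : R).
Hypotheses (d0 : (0 < d)%N) (g_lty : forall x, (g x < +oo)%E)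
  (g_usc : upper_semicontinuous g) (g_concave : concave g)
  (dom_interior : (dom g)° !=set0) (g_strict : strictly_concave_on (dom g)° g)
  (g_C1 : Ck 1 (fine \o g) (dom g)°)
  (g_steep : forall (x : nat -> 'rV[R]_d) z,
    (forall n, (dom g)° (x n)) -> x @ \oo --> z -> boundary (dom g) z ->
    `|gradient (fine \o g) (x n)| @[n --> \oo] --> +oo)
  (dom_bounded : forall x, dom g x -> `|x| <= B).
Implicit Types x y z w : 'rV[R]_d.

Local Notation f := (fine \o g).
Local Notation O := ((dom g)°).

Definition maximizer y z :=
  forall w, (g w + (dotp y w)%:E <= g z + (dotp y z)%:E)%E.

Lemma maximizer_dom y z : maximizer y z -> dom g z.
Proof.
have [x0 /interior_subset dx0] := dom_interior.
move=> /(_ x0); rewrite (domE dx0) -EFinD => H; apply/(domP g_lty).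
by case: (g z) H => [r|//|//]; rewrite ltNyr.
Qed.

Lemma maximizerP y z : maximizer y z <->
  dom g z /\ forall w, dom g w -> f w + dotp y w <= f z + dotp y z.
Proof.
split=> [zmax|[dz zmax] w].
  have dz := maximizer_dom zmax; split=> // w dw.
  by have := zmax w; rewrite (domE dz) (domE dw) -!EFinD lee_fin.
have [dw|/(domP g_lty)/negP] := pselect (dom g w).
  by rewrite (domE dz) (domE dw) -!EFinD lee_fin zmax.
by rewrite -leNgt leeNy_eq => /eqP ->; rewrite addNye leNye.
Qed.

Lemma tilt_usc y : upper_semicontinuous (fun z => g z + (dotp y z)%:E)%E.
Proof.
apply/upper_semicontinuousP => a; rewrite openE => z /= za.
have [b gb ba] : exists2 b : R, (g z < b%:E)%E & b + dotp y z < a.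
  case gz : (g z) za => [r||] //=; last first.
    by move=> _; exists (a - dotp y z - 1); [rewrite ltNyr|lra].
  by rewrite -EFinD lte_fin => rza; exists ((r + (a - dotp y z)) / 2); rewrite ?lte_fin; lra.
have /upper_semicontinuousP/(_ b) ob := g_usc.
have oL : open [set w | dotp y w < a - b].
  exact: (@open_comp _ _ (dotp y) [set t | t < a - b] (fun w _ => @dotp_continuous _ _ y w) (@open_lt _ _)).
have zL : dotp y z < a - b by lra.
apply: filterS (filterI (open_nbhs_nbhs (conj ob gb)) (open_nbhs_nbhs (conj oL zL))).
move=> w /= [gw Lw]; case: (g w) gw => [r||] // gw; last by rewrite addNye ltNyr.
by move: gw; rewrite -EFinD !lte_fin; lra.
Qed.

(** Boundedness of the domain supplies compactness. The constraint A serves the continuity of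
    [argmax], with A the complement of a ball. *)
Lemma exists_maximizer_on y (A : set 'rV[R]_d) : closed A -> dom g `&` A !=set0 ->
  exists2 z, (dom g `&` A) z & forall w, (dom g `&` A) w ->
    f w + dotp y w <= f z + dotp y z.
Proof.
move=> cA [x0 [dx0 Ax0]].
have cBA : compact (A `&` [set x | `|x| <= B]).
  apply: bounded_closed_compact.
    by exists B; split; rewrite ?num_real// => M BM x [_ /= xB]; rewrite (le_trans xB)// ltW.
  apply: closedI => //.
  have -> : [set x : 'rV[R]_d | `|x| <= B] = Num.norm @^-1` [set t | t <= B] by [].
  by apply: closed_comp => [x _|]; [exact: norm_continuous|exact: closed_le].
have [|z [Az _] zmax] := usc_compact_max (@tilt_usc y) cBA.
  by exists x0; split=> //; exact: dom_bounded.
have dz : dom g z.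
  apply/(domP g_lty); have := zmax x0 (conj Ax0 (dom_bounded dx0)).
  by rewrite (domE dx0) -EFinD; case: (g z) => [r|//|//]; rewrite ltNyr.
exists z => // w [dw Aw]; have := zmax w (conj Aw (dom_bounded dw)).
by rewrite (domE dz) (domE dw) -!EFinD lee_fin.
Qed.

Lemma exists_maximizer y : exists z, maximizer y z.
Proof.
have [x0 /interior_subset dx0] := dom_interior.
have [||z [dz _] zmax] := @exists_maximizer_on y setT.
- exact: closedT.
- by exists x0.
- by exists z; apply/maximizerP; split=> // w dw; exact: zmax.
Qed.

Lemma g_derivable x i : O x -> derivable f x (delta_mx 0 i).
Proof. by move=> Ox; have [_ /(_ i)[+ _]] := g_C1; exact. Qed.

Lemma g_tangent x w : O x -> dom g w ->
  f w <= f x + dotp (gradient f x) (w - x).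
Proof. by move=> Ox dw; apply: tangent_le => // i; exact: g_derivable. Qed.

(** The homothety of centre z and ratio t carries a ball around x to a ball around the given point,
    and concavity keeps the image in the domain. *)
Lemma interior_segment x z t : O x -> dom g z -> 0 < t <= 1 ->
  O (t *: x + (1 - t) *: z).
Proof.
move=> Ox dz /andP[t0 t1]; have /nbhs_ballP[e /= e0 eO] := Ox.
apply/nbhs_ballP; exists (t * e) => /=; first by rewrite mulr_gt0.
move=> w; rewrite -ball_normE /= => wt.
pose x' := x + t^-1 *: (w - (t *: x + (1 - t) *: z)).
have dx' : dom g x'.
  apply: eO; rewrite -ball_normE /= /x' opprD addNKr normrN normrZ gtr0_norm ?invr_gt0//.
  by rewrite ltr_pdivrMl// distrC.
have -> : w = t *: x' + (1 - t) *: z.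
  by rewrite /x' scalerDr scalerA mulfV ?gt_eqF// scale1r addrAC addrC subrK.
by apply: concave_dom => //; rewrite ltW.
Qed.

(* Along the segment from a maximizer on the boundary to an interior point the
   gradients stay bounded, which steepness forbids. *)
Lemma maximizer_interior y z : maximizer y z -> O z.
Proof.
move=> zmax; apply: contrapT => nOz.
have [dz zm] := (maximizerP _ _).1 zmax.
have [x0 Ox0] := dom_interior; have dx0 := interior_subset Ox0.
have /nbhs_ballP[e /= e0 eO] := Ox0.
pose t n : R := n.+1%:R^-1; pose x n := t n *: x0 + (1 - t n) *: z.
have t0 n : 0 < t n by rewrite invr_gt0 ltr0n.
have t1 n : t n <= 1 by rewrite invf_le1 ?ltr0n// ler1n.
have Ox n : O (x n) by apply: interior_segment; rewrite ?t0 ?t1.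
have xz n : z - x n = - (t n *: (x0 - z)).
  by apply/rowP => i; rewrite !mxE; ring.
have xz_cvg : x @ \oo --> z.
  have : (fun n => t n *: (x0 - z) + z) @ \oo --> 0 *: (x0 - z) + z.
    by apply: cvgD; [apply: cvgZr_tmp; exact: cvg_harmonic|exact: cvg_cst].
  rewrite scale0r add0r (_ : (fun n => _) = x)//; apply/funext => n.
  by apply/rowP => i; rewrite !mxE; ring.
have bz : boundary (dom g) z by split=> //; exact: subset_closure.
have [zH /maximizerP[_ fH]] := exists_maximizer 0.
set H := f zH in fH; pose c := dotp y (z - x0); pose eta := e / 2.
have eta0 : 0 < eta by rewrite divr_gt0.
have deta h j : `|h| <= eta -> dom g (x0 + h *: delta_mx 0 j).
  move=> he; apply: eO; rewrite -ball_normE /= opprD addNKr normrN.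
  apply: (@le_lt_trans _ _ eta); last by rewrite ltr_pdivrMr// ltr_pMr// ltr1n.
  apply: rV_norm_le => [|i]; first exact: ltW.
  by rewrite !mxE normrM; case: (_ && _); rewrite ?normr1 ?normr0 ?mulr1// mulr0 ltW.
pose M j := (`|H| + `|c| + `|f (x0 + eta *: delta_mx 0 j)| +
  `|f (x0 + (- eta) *: delta_mx 0 j)|) / eta.
have M0 j : 0 <= M j by rewrite divr_ge0 ?(ltW eta0)// !addr_ge0.
have GM n j : `|gradient f (x n) 0 j| <= M j.
  set G := gradient f (x n).
  have dxn := interior_subset (Ox n).
  (* The tangent inequality at [x n], evaluated at z, against the maximality of z. Cancelling [t n]
     makes the bound uniform in n. *)
  have Gc : t n * dotp G (x0 - z) <= t n * c.
    have := g_tangent (Ox n) dz; have := zm _ dxn.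
    rewrite xz dotpNr dotpZr -/G => h1 h2.
    have -> : t n * c = dotp y (z - x n).
      by rewrite xz dotpNr dotpZr /c -mulrN -dotpNr opprB.
    by rewrite dotpBr; lra.
  rewrite (ler_pM2l (t0 n)) in Gc.
  have Gx : dotp G (x0 - x n) <= `|c|.
    have -> : x0 - x n = (1 - t n) *: (x0 - z) by apply/rowP => i; rewrite !mxE; ring.
    have tn1 := t1 n; have tn0 := t0 n.
    rewrite dotpZr; apply: (@le_trans _ _ ((1 - t n) * c)).
      by rewrite ler_wpM2l// subr_ge0.
    apply: le_trans (ler_norm _) _; rewrite normrM ler_piMl// ger0_norm; lra.
  have fxH : f (x n) <= `|H|.
    have := fH _ dxn; rewrite /dotp !big1; [|by move=> i _; rewrite mxE mul0r..].
    by rewrite !addr0 => /le_trans; apply; exact: ler_norm.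
  (* The tangent inequality at [x n], evaluated at x0 shifted along an axis, where f has a value
     independent of n; the shifts eta and - eta bound the coordinate of the gradient from both
     sides. *)
  have T h : `|h| <= eta -> f (x0 + h *: delta_mx 0 j) <= `|H| + `|c| + h * G 0 j.
    move=> /(deta _ j) dh; have := g_tangent (Ox n) dh; rewrite -/G.
    rewrite addrAC; move: Gx; set u := x0 - x n => Gx.
    by rewrite dotpDr dotpZr dotp_delta; lra.
  have e1 : `|eta| <= eta by rewrite gtr0_norm.
  have e2 : `|- eta| <= eta by rewrite normrN.
  have := T _ e1; have := T _ e2.
  have := ler_norm (- f (x0 + eta *: delta_mx 0 j)); rewrite normrN.
  have := ler_norm (- f (x0 + (- eta) *: delta_mx 0 j)); rewrite normrN.
  rewrite /M ler_pdivlMr//.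
  have -> : `|G 0 j| * eta = `|G 0 j * eta| by rewrite normrM (gtr0_norm eta0).
  rewrite ler_norml.
  have := normr_ge0 (f (x0 + eta *: delta_mx 0 j)).
  have := normr_ge0 (f (x0 + (- eta) *: delta_mx 0 j)).
  set F1 := f _; set F2 := f _; move=> *; apply/andP; split; lra.
have GS n : `|gradient f (x n)| <= \sum_j M j.
  apply: rV_norm_le => [|j]; first exact: sumr_ge0.
  apply: le_trans (GM n j) _; rewrite (bigD1 j)//= lerDl; exact: sumr_ge0.
have /cvgryPgt/(_ (\sum_j M j))[N _ /(_ N (leqnn N))] := g_steep Ox xz_cvg bz.
by rewrite /= ltNge GS.
Qed.

Lemma maximizer_unique y z w : maximizer y z -> maximizer y w -> z = w.
Proof.
move=> zmax wmax; apply: contrapT => /eqP zw.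
have [Oz Ow] := (maximizer_interior zmax, maximizer_interior wmax).
have h01 : 0 < (2^-1 : R) < 1 by lra.
have h01' : 0 <= (2^-1 : R) <= 1 by lra.
have [/maximizerP[dz zm] /maximizerP[dw wm]] := (zmax, wmax).
have dm := concave_dom g_lty g_concave dz dw h01'.
have := g_strict Oz Ow zw h01.
rewrite (domE dz) (domE dw) (domE dm) -!EFinM -EFinD lte_fin.
have := zm _ dm; have := wm _ dz; rewrite !dotpDr !dotpZr; lra.
Qed.

(** The first-order condition, tested on small steps in both directions of each axis. It recovers y
    from z, whence the injectivity of [argmax]. *)
Lemma maximizer_gradient y z : maximizer y z -> gradient f z = - y.
Proof.
move=> zmax; have Oz := maximizer_interior zmax.
have [dz zm] := (maximizerP _ _).1 zmax.
apply/rowP => i; rewrite !mxE; apply/eqP; rewrite -addr_eq0 -normr_le0.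
apply/ler_addgt0Pl => e e0; rewrite addr0.
have [D D0 DP] := derivable_littleo (@g_derivable _ i Oz) e0.
have /nbhs_ballP[r /= r0 rO] := Oz.
pose h := Num.min D (r / 2).
have h0 : 0 < h by rewrite lt_min D0 divr_gt0.
have hr : h < r.
  by rewrite gt_min; apply/orP; right; rewrite ltr_pdivrMr// ltr_pMr// ltr1n.
have hD : h <= D by rewrite ge_min lexx.
have dh s : `|s| <= h -> dom g (z + s *: delta_mx 0 i).
  move=> sh; apply: rO; rewrite -ball_normE /= opprD addNKr normrN.
  apply: le_lt_trans hr; apply: le_trans sh; rewrite normrZ ler_piMr//.
  by apply: rV_norm_le => // j; rewrite mxE; case: (_ && _); rewrite ?normr1 ?normr0.
have T s : `|s| <= h -> s * (partial i f z + y 0 i) <= e * `|s|.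
  move=> sh; have := zm _ (dh _ sh); have := DP _ (le_trans sh hD).
  rewrite ler_norml => /andP[+ _]; rewrite dotpDr dotpZr dotp_delta.
  by rewrite /partial; lra.
have e1 : `|h| <= h by rewrite gtr0_norm.
have e2 : `|- h| <= h by rewrite normrN.
have := T _ e1; have := T _ e2; rewrite normrN (gtr0_norm h0) => T1 T2.
rewrite -(ler_pM2l h0) -{1}(gtr0_norm h0) -normrM ler_norml; apply/andP; split; lra.
Qed.

Definition argmax y : 'rV[R]_d := sval (cid (exists_maximizer y)).

Lemma argmaxP y : maximizer y (argmax y).
Proof. exact: svalP. Qed.

Lemma argmax_inj : injective argmax.
Proof.
move=> y y' yy'; have := maximizer_gradient (argmaxP y).
by rewrite yy' (maximizer_gradient (argmaxP y')) => /oppr_inj.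
Qed.

(** By uniqueness, away from a ball around z the functional for y stays below its maximum by some
    delta > 0. For y' close to y, the functional changes by less than delta between two points of
    the bounded domain, so the maximizer cannot leave the ball. *)
Lemma argmax_continuous : continuous argmax.
Proof.
move=> y; apply: (@cvgrPdist_lt _ _ _ (nbhs y) (nbhs_filter y) _ _).2 => e e0.
set z := argmax y; have zmax : maximizer y z by exact: argmaxP.
have [dz zm] := (maximizerP _ _).1 zmax.
pose A := [set w : 'rV[R]_d | e <= `|z - w|].
have cA : closed A.
  have -> : A = (fun w => `|z - w|) @^-1` [set t | e <= t] by [].
  apply: closed_comp => [w _|]; last exact: closed_ge.
  apply: (@lipschitz_continuous_for _ _ _ 1) => u v; rewrite mul1r.
  by rewrite (le_trans (ler_dist_dist _ _))// opprB addrC addrA subrK distrC.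
have [[w0 dw0]|nA] := pselect (dom g `&` A !=set0); last first.
  apply: nearW => y'; rewrite ltNge; apply/negP => yA; apply: nA.
  exists (argmax y'); split=> //; exact: maximizer_dom (argmaxP y').
have [|w1 [dw1 Aw1] w1m] := @exists_maximizer_on y A cA; first by exists w0.
pose delta := f z + dotp y z - (f w1 + dotp y w1).
have delta0 : 0 < delta.
  rewrite subr_gt0 lt_neqAle zm// andbT; apply/eqP => E.
  have w1max : maximizer y w1.
    by apply/maximizerP; split=> // w dw; rewrite E zm.
  move: Aw1; rewrite /A/= (maximizer_unique zmax w1max) subrr normr0.
  by rewrite leNgt e0.
have B0 : 0 <= B := le_trans (normr_ge0 _) (dom_bounded dz).
pose K := d%:R * (B + B) + 1.
have K0 : 0 < K by rewrite ltr_wpDl// mulr_ge0// addr_ge0.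
have /(@cvgrPdist_lt _ _ _ (nbhs y) (nbhs_filter y) _ _)/(_ (delta / K)) := @cvg_id _ (nbhs y).
rewrite divr_gt0// => /(_ isT); apply: filterS => y' yy'.
rewrite ltNge; apply/negP => Ay'.
have [dz' zm'] := (maximizerP _ _).1 (argmaxP y').
set z' := argmax y' in dz' zm' Ay'.
have h1 := w1m _ (conj dz' Ay'); have h2 := zm' _ dz.
have h3 : delta <= dotp (y' - y) (z' - z).
  by rewrite dotpBr !dotpBl /delta; lra.
have : `|dotp (y' - y) (z' - z)| < delta.
  apply: le_lt_trans (norm_dotp_le _ _) _.
  apply: (@le_lt_trans _ _ (`|y - y'| * K)); last by rewrite -ltr_pdivlMr.
  rewrite distrC mulrC mulrA mulrC ler_wpM2l//.
  rewrite /K ler_wpDr// mulrC ler_wpM2l//.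
  by rewrite (le_trans (ler_normB _ _))// lerD// dom_bounded.
by rewrite ltNge (le_trans h3)// ler_norm.
Qed.

Definition conjugate y : R := f (argmax y) + dotp y (argmax y).

(** Testing each maximizer, z for y and z' for y + h, in the problem of the other gives <h,z> <=
    conjugate (y + h) - conjugate y <= <h,z'>, and z' tends to z. *)
Let conjugate_expansion y :
  (conjugate \o shift y : 'rV[R]_d -> R^o) =
    (cst (conjugate y) + dotp (argmax y) : 'rV[R]_d -> R^o) +o_ (0 : 'rV[R]_d) id.
Proof.
apply: (eqaddoP _ _ _ _).2 => e e0.
have [dz zm] := (maximizerP _ _).1 (argmaxP y).
have e1 : 0 < e / d%:R by rewrite divr_gt0// ltr0n.
have /(@cvgrPdist_lt _ _ _ (nbhs y) (nbhs_filter y) _ _)/(_ _ e1) := @argmax_continuous y.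
move=> /nbhs0P H.
apply: filterS H => h; rewrite [y + h]addrC => hd.
rewrite !fctE/=; set z := argmax y in dz zm hd *; set z' := argmax (h + y) in hd *.
have [dz' zm'] := (maximizerP _ _).1 (argmaxP (h + y)); rewrite -/z' in dz' zm'.
have E : conjugate (h + y) = f z' + dotp (h + y) z' by [].
have E' : conjugate y = f z + dotp y z by [].
rewrite E E'; have h1 := zm' _ dz; have h2 := zm _ dz'.
rewrite !dotpDl in h1 *; rewrite (dotpC z h).
have h3 : `|dotp h (z' - z)| <= e * `|h|.
  apply: le_trans (norm_dotp_le _ _) _.
  rewrite mulrAC ler_wpM2r// mulrC -ler_pdivlMr ?ltr0n//.
  by rewrite distrC ltW.
move: h3; rewrite dotpBr !ler_norml => /andP[h3 h4]; apply/andP; split; lra.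
Qed.

Let conjugate_diff y : 'd conjugate y = dotp (argmax y) :> ('rV[R]_d -> R).
Proof. by apply: diff_unique; [exact: dotp_continuous|exact: conjugate_expansion]. Qed.

Lemma conjugate_differentiable y : differentiable conjugate y.
Proof.
apply/diff_locallyP; rewrite conjugate_diff; split=> //; exact: dotp_continuous.
Qed.

Lemma conjugate_gradient y : gradient conjugate y = argmax y.
Proof.
apply/rowP => i; rewrite mxE /partial deriveE; last exact: conjugate_differentiable.
by rewrite conjugate_diff dotp_delta.
Qed.

End LegendreTransform.

(** * Prescribing the maximizing parameters *)

Section MeanBounded.
Variables (R : realType) (X : pointedMetricType R) (d : nat) (phi : 'I_d -> X -> R).
Hypotheses (cX : compact [set: X]) (phi_c : forall i, continuous (phi i)).

Lemma continuous_measurable (f : X -> R) : continuous f ->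
  measurable_fun [set: borel X] (f : borel X -> R).
Proof.
move=> fc; apply: (measurability _ (measurable_realfun.RGenOpens.measurableE R)) => _ [_ [a [b ->] <-]].
rewrite setTI; apply: sub_sigma_algebra.
by move/continuousP : fc; apply; exact: interval_open.
Qed.

Lemma continuous_bounded (f : X -> R) : continuous f ->
  exists2 C, 0 <= C & forall x, `|f x| <= C.
Proof.
move=> fc.
have [|||c _ cmax] := @compact_EVT_max X R (fun x => `|f x|) setT.
- by exists point.
- exact: cX.
- by apply: continuous_subspaceT => x; apply: continuous_comp; [exact: fc|exact: norm_continuous].
by exists `|f c| => // x; apply: cmax; rewrite inE.
Qed.

Lemma continuous_integrable (f : X -> R) (mu : probability (borel X) R) :
  continuous f -> mu.-integrable [set: borel X] (EFin \o (f : borel X -> R)).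
Proof.
move=> fc; apply: measurable_bounded_integrable => //.
- by apply: le_lt_trans (probability_le1 mu measurableT) _; rewrite ltry.
- exact: continuous_measurable.
- have [C C0 fC] := continuous_bounded fc.
  by exists C; split; rewrite ?num_real// => M CM x _; exact: le_trans (fC x) (ltW CM).
Qed.

(** Bounds the rotation set, hence the domain of h, which makes the maximization problems
    compact. *)
Lemma mean_bounded : exists B : R, forall mu : probability (borel X) R,
  `|mean phi mu| <= B.
Proof.
have /choice[C CP] i : exists C, 0 <= C /\ forall x, `|phi i x| <= C.
  by have [C C0 fC] := continuous_bounded (@phi_c i); exists C.
exists (\sum_i C i) => mu; apply: rV_norm_le => [|i].
  by apply: sumr_ge0 => i _; have [] := CP i.
rewrite mxE; apply: (@le_trans _ _ (C i)); last first.
  by rewrite (bigD1 i)//= lerDl; apply: sumr_ge0 => j _; have [] := CP j.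
have int := continuous_integrable mu (@phi_c i).
apply: le_trans (le_normr_Rintegral measurableT int) _.
apply: (@le_trans _ _ (\int[mu]_(x in [set: borel X]) C i)).
  apply: le_Rintegral => //.
  - exact: integrable_norm int.
  - exact: finite_measure_integrable_cst.
  - by move=> x _; have [_ /(_ x)] := CP i.
rewrite Rintegral_cst// [X in fine X](_ : _ = 1%E) ?mulr1//.
exact: probability_setT.
Qed.

End MeanBounded.

Section PrescribedMaximizers.
Variables (R : realType) (X : pointedMetricType R) (T : X -> X) (d : nat).
Variables (phi : 'I_d -> X -> R) (r : option nat).
Hypothesis hr : if r is Some k then (2 <= k)%N else true.
Hypotheses (cX : compact [set: X]) (d0 : (0 < d)%N)
  (phi_c : forall i, continuous (phi i)).
Hypothesis hL : legendre_system T phi r.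

Local Notation h := (entropy_function T phi).
Local Notation f := (fine \o h).
Local Notation P := (fine \o pressure T phi).

Lemma entropy_dom z : dom h z -> exists2 mu, Defs.invariant T mu & mean phi mu = z.
Proof.
move=> dz; apply: contrapT => nmu; suff hz : h z = -oo%E by move: dz; rewrite /dom/= hz.
suff E : [set ks_entropy T mu | mu in
    [set mu | Defs.invariant T mu /\ mean phi mu = z]] = set0.
  by rewrite /entropy_function E ereal_sup0.
by apply/seteqP; split=> [t [mu [imu muz] _]|//]; apply: nmu; exists mu.
Qed.

Lemma ks_le_entropy mu : Defs.invariant T mu -> (ks_entropy T mu <= h (mean phi mu))%E.
Proof. by move=> imu; apply: ereal_sup_ubound; exists mu. Qed.

(** Grouping the invariant measures by their mean identifies P with the conjugate of h, so its
    gradient is [argmax]. *)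
Lemma pressure_gradient_facts :
  [/\ forall y, differentiable P y,
      injective (gradient P), continuous (gradient P),
      forall y, (dom h)° (gradient P y) &
      exists M, forall z, dom h z -> f z < M].
Proof.
have [_ _ [h_lty [h_usc h_conc] [dom0 h_strict h_Cr _] h_steep]] := hL.
have h_C1 : Ck 1 f (dom h)°.
  by case: (r) hr h_Cr => [k k2|_ H]; [apply: Ck_le; exact: ltnW|exact: H].
have [B meanB] := mean_bounded cX phi_c.
have domB z : dom h z -> `|z| <= B by move=> /entropy_dom[mu _ <-].
pose a := argmax h_lty h_usc dom0 domB.
have aP y : maximizer h y (a y) by exact: argmaxP.
have aO y : (dom h)° (a y) 
  by apply: (maximizer_interior d0 h_lty h_usc h_conc dom0 h_C1 h_steep domB (aP y)).
have PE : P = conjugate h_lty h_usc dom0 domB.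
  apply/funext => y; rewrite /conjugate -/(a y) /=.
  have dz := interior_subset (aO y).
  suff -> : pressure T phi y = (f (a y) + dotp y (a y))%:E by [].
  rewrite EFinD -(domE dz); apply/eqP; rewrite eq_le; apply/andP; split.
    apply: ub_ereal_sup => _ [mu imu <-]; apply: le_trans (aP y (mean phi mu)).
    by rewrite leeD2r// ks_le_entropy.
  rewrite -leeBrDr//; apply: ub_ereal_sup => _ [mu [imu muz] <-].
  rewrite leeBrDr//; apply: ereal_sup_ubound; exists mu => //.
  by rewrite muz.
have GE : gradient P = a by apply/funext => y; rewrite PE; exact: conjugate_gradient.
split.
- by move=> y; rewrite PE; exact: conjugate_differentiable.
- by rewrite GE; exact: argmax_inj.
- by rewrite GE; exact: argmax_continuous.
- by rewrite GE.
(* The maximizer for y = 0 maximizes h itself. Adding 1 makes the bound strict, so that h + F cannot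
   vanish off K. *)
- exists (f (a 0) + 1) => z dz; have [_ /(_ z dz)] := (maximizerP h_lty dom0 _ _).1 (aP 0).
  rewrite /dotp !big1; [|by move=> i _; rewrite mxE mul0r..].
  by rewrite !addr0 => /le_lt_trans; apply; rewrite ltrDl.
Qed.

Lemma nonlinearity_with_maximizing_values (K : set 'rV[R]_d) :
  compact K -> K !=set0 -> K `<=` (dom h)° ->
  exists F, nonlinearity T phi r setT F /\ maximizing_values T phi F = K.
Proof.
move=> cK K0 KO.
have [_ _ [h_lty _ [_ _ h_Cr _] _]] := hL.
have [_ _ _ _ [M fM]] := pressure_gradient_facts.
have oO : open (dom h)° by exact: open_interior.
have [chi [S [chiC chi01 chiK [cS SO chiS]]]] := smooth_cutoff cK K0 oO KO.
pose F z := chi z * (M - f z) - M.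
have FC k : Ck k f (dom h)° -> Ck k F setT.
  (* On the interior of the domain all terms of F are smooth; off S it is the constant - M, whatever
     the values of f there. *)
  move=> fC; have -> : setT = (dom h)° `|` ~` S.
    apply/esym/seteqP; split=> // z _; have [Sz|nSz] := pselect (S z); last by right.
    by left; exact: SO.
  apply: CkU.
    have chiO : Ck k chi (dom h)° by apply: Ck_sub (chiC k).
    apply: (CkB oO (g := cst M)); last exact: Ck_cst.
    by apply: (CkM oO chiO (g := cst M - f)); apply: CkB => //; exact: Ck_cst.
  apply: (Ck_eq (closed_openC cS) _ (Ck_cst k (- M) _)) => z /set_mem/= nSz.
  by rewrite /F chiS// mul0r sub0r.
exists F; split.
  split=> //; first exact: openT.
  by case: (r) h_Cr => [k|] /=; [exact: FC|move=> fC k; exact: FC].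
have oE z : dom h z -> nonlinear_objective T phi F z = ((1 - chi z) * (f z - M))%:E.
  move=> dz; rewrite /nonlinear_objective (domE dz) -EFinD; congr _%:E; rewrite /F /=; ring.
have oN z : ~ dom h z -> nonlinear_objective T phi F z = -oo%E.
  move=> /(domP h_lty)/negP; rewrite -leNgt leeNy_eq => /eqP hz.
  by rewrite /nonlinear_objective hz addNye.
have oK z : K z -> nonlinear_objective T phi F z = 0%E.
  move=> Kz; rewrite oE; last exact: interior_subset (KO _ Kz).
  by rewrite (chiK z).2// subrr mul0r.
have sup0 : ereal_sup (range (nonlinear_objective T phi F)) = 0%E.
  apply/eqP; rewrite eq_le; apply/andP; split.
    apply: ub_ereal_sup => _ [z _ <-]; have [dz|ndz] := pselect (dom h z); last by rewrite oN// leNye.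
    rewrite oE// lee_fin mulr_ge0_le0//; first by rewrite subr_ge0; have /andP[] := chi01 z.
    by rewrite subr_le0 ltW// fM.
  by have [z Kz] := K0; rewrite -(oK z Kz); apply: ereal_sup_ubound; exists z.
apply/seteqP; split=> z; rewrite /maximizing_values/= sup0; last exact: oK.
have [dz|ndz] := pselect (dom h z); last by rewrite oN.
rewrite oE// => -[/eqP]; rewrite mulf_eq0 => /orP[|].
  by rewrite subr_eq0 => /eqP/esym/chiK.
by rewrite subr_eq0 => /eqP E; have := fM _ dz; rewrite /= E ltxx.
Qed.

Theorem prescribed_maximizing_parameters (E : set 'rV[R]_d) :
  E !=set0 -> compact E ->
  exists F, nonlinearity T phi r setT F /\ maximizing_parameters T phi F = E.
Proof.
move=> [y0 Ey0] cE; have [Pd Gi Gc GO _] := pressure_gradient_facts.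
have [|||F [nF FK]] := @nonlinearity_with_maximizing_values (gradient P @` E).
- by apply: continuous_compact => //; exact: continuous_subspaceT.
- by exists (gradient P y0), y0.
- by move=> _ [y _ <-]; exact: GO.
exists F; split=> //; apply/seteqP; split=> y; rewrite /maximizing_parameters/= FK.
  by move=> [_ [y' Ey' /Gi <-]].
by move=> Ey; split; [exact: Pd|exists y].
Qed.

End PrescribedMaximizers.

(** * The full shift on two symbols *)

Section FirstDifference.
Variable R : realType.
Implicit Types x y z : nat -> bool.

Definition first_diff_dist x y : R :=
  if pselect (exists n, x n != y n) is left xy then (ex_minn xy).+1%:R^-1 else 0.

Lemma first_diff_distP x y n :
  first_diff_dist x y < n.+1%:R^-1 <-> forall i, (i <= n)%N -> x i = y i.
Proof.
rewrite /first_diff_dist; case: pselect => [xy|nxy]; last first.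
  rewrite invr_gt0 ltr0n; split=> // _ i _.
  by apply: contrapT => /eqP xyi; apply: nxy; exists i.
case: ex_minnP => m xym mmin; rewrite ltf_pV2 ?posrE ?ltr0n// ltr_nat ltnS; split.
  move=> nm i ni; apply/eqP; apply: contraT => /mmin.
  by rewrite leqNgt (leq_ltn_trans ni).
by move=> H; rewrite ltnNge; apply/negP => /H/eqP; exact/negP.
Qed.

Lemma first_diff_dist_ge0 x y : 0 <= first_diff_dist x y.
Proof. by rewrite /first_diff_dist; case: pselect. Qed.

Lemma first_diff_distxx x : first_diff_dist x x = 0.
Proof.
rewrite /first_diff_dist; case: pselect => // xx; exfalso.
by case: xx => n; rewrite eqxx.
Qed.

Lemma first_diff_dist_eq0 x y : first_diff_dist x y = 0 -> x = y.
Proof.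
move=> xy0; apply/funext => n; apply: (first_diff_distP x y n).1 (leqnn n).
by rewrite xy0 invr_gt0 ltr0n.
Qed.

Lemma first_diff_distC x y : first_diff_dist x y = first_diff_dist y x.
Proof.
suff H u v : first_diff_dist u v <= first_diff_dist v u by apply/eqP; rewrite eq_le !H.
rewrite {2}/first_diff_dist; case: pselect => [vu|nvu]; last first.
  suff -> : u = v by rewrite first_diff_distxx.
  by apply/funext => n; apply: contrapT => /eqP; rewrite eq_sym => uv; apply: nvu; exists n.
case: ex_minnP => m vum mmin; rewrite /first_diff_dist; case: pselect => [uv|] //=.
case: ex_minnP => m' uvm' mmin'; rewrite lef_pV2 ?posrE ?ltr0n// ler_nat ltnS.
by apply: mmin; rewrite eq_sym.
Qed.

Lemma first_diff_dist_max y x z :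
  first_diff_dist x z <= Num.max (first_diff_dist x y) (first_diff_dist y z).
Proof.
rewrite leNgt gt_max; apply/negP; rewrite {2 4}/first_diff_dist.
case: pselect => [xz|_]; last by rewrite ltNge first_diff_dist_ge0.
case: ex_minnP => m xzm _ /andP[/first_diff_distP xy /first_diff_distP yz].
by move: xzm; rewrite xy// yz// eqxx.
Qed.

Lemma first_diff_dist_triangle y x z :
  first_diff_dist x z <= first_diff_dist x y + first_diff_dist y z.
Proof.
apply: le_trans (first_diff_dist_max y x z) _; rewrite ge_max.
by rewrite lerDl lerDr !first_diff_dist_ge0.
Qed.

End FirstDifference.

(* The parameter R only fixes the ring in which distances are measured. *)
Definition shift_space (R : realType) : Type := nat -> bool.

HB.instance Definition _ (R : realType) := gen_eqMixin (shift_space R).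
HB.instance Definition _ (R : realType) := gen_choiceMixin (shift_space R).
HB.instance Definition _ (R : realType) := isPointed.Build (shift_space R) (fun=> false).
HB.instance Definition _ (R : realType) := @isMetric.Build R (shift_space R)
  (@first_diff_dist R) (@first_diff_distxx R) (@first_diff_dist_eq0 R)
  (@first_diff_distC R) (@first_diff_dist_triangle R).

Definition shift_map (R : realType) (x : shift_space R) : shift_space R := fun n => x n.+1.

Section ShiftTopology.
Variable R : realType.
Local Notation X := (shift_space R).
Implicit Types x y : X.

Definition agree n x y := forall i, (i < n)%N -> x i = y i.

Lemma nbhs_agree x (A : set X) : nbhs x A <-> exists n, agree n x `<=` A.
Proof.
split=> [/nbhs_ballP[e /= e0 eA]|[n nA]].
- exists (Num.truncn e^-1).+1 => y xy; apply: eA; rewrite ballEmdist/=.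
  apply: (@lt_trans _ _ (Num.truncn e^-1).+1%:R^-1).
    by apply/first_diff_distP => i; exact: xy.
  by rewrite invf_plt ?posrE ?ltr0n// truncnS_gt.
- apply/nbhs_ballP; exists n.+1%:R^-1 => /=; first by rewrite invr_gt0 ltr0n.
  move=> y; rewrite ballEmdist/= => /first_diff_distP xy; apply: nA => i /ltnW; exact: xy.
Qed.

(** A union of cylinders of length n, encoded as invariance under agreement of the first n
    letters. *)
Definition finitary n (A : set X) := forall x y, agree n x y -> A x -> A y.

Lemma agree_sym n x y : agree n x y -> agree n y x.
Proof. by move=> xy i /xy. Qed.

Lemma finitary_open n A : finitary n A -> open A.
Proof.
move=> nA; rewrite openE => x Ax; apply/nbhs_agree; exists n => y xy; exact: nA Ax.
Qed.

Lemma finitary_measurable n (A : set (borel X)) : finitary n A -> measurable A.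
Proof. by move=> nA; apply: sub_sigma_algebra; exact: finitary_open nA. Qed.

Lemma finitary_le m n A : (m <= n)%N -> finitary m A -> finitary n A.
Proof. by move=> mn mA x y xy; apply: mA => i im; apply: xy; exact: leq_trans mn. Qed.

(** The largest subset of A that depends on the first n letters only. *)
Definition finitary_interior n (A : set X) : set X := [set x | agree n x `<=` A].

Lemma finitary_finitary_interior n A : finitary n (finitary_interior n A).
Proof. by move=> x y xy Ux z yz; apply: Ux => i ni; rewrite xy// yz. Qed.

Lemma open_bigcup_finitary A : open A -> A = \bigcup_n finitary_interior n A.
Proof.
move=> oA; apply/seteqP; split=> [x Ax|x [n _]]; last by apply=> i.
have /nbhs_agree[n nA] := open_nbhs_nbhs (conj oA Ax : open_nbhs x A).
by exists n.
Qed.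

Lemma shift_map_continuous : continuous (@shift_map R).
Proof.
move=> x A /nbhs_agree[n nA]; apply/nbhs_agree; exists n.+1 => y xy.
by apply: nA => i ni; exact: xy.
Qed.

Lemma iter_shift_map i x n : iter i (@shift_map R) x n = x (i + n)%N.
Proof. by elim: i n => //= i IH n; rewrite /shift_map IH addnS. Qed.

(** The limit of an ultrafilter is read off letter by letter: its n-th letter is the one shared by a
    set of the ultrafilter. *)
Lemma shift_space_compact : compact [set: X].
Proof.
rewrite compact_ultra => F FU _.
pose y : X := fun n => `[< F [set x | x n] >].
exists y; split=> // A /nbhs_agree[n nA].
apply: filterS nA _.
elim: n => [|n IH]; first by apply: filterS filterT => x _ i.
suff Fn : F [set x | x n = y n].
  apply: filterS (filterI IH Fn) => x [xy xn] i; rewrite ltnS leq_eqVlt => /orP[/eqP ->|/xy//].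
  by rewrite xn.
have [Fxn|nFxn] := in_ultra_setVsetC [set x : X | x n] FU.
  have yn : y n = true by apply/asboolP.
  by apply: filterS Fxn => x /= ->; rewrite yn.
have yn : y n = false.
  apply/asboolP => Fxn.
  by have [x []] := filter_ex (filterI Fxn nFxn).
by apply: filterS nFxn => x /= /negP/negbTE ->; rewrite yn.
Qed.

End ShiftTopology.

(** * Entropy of invariant measures of the shift *)

Section FiniteLaws.
Variables (R : realType) (disp : measure_display) (T : measurableType disp).
Variable mu : probability T R.
Implicit Types I J : finType.

Definition finite_valued I (N : T -> I) := forall s, measurable [set x | N x = s].

Definition law I (N : T -> I) (s : I) : R := fine (mu [set x | N x = s]).

Lemma measurable_finite_valued I (N : T -> I) (Q : pred I) :
  finite_valued N -> measurable [set x | Q (N x)].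
Proof.
move=> mN; rewrite (_ : mkset _ = \bigcup_(s in [set s | Q s]) [set x | N x = s]).
  by apply: fin_bigcup_measurable => // s _; exact: mN.
by apply/seteqP; split=> [x /= QNx|x [s /= Qs] ->]//; exists (N x).
Qed.

Lemma finite_valued_comp I J (N : T -> I) (g : I -> J) :
  finite_valued N -> finite_valued (g \o N).
Proof.
move=> mN t; rewrite (_ : mkset _ = [set x | [pred s | g s == t] (N x)]).
  exact: measurable_finite_valued.
by apply/seteqP; split=> x /= /eqP.
Qed.

Lemma finite_valued_pair I J (N : T -> I) (M : T -> J) :
  finite_valued N -> finite_valued M -> finite_valued (fun x => (N x, M x)).
Proof.
move=> mN mM [s t]; rewrite (_ : mkset _ = [set x | N x = s] `&` [set x | M x = t]).
  exact: measurableI.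
by apply/seteqP; split=> x /= [-> ->].
Qed.

Lemma finite_valued_ffun I J (N : I -> T -> J) :
  (forall i, finite_valued (N i)) -> finite_valued (fun x => [ffun i => N i x]).
Proof.
move=> mN w; rewrite (_ : mkset _ = \bigcap_(i in [set: I]) [set x | N i x = w i]).
  by apply: fin_bigcap_measurable => // i _; exact: mN.
apply/seteqP; split=> [x /= <- i _|x Nw] /=; first by rewrite ffunE.
by apply/ffunP => i; rewrite ffunE; exact: (Nw i Logic.I).
Qed.

Lemma law_ge0 I (N : T -> I) s : 0 <= law N s.
Proof. by rewrite fine_ge0. Qed.

Lemma lawE I (N : T -> I) s : finite_valued N ->
  mu [set x | N x = s] = (law N s)%:E.
Proof. by move=> mN; rewrite fineK// fin_num_measure. Qed.

Let measure_seq I (N : T -> I) (r : seq I) : finite_valued N -> uniq r ->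
  mu [set x | N x \in r] = (\sum_(s <- r) law N s)%:E.
Proof.
move=> mN; elim: r => [_|s r IH /= /andP[sr ur]].
  by rewrite big_nil (_ : mkset _ = set0) ?measure0//; apply/seteqP; split.
rewrite big_cons EFinD -IH// -lawE//.
rewrite (_ : mkset _ = [set x | N x = s] `|` [set x | N x \in r]); last first.
  apply/seteqP; split=> x /=; first by rewrite inE => /orP[/eqP|]; [left|right].
  by rewrite inE => -[->|->]; rewrite ?eqxx ?orbT.
apply: measureU => //; first exact: (@measurable_finite_valued _ _ (mem r)).
by apply/seteqP; split=> // x /= [-> sr']; rewrite sr' in sr.
Qed.

Lemma sum_law I (N : T -> I) (Q : pred I) : finite_valued N ->
  \sum_(s | Q s) law N s = fine (mu [set x | Q (N x)]).
Proof.
move=> mN; rewrite -big_filter.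
transitivity (fine (\sum_(s <- [seq s <- index_enum I | Q s]) law N s)%:E) => //.
rewrite -measure_seq ?filter_uniq ?index_enum_uniq//; congr (fine (mu _)).
by apply/seteqP; split=> x /=; rewrite mem_filter mem_index_enum andbT.
Qed.

Lemma law_sum1 I (N : T -> I) : finite_valued N -> \sum_s law N s = 1.
Proof.
move=> mN; rewrite sum_law// (_ : mkset _ = setT) ?probability_setT//.
by apply/seteqP.
Qed.

Lemma law_comp I J (N : T -> I) (g : I -> J) t : finite_valued N ->
  law (g \o N) t = \sum_(s | g s == t) law N s.
Proof.
move=> mN; rewrite sum_law//; congr (fine (mu _)).
by apply/seteqP; split=> x /= /eqP.
Qed.

Lemma sum_law_comp I J (N : T -> I) (g : I -> J) (G : J -> R) : finite_valued N ->
  \sum_s law N s * G (g s) = \sum_t law (g \o N) t * G t.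
Proof.
move=> mN; rewrite (partition_big g predT)//=; apply: eq_bigr => t _.
by rewrite law_comp// mulr_suml; apply: eq_bigr => s /eqP ->.
Qed.

End FiniteLaws.

Section Gibbs.
Variables (R : realType) (I : finType).
Implicit Types p q : I -> R.

(** From ln t <= t - 1 at t = q i / p i. Allowing q a smaller total mass spares normalizing the
    comparison law. *)
Lemma gibbs_inequality p q : (forall i, 0 <= p i) -> (forall i, 0 < q i) ->
  \sum_i q i <= \sum_i p i -> - \sum_i p i * ln (p i) <= - \sum_i p i * ln (q i).
Proof.
move=> p0 q0 qp; rewrite lerN2 -subr_ge0 -sumrB.
apply: (@le_trans _ _ (\sum_i (p i - q i))); first by rewrite sumrB subr_ge0.
apply: ler_sum => i _; have [->|pi0] := eqVneq (p i) 0.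
  by rewrite !mul0r !sub0r oppr0 oppr_le0 ltW.
have {}pi0 : 0 < p i by rewrite lt_neqAle eq_sym pi0 p0.
have L : ln (q i / p i) <= q i / p i - 1.
  have := @le_ln1Dx R (q i / p i - 1); rewrite addrCA subrr addr0; apply.
  by rewrite ltrBrDr addrC subrr divr_gt0.
have E : p i * (q i / p i - 1) = q i - p i by field; rewrite gt_eqF.
have : p i * ln (q i / p i) <= q i - p i by rewrite -E ler_pM2l.
by rewrite ln_div ?posrE//; lra.
Qed.

End Gibbs.

(** * Approximating Borel sets by finitary sets *)

Section Approximation.
Variables (R : realType).
Local Notation X := (shift_space R).
Variable mu : probability (borel X) R.
Implicit Types A B : set (borel X).

Definition symdiff A B := (A `\` B) `|` (B `\` A).

Lemma measurable_symdiff A B : measurable A -> measurable B -> measurable (symdiff A B).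
Proof. by move=> mA mB; apply: measurableU; apply: measurableD. Qed.

Definition approximable A := forall e : R, 0 < e ->
  exists n B, finitary n (B : set X) /\ (mu (symdiff A B) < e%:E)%E.

Lemma finitary_approximable n A : finitary n (A : set X) -> approximable A.
Proof.
move=> nA e e0; exists n, A; split=> //.
by rewrite /symdiff setDv setU0 measure0 lte_fin.
Qed.

Lemma approximableC A : approximable A -> approximable (~` A).
Proof.
move=> aA e /aA[n [B [nB AB]]]; exists n, (~` B); split.
  by move=> x y xy nBx /(nB _ _ (agree_sym xy)).
suff -> : symdiff (~` A) (~` B) = symdiff A B by [].
by rewrite /symdiff !setDE !setCK setUC (setIC B) (setIC A).
Qed.

Lemma approximable_mono A B C e1 e2 : measurable A -> measurable B -> measurable C ->
  (mu (symdiff A B) < e1%:E)%E -> (mu (symdiff B C) < e2%:E)%E ->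
  (mu (symdiff A C) < (e1 + e2)%:E)%E.
Proof.
move=> mA mB mC AB BC; apply: (@le_lt_trans _ _ (mu (symdiff A B `|` symdiff B C))).
  apply: le_measure; rewrite ?inE; [| |].
  - exact: measurable_symdiff.
  - by apply: measurableU; exact: measurable_symdiff.
  - by move=> x [[Ax nCx]|[Cx nAx]]; have [Bx|nBx] := pselect (B x);
      [right; left|left; left|left; right|right; right].
apply: le_lt_trans (measureU2 _ _ _) _; [exact: measurable_symdiff..|].
by rewrite EFinD lteD.
Qed.

Lemma approximableU A B : measurable A -> measurable B ->
  approximable A -> approximable B -> approximable (A `|` B).
Proof.
move=> mA mB aA aB e e0; have e20 : 0 < e / 2 by rewrite divr_gt0.
have [n [A' [nA' AA']]] := aA _ e20; have [m [B' [mB' BB']]] := aB _ e20.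
have nU : finitary (maxn n m) (A' `|` B' : set X).
  move=> x y xy [Ax|Bx]; [left|right].
    by apply: nA' Ax => i ?; apply: xy; rewrite leq_max; apply/orP; left.
  by apply: mB' Bx => i ?; apply: xy; rewrite leq_max; apply/orP; right.
have [mA' mB''] := (finitary_measurable nA', finitary_measurable mB').
exists (maxn n m), (A' `|` B'); split=> //.
apply: (@le_lt_trans _ _ (mu (symdiff A A' `|` symdiff B B'))).
  apply: le_measure; rewrite ?inE; [| |].
  - by apply: measurable_symdiff; exact: measurableU.
  - by apply: measurableU; exact: measurable_symdiff.
  - by move=> x [[[Ax|Bx] /not_orP[? ?]]|[[Ax|Bx] /not_orP[? ?]]];
      [left; left|right; left|left; right|right; right].
apply: le_lt_trans (measureU2 _ _ _) _; [exact: measurable_symdiff..|].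
by rewrite [e]splitr EFinD lteD.
Qed.

Lemma approximable_lim (U : nat -> set (borel X)) :
  (forall n, measurable (U n)) -> nondecreasing_seq U ->
  (forall n, approximable (U n)) -> approximable (\bigcup_n U n).
Proof.
move=> mU ndU aU e e0; have e20 : 0 < e / 2 by rewrite divr_gt0.
have mUU : measurable (\bigcup_n U n) by exact: bigcupT_measurable.
have fU (A : set (borel X)) : measurable A -> mu A = (fine (mu A))%:E.
  by move=> mA; rewrite fineK// fin_num_measure.
have cU : (fun n => mu (U n)) @ \oo --> (fine (mu (\bigcup_n U n)))%:E.
  by rewrite -fU//; exact: nondecreasing_cvg_mu.
move/fine_cvg : cU => /cvgrPdist_lt/(_ _ e20)[N _ /(_ N (leqnn N))] /=.
rewrite ltr_norml => /andP[_ UN].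
have [n [B [nB UB]]] := aU N _ e20; exists n, B; split=> //.
rewrite [e]splitr; apply: approximable_mono UB => //.
  exact: (@finitary_measurable R n B nB).
have -> : symdiff (\bigcup_n U n) (U N) = \bigcup_n U n `\` U N.
  rewrite /symdiff -[RHS]setU0; congr (_ `|` _); apply/seteqP; split=> // x [UNx].
  by apply; exists N.
have -> : mu (\bigcup_n U n `\` U N) = (fine (mu (\bigcup_n U n)) - fine (mu (U N)))%:E.
  rewrite EFinB -!fU// measureD//; last by apply: le_lt_trans (probability_le1 mu mUU) _; rewrite ltry.
  by congr (_ - mu _)%E; apply/setIidr/bigcup_sup.
by rewrite lte_fin; lra.
Qed.

(** Approximable measurable sets form a sigma-algebra, countable unions being reduced to increasing
    ones. It contains the open sets, as increasing unions of their finitary interiors. *)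
Lemma measurable_approximable A : measurable A -> approximable A.
Proof.
move=> mA; suff [] : measurable A /\ approximable A by [].
move: A mA; apply: smallest_sub; [split=> //|].
- by split; [exact: measurable0|apply: (@finitary_approximable 0)].
- by move=> A [mA aA]; rewrite setTD; split; [exact: measurableC|exact: approximableC].
- move=> A DA; have mA n : measurable (A n : set (borel X)) by have [] := DA n.
  split; first exact: bigcupT_measurable.
  have -> : \bigcup_n A n = \bigcup_n \big[setU/set0]_(i < n.+1) A i.
    by rewrite bigcup_bigsetU_bigcup.
  apply: approximable_lim.
  + by move=> n; exact: bigsetU_measurable.
  + by move=> m n mn; exact/subsetPset/subset_bigsetU.
  + move=> n; elim: n.+1 => {n} [|n IH].
      by rewrite big_ord0; apply: (@finitary_approximable 0).
    rewrite big_ord_recr/=; apply: approximableU => //; last by have [] := DA n.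
    exact: bigsetU_measurable.
- move=> A oA; split; first exact: sub_sigma_algebra.
  pose U n : set (borel X) := finitary_interior n A.
  have nU n : finitary n (U n) by exact: finitary_finitary_interior.
  rewrite (open_bigcup_finitary oA : A = \bigcup_n U n).
  apply: approximable_lim => [n|m n mn|n]; [exact: finitary_measurable| |exact: finitary_approximable].
  apply/subsetPset => x Ux y xy; apply: Ux => i im; apply: xy; exact: leq_trans mn.
Qed.

End Approximation.

Lemma ln_prod (R : realType) (I : Type) (r : seq I) (F : I -> R) :
  (forall i, 0 < F i) -> ln (\prod_(i <- r) F i) = \sum_(i <- r) ln (F i).
Proof.
move=> F0; elim: r => [|i r IH]; first by rewrite !big_nil ln1.
by rewrite !big_cons lnM ?posrE ?prodr_gt0// IH.
Qed.

(** * Entropy is at most the cross entropy of one letter *)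

Section EntropyUpperBound.
Variables (R : realType).
Local Notation X := (shift_space R).
Local Notation T := (@shift_map R).
Variable mu : probability (borel X) R.
Hypothesis imu : Defs.invariant T mu.

Lemma finite_valued_agree (I : finType) m (b : borel X -> I) :
  (forall x y : X, agree m x y -> b x = b y) -> finite_valued b.
Proof.
move=> bm s; apply: (@finitary_measurable _ m) => x y xy /= <-.
by apply: bm; exact: agree_sym.
Qed.

(** Each piece of the partition is replaced by a finitary set. A point outside all the symmetric
    differences lies in exactly one of these sets, the right one, so b errs only on the union of the
    differences; elsewhere its choice and its default value are immaterial. *)
Lemma approximate_name k (a : borel X -> 'I_k) : finite_valued a ->
  forall e : R, 0 < e -> exists m (b : X -> 'I_k),
    (forall x y, agree m x y -> b x = b y) /\
    law mu (fun x => a x == b x) false < e.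
Proof.
move=> ma e e0.
have k0 : (0 < k)%N := leq_ltn_trans (leq0n _) (ltn_ord (a point)).
have ek : 0 < e / 2 / k%:R by rewrite !divr_gt0// ltr0n.
have /choice[mB mBP] i : exists mB : nat * set (borel X), finitary mB.1 (mB.2 : set X) /\
    (mu (symdiff [set x | a x = i] mB.2) < (e / 2 / k%:R)%:E)%E.
  by have [m [B [? ?]]] := measurable_approximable mu (ma i) ek; exists (m, B).
pose m := \max_i (mB i).1.
pose b (x : X) := odflt (a point) [pick i | `[< (mB i).2 x >]].
have mBm i : finitary m ((mB i).2 : set X).
  by apply: finitary_le (mBP i).1; exact: leq_bigmax.
have bm x y : agree m x y -> b x = b y.
  move=> xy; rewrite /b; congr (odflt _ _); apply: eq_pick => i /=.
  apply/asboolP/asboolP; apply: mBm => //; exact: agree_sym.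
pose S i := symdiff [set x | a x = i] (mB i).2.
have mS i : measurable (S i).
  by apply: measurable_symdiff => //; exact: finitary_measurable (mBm i).
have sub : [set x | (a x == b x) = false] `<=` \big[setU/set0]_(i < k) S i.
  move=> x /= abx; apply: contrapT => nS.
  have {}nS i : ~ S i x by move=> Six; apply: nS; rewrite (bigD1 i)//=; left.
  suff Bx i : `[< (mB i).2 x >] = (i == a x).
    by move: abx; rewrite /b (eq_pick Bx); case: pickP => [j /eqP ->|/(_ (a x))]; rewrite eqxx.
  apply/asboolP/eqP => [Bx|->].
    by apply: contrapT => ia; apply: (nS i); right; split=> // /esym.
  by apply: contrapT => nBx; apply: (nS (a x)); left.
have SE (r : seq 'I_k) : measurable (\big[setU/set0]_(i <- r) S i) /\
    (mu (\big[setU/set0]_(i <- r) S i) <= ((size r)%:R * (e / 2 / k%:R))%:E)%E.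
  split; first exact: bigsetU_measurable.
  elim: r => [|i r IH]; first by rewrite big_nil measure0 mul0r.
  rewrite big_cons; apply: le_trans (measureU2 _ _ _) _ => //.
    exact: bigsetU_measurable.
  rewrite /= -natr1 mulrDl mul1r addrC EFinD leeD//; apply: ltW; exact: (mBP i).2.
have [mSk Sk] := SE (index_enum 'I_k).
have mab : measurable [set x : borel X | (a x == b x) = false].
  apply: (finite_valued_comp (fun st : 'I_k * 'I_k => st.1 == st.2)
    (finite_valued_pair ma (finite_valued_agree bm))).
exists m, b; split=> //.
have : (mu [set x | (a x == b x) = false] <= (e / 2)%:E)%E.
  apply: le_trans (le_measure _ _ _ sub) _; rewrite ?inE//.
  apply: le_trans Sk _.
  rewrite -[size _]/(size (index_enum 'I_k)) /index_enum -enumT size_enum_ord.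
  by rewrite mulrC mulfVK// gt_eqF// ltr0n.
rewrite -(@fineK _ (mu _)) ?fin_num_measure// lee_fin => /le_lt_trans; apply.
by rewrite ltr_pdivrMr// ltr_pMr// ltr1n.
Qed.

Lemma measurable_shift_map : measurable_fun [set: borel X] (T : borel X -> borel X).
Proof.
have H := @measurability _ _ (borel X) (borel X) setT T (@open X) (erefl _).
apply: H => _ [A oA <-]; rewrite setTI.
by apply: sub_sigma_algebra; move/continuousP : (@shift_map_continuous R); apply.
Qed.

Lemma finite_valued_iter (I : finType) (N : borel X -> I) i : finite_valued N ->
  finite_valued (fun x : borel X => N (iter i T x)).
Proof.
move=> mN s; elim: i => [|i IH]; first exact: mN.
rewrite (_ : mkset _ = T @^-1` [set x | N (iter i T x) = s]).
  by rewrite -[_ @^-1` _]setTI; exact: measurable_shift_map.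
by apply/seteqP; split => x; rewrite /mkset iterSr.
Qed.

Lemma law_iter (I : finType) (N : borel X -> I) i s : finite_valued N ->
  law mu (fun x : borel X => N (iter i T x)) s = law mu N s.
Proof.
move=> mN; elim: i => // i <-; rewrite /law.
rewrite -[in RHS](imu (finite_valued_iter i mN s)); congr (fine (mu _)).
by apply/seteqP; split => x; rewrite /mkset iterSr.
Qed.

(** A representative of the cylinder of u, at which functions of the first l letters are
    evaluated. *)
Definition word_ext l (u : {ffun 'I_l -> bool}) : X :=
  fun j => if insub j is Some j' then u j' else false.

Lemma word_extE l (x : X) : agree l (word_ext [ffun j : 'I_l => x j]) x.
Proof. by move=> i il; rewrite /word_ext insubT ffunE. Qed.

Definition letter_law : bool -> R := law mu (fun x : borel X => x 0%N).

(** The cross entropy of the first letter relative to the Bernoulli law of parameter q. *)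
Definition letter_cost (q : R) : R :=
  - (letter_law true * ln q + letter_law false * ln (1 - q)).

(* The cross entropy of the names of length n relative to the following
   distribution: draw n + m independent bits of parameter q, read off the
   n letters of the approximating code b, corrupt each with probability delta. *)
Lemma join_entropy_le k (A : 'I_k -> set (borel X)) (a : borel X -> 'I_k) m
    (b : X -> 'I_k) (q delta : R) n :
  (forall i, measurable (A i)) -> (forall i x, A i x <-> a x = i) ->
  (forall x y, agree m x y -> b x = b y) ->
  0 < q < 1 -> 0 < delta < 1 ->
  join_entropy T mu A n <= (n + m)%:R * letter_cost q +
    n%:R * - (law mu (fun x => a x == b x) true * ln (1 - delta) +
              law mu (fun x => a x == b x) false * ln (delta / k%:R)).
Proof.
move=> mA Aa bm /andP[q0 q1] /andP[de0 de1].
pose p := letter_law; pose eta := law mu (fun x => a x == b x).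
have k0 : (0 < k)%N := leq_ltn_trans (leq0n _) (ltn_ord (a point)).
have ma : finite_valued a.
  move=> i; rewrite (_ : mkset _ = A i)//.
  by apply/seteqP; split=> x /= /Aa.
(* Names are considered jointly with n + m letters, since b reads m letters from each of n
   successive positions. Q is the marginal of the comparison law on names. *)
pose S : finType := ({ffun 'I_n -> 'I_k} * {ffun 'I_(n + m) -> bool})%type.
pose beta (c : bool) := if c then q else 1 - q.
pose rho (e : bool) := if e then 1 - delta else delta / k%:R.
have beta0 c : 0 < beta c by case: c; rewrite /beta ?subr_gt0.
have rho0 e : 0 < rho e by case: e; rewrite /rho ?subr_gt0// divr_gt0// ltr0n.
pose aname (x : borel X) := [ffun i : 'I_n => a (iter i T x)].
pose word (x : borel X) := [ffun j : 'I_(n + m) => x j].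
pose N x := (aname x, word x).
have mai i := finite_valued_iter i ma.
have mxj j : finite_valued (fun x : borel X => x j).
  by apply: (@finite_valued_agree _ j.+1) => x y; apply.
have maname : finite_valued aname by apply: finite_valued_ffun.
have mN : finite_valued N.
  by apply: finite_valued_pair => //; apply: finite_valued_ffun.
pose err (s : S) (i : 'I_n) :=
  s.1 i == b (iter i T (word_ext s.2)).
pose term (s : S) := \prod_j beta (s.2 j) * \prod_i rho (err s i).
pose Q w := \sum_u term (w, u).
have term0 s : 0 < term s by rewrite mulr_gt0// prodr_gt0.
have term_le s : term s <= Q s.1.
  case: s => w u; rewrite /Q (bigD1 u)//= lerDl; apply: sumr_ge0 => v _; exact: ltW.
have Q0 w : 0 < Q w by apply: lt_le_trans (term_le (w, [ffun=> false])).
have Q1 : \sum_w Q w <= \sum_w law mu aname w.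
  rewrite law_sum1// exchange_big/=.
  have S1 (u : {ffun 'I_(n + m) -> bool}) : \sum_w term (w, u) <= \prod_j beta (u j).
    rewrite /term/= -mulr_sumr ler_piMr//; first by apply: prodr_ge0 => j _; exact: ltW.
    rewrite -(bigA_distr_bigA (fun (i : 'I_n) c => rho (c == b (iter i T (word_ext u))))).
    apply: prodr_ile1 => i _; rewrite sumr_ge0 => [|c _]; last exact: ltW.
    rewrite (bigD1 (b (iter i T (word_ext u))))//= eqxx /rho.
    rewrite (eq_bigr (fun=> delta / k%:R)) => [|c /negbTE ->//].
    rewrite sumr_const cardC1 card_ord -[_ *+ _]mulr_natr -subr_ge0.
    (* At each position the correct symbol and the k - 1 others carry a mass 1 - delta + (k - 1)
       delta / k, at most 1. *)
    have -> : 1 - (1 - delta + delta / k%:R * k.-1%:R) = delta / k%:R * (k%:R - k.-1%:R).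
      by field; rewrite pnatr_eq0 -lt0n.
    by rewrite mulr_ge0 ?divr_ge0 ?(ltW de0)// subr_ge0 ler_nat leq_pred.
  apply: le_trans (ler_sum _ (fun u _ => S1 u)) _.
  rewrite -(bigA_distr_bigA (fun (_ : 'I_(n + m)) c => beta c)) big1// => j _.
  by rewrite big_bool /beta /= addrC subrK.
have pE (w : {ffun 'I_n -> 'I_k}) : fine (mu (\bigcap_(i in [set: 'I_n]) iter i T @^-1` A (w i))) = law mu aname w.
  congr (fine (mu _)); apply/seteqP; split=> x /=.
    by move=> H; apply/ffunP => i; rewrite ffunE; apply/Aa/H.
  by move=> <- i _; apply/Aa; rewrite ffunE.
rewrite /join_entropy (eq_bigr (fun w => law mu aname w * ln (law mu aname w))); last first.
  by move=> w _; rewrite pE.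
apply: le_trans (gibbs_inequality (law_ge0 mu aname) Q0 Q1) _.
rewrite -(sum_law_comp mu fst (fun w => ln (Q w)) mN).
have lnterm (s : S) : ln (term s) = \sum_j ln (beta (s.2 j)) + \sum_i ln (rho (err s i)).
  by rewrite /term lnM ?posrE ?prodr_gt0// !ln_prod.
apply: (@le_trans _ _ (- \sum_(s : S) law mu N s *
    (\sum_j ln (beta (s.2 j)) + \sum_i ln (rho (err s i))))).
  rewrite lerN2; apply: ler_sum => s _; rewrite -lnterm ler_wpM2l ?law_ge0//.
  by rewrite ler_ln ?posrE.
(* By invariance every letter has the law of the first and every error the law of the error at time
   0. The logarithm of a term being a sum, linearity of expectation does the work of
   independence. *)
have E1 j : \sum_(s : S) law mu N s * ln (beta (s.2 j)) = p true * ln q + p false * ln (1 - q).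
  rewrite (sum_law_comp mu (fun s : S => s.2 j) (fun c => ln (beta c)) mN).
  rewrite big_bool/= /p /letter_law -!(@law_iter _ (fun x : borel X => x 0%N) j)//.
  congr (_ * _ + _ * _); rewrite /law; congr (fine (mu _)); apply/seteqP; split=> x /=;
    by rewrite ffunE iter_shift_map addn0.
have E2 i : \sum_(s : S) law mu N s * ln (rho (err s i)) =
    eta true * ln (1 - delta) + eta false * ln (delta / k%:R).
  rewrite (sum_law_comp mu (fun s : S => err s i) (fun c => ln (rho c)) mN).
  have mab : finite_valued (fun x => a x == b x).
    exact: (finite_valued_comp (fun st : 'I_k * 'I_k => st.1 == st.2)
      (finite_valued_pair ma (finite_valued_agree bm))).
  rewrite big_bool/= /eta -!(@law_iter _ (fun x => a x == b x) i)//.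
  have NE x : err (N x) i = (a (iter i T x) == b (iter i T x)).
    rewrite /err /= ffunE; congr (_ == _); apply: bm => j jm.
    by rewrite !iter_shift_map word_extE// (leq_trans _ (leq_add (ltn_ord i) (leqnn m)))// addSn ltnS leq_add2l ltnW.
  by congr (_ * _ + _ * _); rewrite /law; congr (fine (mu _)); apply/seteqP; split=> x /=;
    rewrite NE.
under eq_bigr do rewrite mulrDr !mulr_sumr.
rewrite big_split/= exchange_big/= [X in _ + X]exchange_big/=.
rewrite (eq_bigr _ (fun j _ => E1 j)) [X in _ + X](eq_bigr _ (fun i _ => E2 i)).
by rewrite !sumr_const !card_ord opprD !mulrN !mulr_natl.
Qed.

Lemma letter_cost_ge0 q : 0 < q < 1 -> 0 <= letter_cost q.
Proof.
move=> /andP[q0 q1]; rewrite /letter_cost oppr_ge0.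
have l0 c : 0 <= letter_law c by exact: law_ge0.
have lq : ln q <= 0 by exact/ln_le0/ltW.
have lq' : ln (1 - q) <= 0 by apply: ln_le0; lra.
have h1 := mulr_ge0_le0 (l0 true) lq; have h2 := mulr_ge0_le0 (l0 false) lq'; lra.
Qed.

(* The limit defining the entropy need not be known to exist: by convention a
   divergent sequence has limit 0, and the bound is nonnegative. *)
Lemma ks_entropy_le q : 0 < q < 1 -> (ks_entropy T mu <= (letter_cost q)%:E)%E.
Proof.
move=> q01; have c0 := letter_cost_ge0 q01.
apply: ub_ereal_sup => _ [k [A [mA tA cA] ->]]; rewrite lee_fin.
have /choice[a aP] (x : borel X) : exists i, A i x.
  have [i _ Aix] : (\bigcup_i A i) x by rewrite cA.
  by exists i.
have Aa i x : A i x <-> a x = i.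
  split=> [Aix|<-//]; apply: tA => //; exists x; split=> //; exact: aP.
have k0 : (0 < k)%N := leq_ltn_trans (leq0n _) (ltn_ord (a point)).
have ma : finite_valued a.
  move=> i; rewrite (_ : mkset _ = A i)//.
  by apply/seteqP; split=> x /= /Aa.
rewrite /partition_entropy.
have [cv|ncv] := pselect (cvgn (fun n => n%:R^-1 * join_entropy T mu A n)); last first.
  by rewrite (dvgP ncv).
apply/ler_addgt0Pr => e e0; have e30 : 0 < e / 3 by rewrite divr_gt0.
(* Chosen so that - ln (1 - delta) = e / 3: an uncorrupted position costs e / 3. *)
pose delta := 1 - expR (- (e / 3)).
have de01 : 0 < delta < 1.
  by rewrite subr_gt0 expR_lt1 oppr_lt0 e30 /= gtrBl expR_gt0.
(* L exceeds the cost of one corrupted position, so an error probability below e / 3 / L contributes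
   at most e / 3 per position. *)
pose L := `|ln (delta / k%:R)| + 1.
have L0 : 0 < L by rewrite ltr_wpDl.
have [m [b [bm ab]]] := approximate_name ma (divr_gt0 e30 L0).
have H n : join_entropy T mu A n <= (n + m)%:R * letter_cost q + n%:R * (e / 3 + e / 3).
  apply: le_trans (join_entropy_le n mA Aa bm q01 de01) _; rewrite lerD2l ler_wpM2l//.
  set x := law mu _ true; set y := law mu _ false in ab *.
  have -> : ln (1 - delta) = - (e / 3) by rewrite /delta opprB addrC subrK expRK.
  have mab : finite_valued (fun x => a x == b x).
    exact: (finite_valued_comp (fun st : 'I_k * 'I_k => st.1 == st.2)
      (finite_valued_pair ma (finite_valued_agree bm))).
  have x0 : 0 <= x by exact: law_ge0.
  have y0 : 0 <= y by exact: law_ge0.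
  have xy : x + y = 1 by rewrite -(law_sum1 mu mab) big_bool.
  rewrite opprD lerD//.
    by rewrite mulrN opprK ler_piMl ?(ltW e30)//; lra.
  apply: (@le_trans _ _ (y * L)); last by rewrite -ler_pdivlMr// ltW.
  rewrite -mulrN ler_wpM2l// /L.
  by apply: le_trans (ler_norm _) _; rewrite normrN lerDl.
apply: limr_le => //.
(* From n >= M on, the m extra letters cost at most n e / 3. *)
pose M := (m%:R * letter_cost q) / (e / 3).
exists (Num.truncn M).+1 => // n /= nM.
have n0 : 0 < n%:R :> R by rewrite ltr0n (leq_trans _ nM).
rewrite ler_pdivrMl//; apply: le_trans (H n) _; rewrite natrD.
have : M <= n%:R.
  by apply: le_trans (ltW (truncnS_gt M)) _; rewrite ler_nat.
rewrite /M ler_pdivrMr// => mn.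
have -> : n%:R * (letter_cost q + e) = n%:R * letter_cost q + n%:R * (e / 3) + n%:R * (e / 3 + e / 3).
  by field.
by rewrite lerD2r mulrDl lerD2l.
Qed.

End EntropyUpperBound.

(** * Bernoulli measures *)

(* The itinerary of a point of [0,1[ under the skew doubling map whose branches
   have lengths 1 - p and p; it transports the Lebesgue measure to the
   Bernoulli measure of parameter p. *)
Section Coding.
Variables (R : realType) (p : R).
Hypothesis p01 : 0 <= p <= 1.
Local Notation X := (shift_space R).
Local Notation T := (@shift_map R).

(** For p = 0 or p = 1 the branch that would divide by zero is never taken on [0, 1[. *)
Definition skew_map (x : R) : R :=
  if x < 1 - p then x / (1 - p) else (x - (1 - p)) / p.

Definition itinerary (x : R) : borel X := fun n => 1 - p <= iter n skew_map x.

Definition letter_weight (c : bool) : R := if c then p else 1 - p.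

(** The left end of the interval of points whose itinerary begins with w: prepending a letter
    applies the corresponding inverse branch. *)
Fixpoint word_left (w : seq bool) : R :=
  if w is c :: w' then
    if c then 1 - p + p * word_left w' else (1 - p) * word_left w'
  else 0.

Definition word_weight (w : seq bool) : R := \prod_(c <- w) letter_weight c.

Lemma letter_weight_ge0 c : 0 <= letter_weight c.
Proof. by have /andP[p0 p1] := p01; case: c => //=; rewrite subr_ge0. Qed.

Lemma word_weight_ge0 w : 0 <= word_weight w.
Proof. by apply: prodr_ge0 => c _; exact: letter_weight_ge0. Qed.

Lemma word_left_bounds w : 0 <= word_left w /\ word_left w + word_weight w <= 1.
Proof.
have /andP[p0 p1] := p01.
elim: w => [|c w [l0 l1]]; first by rewrite /word_weight big_nil /=; lra.
rewrite /word_weight big_cons -/(word_weight w); case: c => /=.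
  split; first by rewrite addr_ge0 ?subr_ge0// mulr_ge0.
  by rewrite -addrA -mulrDr; have := ler_wpM2l p0 l1; lra.
have p1' : 0 <= 1 - p by rewrite subr_ge0.
split; first by rewrite mulr_ge0.
by rewrite -mulrDr; have := ler_wpM2l p1' l1; lra.
Qed.

Lemma skew_map_itv x : 0 <= x < 1 -> 0 <= skew_map x < 1.
Proof.
have /andP[p0 p1] := p01.
move=> /andP[x0 x1]; rewrite /skew_map; case: ifPn => [xp|].
  have p1' : 0 < 1 - p by apply: le_lt_trans xp.
  by rewrite divr_ge0 ?(ltW p1')//= ltr_pdivrMr// mul1r.
rewrite -leNgt => px; have p0' : 0 < p by lra.
by rewrite divr_ge0 ?subr_ge0//= ltr_pdivrMr// mul1r; lra.
Qed.

Definition cylinder (w : seq bool) : set (borel X) :=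
  [set x | forall i, (i < size w)%N -> x i = nth false w i].

Lemma itinerary_cylinder w :
  `[0, 1[%classic `&` itinerary @^-1` cylinder w =
  `[word_left w, word_left w + word_weight w[%classic.
Proof.
have /andP[p0 p1] := p01.
suff H x : (0 <= x < 1 /\ forall i, (i < size w)%N -> itinerary x i = nth false w i) <->
    word_left w <= x < word_left w + word_weight w.
  apply/seteqP; split=> x /=.
    by rewrite !in_itv/= => -[x01 xw]; apply/H.
  by rewrite !in_itv/= => /H.
elim: w x => [|c w IH] x.
  by rewrite /word_weight big_nil /= add0r; split=> [[]|].
have step : (forall i, (i < size (c :: w))%N -> itinerary x i = nth false (c :: w) i) <->
    (1 - p <= x) = c /\ forall i, (i < size w)%N -> itinerary (skew_map x) i = nth false w i.
  split=> [H|[xc H] [|i] iw//]; last by rewrite /itinerary iterSr; exact: H.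
  by split=> [|i iw]; [exact: (H 0%N)|have := H i.+1 iw; rewrite /itinerary iterSr].
have [l0 l1] := word_left_bounds w.
have w0 := word_weight_ge0 w.
rewrite /word_weight big_cons -/(word_weight w).
split=> [[x01 /step[xc H]]|xI].
  have /IH : 0 <= skew_map x < 1 /\ forall i, (i < size w)%N ->
    itinerary (skew_map x) i = nth false w i by split=> //; exact: skew_map_itv.
  rewrite /skew_map; case: c xc {step} => /= xc.
    have p0' : 0 < p by lra.
    by rewrite ltNge xc /= ler_pdivlMr// ltr_pdivrMr//; lra.
  move/negbT : xc; rewrite -ltNge => xc; rewrite xc.
  have p1' : 0 < 1 - p by lra.
  by rewrite ler_pdivlMr// ltr_pdivrMr//; lra.
case: c xI step => /= /andP[xl xr] step.
  (* An interval that contains x is nonempty, which excludes a branch of length zero. *)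
  have p0' : 0 < p.
    rewrite lt_neqAle p0 andbT eq_sym; apply/eqP => pE.
    by move: xl xr; rewrite pE !mul0r; lra.
  have h1 := mulr_ge0 p0 l0.
  have h2 := ler_wpM2l p0 l1.
  have xc : 1 - p <= x by lra.
  split; first lra.
  apply/step; split=> //; have [|_] := (IH (skew_map x)).2; last by [].
  by rewrite /skew_map ltNge xc /= ler_pdivlMr// ltr_pdivrMr//; lra.
have p1' : 0 < 1 - p.
  rewrite lt_neqAle subr_ge0 p1 andbT eq_sym; apply/eqP => pE.
  by move: xl xr; rewrite pE !mul0r; lra.
have h1 := mulr_ge0 (ltW p1') l0.
have h2 := ler_wpM2l (ltW p1') l1.
have xc : x < 1 - p by lra.
split; first lra.
apply/step; split; first by apply/negbTE; rewrite -ltNge.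
have [|_] := (IH (skew_map x)).2; last by [].
by rewrite /skew_map xc ler_pdivlMr// ltr_pdivrMr//; lra.
Qed.

Definition prefix_word n (u : {ffun 'I_n -> bool}) : seq bool :=
  [seq u i | i <- enum 'I_n].

Lemma prefix_wordE n (u : {ffun 'I_n -> bool}) :
  [set x : borel X | [ffun j : 'I_n => x j] = u] = cylinder (prefix_word u).
Proof.
have nthE (i : 'I_n) : nth false (prefix_word u) i = u i.
  by rewrite (nth_map i) ?size_enum_ord// nth_ord_enum.
apply/seteqP; split=> x /=.
  move=> <- i; rewrite size_map size_enum_ord => iin.
  by rewrite -[i]/(nat_of_ord (Ordinal iin)) (nth_map (Ordinal iin)) ?size_enum_ord// nth_ord_enum ffunE.
move=> H; apply/ffunP => j; rewrite ffunE -nthE; apply: H.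
by rewrite size_map size_enum_ord.
Qed.

Lemma word_weight_prefix n (u : {ffun 'I_n -> bool}) :
  word_weight (prefix_word u) = \prod_i letter_weight (u i).
Proof. by rewrite /word_weight big_map big_enum. Qed.

Lemma finitary_prefix n (A : set (borel X)) : finitary n (A : set X) ->
  A = [set x | [pred u | `[< A (word_ext R u) >]] [ffun j : 'I_n => x j]].
Proof.
move=> nA; apply/seteqP; split=> x /=.
  by move=> Ax; apply/asboolP; apply: nA Ax; apply: agree_sym; exact: word_extE.
by move/asboolP; apply: nA; exact: word_extE.
Qed.

Local Notation D := (`[0, 1[%classic : set R).

Let measurable_cylinder w : measurable (D `&` itinerary @^-1` cylinder w).
Proof. by rewrite itinerary_cylinder. Qed.

Let measurable_finitary n (A : set (borel X)) : finitary n (A : set X) ->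
  measurable (D `&` itinerary @^-1` A).
Proof.
move=> nA; pose Q (u : {ffun 'I_n -> bool}) := `[< A (word_ext R u) >].
rewrite (_ : _ `&` _ =
    \bigcup_(u in [set u | Q u]) (D `&` itinerary @^-1` cylinder (prefix_word u))).
  by apply: fin_bigcup_measurable => // u _; exact: measurable_cylinder.
rewrite {1}(finitary_prefix nA); apply/seteqP; split=> x.
  move=> [x01 /= Qx]; exists [ffun j : 'I_n => itinerary x j] => //.
  by split=> //; rewrite -prefix_wordE.
by move=> [u /= Qu [x01]]; rewrite -prefix_wordE /= => xu; split=> //=; rewrite xu.
Qed.

Lemma measurable_itinerary : measurable_fun D itinerary.
Proof.
have H := @measurability _ _ R (borel X) D itinerary (@open X) (erefl _).
apply: H => _ [A oA <-].
rewrite (open_bigcup_finitary oA) preimage_bigcup setI_bigcupr.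
apply: bigcupT_measurable => n; apply: measurable_finitary.
exact: finitary_finitary_interior.
Qed.

(* p01 is a parameter so that the measure structure can be inferred. *)
Definition bernoulli_measure (_ : 0 <= p <= 1) (A : set (borel X)) : \bar R :=
  lebesgue_measure (D `&` itinerary @^-1` A).

Let bernoulli_measure0 : bernoulli_measure p01 set0 = 0%E.
Proof. by rewrite /bernoulli_measure preimage_set0 setI0 measure0. Qed.

Let bernoulli_measure_ge0 A : (0 <= bernoulli_measure p01 A)%E.
Proof. exact: measure_ge0. Qed.

Let bernoulli_measure_sigma_additive : semi_sigma_additive (bernoulli_measure p01).
Proof.
move=> F mF tF mUF; rewrite /bernoulli_measure preimage_bigcup setI_bigcupr.
apply: measure_semi_sigma_additive.
- by move=> n; apply: measurable_itinerary.
- move=> i j _ _ [x [[_ Fix] [_ Fjx]]]; apply: tF => //.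
  by exists (itinerary x).
- by apply: bigcupT_measurable => n; apply: measurable_itinerary.
Qed.

HB.instance Definition _ := isMeasure.Build _ _ _ (bernoulli_measure p01)
  bernoulli_measure0 bernoulli_measure_ge0 bernoulli_measure_sigma_additive.

Let bernoulli_measureT : bernoulli_measure p01 setT = 1%E.
Proof.
rewrite /bernoulli_measure preimage_setT setIT lebesgue_measure_itv/=.
by rewrite lte_fin ltr01 -EFinB subr0.
Qed.

HB.instance Definition _ := @Measure_isProbability.Build _ _ R
  (bernoulli_measure p01) bernoulli_measureT.

Definition bernoulli_shift : probability (borel X) R := bernoulli_measure p01.

Lemma bernoulli_cylinder w : bernoulli_shift (cylinder w) = (word_weight w)%:E.
Proof.
rewrite /bernoulli_shift/= /bernoulli_measure itinerary_cylinder lebesgue_measure_itv/=.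
rewrite lte_fin ltrDl; case: ifPn => [_|].
  by rewrite -EFinB addrAC subrr add0r.
rewrite -leNgt => w0; congr _%:E; apply/eqP.
by rewrite eq_le w0 word_weight_ge0.
Qed.

Lemma law_bernoulli n (u : {ffun 'I_n -> bool}) :
  law bernoulli_shift (fun x : borel X => [ffun j : 'I_n => x j]) u =
  \prod_i letter_weight (u i).
Proof. by rewrite /law prefix_wordE bernoulli_cylinder word_weight_prefix. Qed.

Let mprefix n : finite_valued (fun x : borel X => [ffun j : 'I_n => x j]).
Proof.
apply: finite_valued_ffun => j.
by apply: (@finite_valued_agree _ _ j.+1) => x y; apply.
Qed.

Lemma prefix_shiftE n (u : {ffun 'I_n -> bool}) :
  [set x : borel X | [ffun j : 'I_n => T x j] = u] =
  cylinder (false :: prefix_word u) `|` cylinder (true :: prefix_word u).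
Proof.
rewrite (_ : mkset _ = T @^-1` cylinder (prefix_word u)); last first.
  by rewrite -prefix_wordE.
apply/seteqP; split=> x /=.
  by case x0 : (x 0%N) => H; [right|left] => -[|i] // /H.
by move=> [H|H] i iw; exact: (H i.+1).
Qed.

(* Both sides are determined by finitary sets, where prepending one letter
   multiplies the weights by (1 - p) + p = 1. *)
Lemma bernoulli_invariant : Defs.invariant T bernoulli_shift.
Proof.
have mT : measurable_fun [set: borel X] (T : borel X -> borel X) := @measurable_shift_map R.
have lawT n (u : {ffun 'I_n -> bool}) :
    law bernoulli_shift (fun x : borel X => [ffun j : 'I_n => T x j]) u =
    law bernoulli_shift (fun x : borel X => [ffun j : 'I_n => x j]) u.
  rewrite law_bernoulli /law prefix_shiftE.
  have mcyl w : measurable (cylinder w).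
    by apply: (@finitary_measurable _ (size w)) => x y xy xw i iw; rewrite -xy ?xw.
  have -> : bernoulli_shift (cylinder (false :: prefix_word u) `|` cylinder (true :: prefix_word u)) =
      (bernoulli_shift (cylinder (false :: prefix_word u)) +
       bernoulli_shift (cylinder (true :: prefix_word u)))%E.
    apply: measureU => //; apply/seteqP; split=> // x [H H'].
    by have := H 0%N isT; rewrite (H' 0%N isT).
  rewrite !bernoulli_cylinder -EFinD /= /word_weight !big_cons -mulrDl subrK mul1r.
  by rewrite -/(word_weight _) word_weight_prefix.
(* Finitary sets are stable under intersection and generate the Borel sets, so two probability
   measures that agree on them are equal. *)
pose G : set (set (borel X)) := [set A | exists n, finitary n (A : set X)].
have Gm : G `<=` measurable by move=> A [n nA]; exact: finitary_measurable nA.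
have GI : setI_closed G.
  move=> A B [n nA] [m mB]; exists (maxn n m) => x y xy [Ax Bx]; split.
    by apply: nA Ax => i ni; apply: xy; rewrite leq_max ni.
  by apply: mB Bx => i mi; apply: xy; rewrite leq_max mi orbT.
have mT' n : finite_valued (fun x : borel X => [ffun j : 'I_n => T x j]).
  exact: (@finite_valued_iter _ _ (fun x : borel X => [ffun j : 'I_n => x j]) 1).
pose TM : {mfun borel X >-> borel X} := mfun_Sub (mem_set mT).
suff H A : measurable A -> distribution bernoulli_shift TM A = bernoulli_shift A.
  by move=> A mA; rewrite -[RHS]H.
move=> mA; apply: (@g_sigma_algebra_measure_unique _ R _ G Gm (fun=> setT)) => //.
- by move=> _; exists 0%N.
- by apply/seteqP; split=> // x _; exists 0%N.
- move=> B [n nB]; rewrite (finitary_prefix nB) /=.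
  pose Q (u : {ffun 'I_n -> bool}) := `[< B (word_ext R u) >].
  have E1 := sum_law bernoulli_shift Q (@mprefix n).
  have E2 := sum_law bernoulli_shift Q (mT' n).
  have F (N : borel X -> {ffun 'I_n -> bool}) : finite_valued N ->
      bernoulli_shift [set x | Q (N x)] = (fine (bernoulli_shift [set x | Q (N x)]))%:E.
    by move=> mN; rewrite fineK// fin_num_measure//; exact: measurable_finite_valued.
  rewrite (F _ (@mprefix n)) -E1 -(eq_bigr _ (fun u _ => lawT n u)) E2.
  exact: F (mT' n).
- by move=> _; apply: le_lt_trans (probability_le1 _ measurableT) _; rewrite ltry.
- have : <<s G >> A; last by [].
  apply: smallest_sub mA; first exact: smallest_sigma_algebra.
  move=> B oB; rewrite (open_bigcup_finitary oB : B = _).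
  pose GT : measurableType _ := g_sigma_algebraType G.
  apply: (@bigcupT_measurable _ GT) => n; apply: sub_sigma_algebra.
  by exists n; exact: finitary_finitary_interior.
Qed.

End Coding.

(** * The binary entropy function *)

Definition binary_entropy (R : realType) (p : R) : R := - (p * ln p + (1 - p) * ln (1 - p)).

Section BinaryEntropyShape.
Variable R : realType.
Implicit Types x y w t : R.

Lemma lnlt1 x : 0 < x -> x != 1 -> ln x < x - 1.
Proof.
move=> x0 x1; have lx0 : ln x != 0 by rewrite ln_eq0.
have := expR_gt1Dx lx0; rewrite lnK ?posrE//; lra.
Qed.

Definition cross_entropy w x : R := - (x * ln w + (1 - x) * ln (1 - w)).

Lemma mul_ln_ratio_le x w : 0 <= x -> 0 < w -> x * ln w - x * ln x <= w - x.
Proof.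
move=> x0 w0; have [->|xn0] := eqVneq x 0; first by rewrite !mul0r !subr0 ltW.
have {x0 xn0}x0 : 0 < x by rewrite lt_neqAle eq_sym xn0.
have E : x * (w / x - 1) = w - x by field; rewrite gt_eqF.
have wx0 : 0 < w / x by rewrite divr_gt0.
have [wx1|wx1] := eqVneq (w / x) 1.
  by have -> : w = x; [exact: divr1_eq|rewrite !subrr].
by rewrite -mulrBr -ln_div ?posrE// -E ler_pM2l// ltW// lnlt1.
Qed.

Lemma mul_ln_ratio_lt x w : 0 < x -> 0 < w -> x != w -> x * ln w - x * ln x < w - x.
Proof.
move=> x0 w0 xw.
have E : x * (w / x - 1) = w - x by field; rewrite gt_eqF.
rewrite -mulrBr -ln_div ?posrE// -E ltr_pM2l// lnlt1 ?divr_gt0//.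
by apply: contra_neq xw => /divr1_eq.
Qed.

Lemma binary_entropy_le_cross x w : 0 <= x <= 1 -> 0 < w < 1 ->
  binary_entropy x <= cross_entropy w x.
Proof.
move=> /andP[x0 x1] /andP[w0 w1].
have h1 := mul_ln_ratio_le x0 w0.
have x1' : 0 <= 1 - x by rewrite subr_ge0.
have w1' : 0 < 1 - w by rewrite subr_gt0.
have := mul_ln_ratio_le x1' w1'; rewrite /binary_entropy /cross_entropy; lra.
Qed.

Lemma binary_entropy_lt_cross x w : 0 < x < 1 -> 0 < w < 1 -> x != w ->
  binary_entropy x < cross_entropy w x.
Proof.
move=> /andP[x0 x1] /andP[w0 w1] xw.
have h1 := mul_ln_ratio_lt x0 w0 xw.
have x1' : 0 <= 1 - x by rewrite subr_ge0 ltW.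
have w1' : 0 < 1 - w by rewrite subr_gt0.
have := mul_ln_ratio_le x1' w1'; rewrite /binary_entropy /cross_entropy; lra.
Qed.

Lemma binary_entropy0 : binary_entropy (0 : R) = 0.
Proof. by rewrite /binary_entropy mul0r subr0 ln1 mulr0 addr0 oppr0. Qed.

Lemma binary_entropy1 : binary_entropy (1 : R) = 0.
Proof. by rewrite /binary_entropy subrr mul0r ln1 mulr0 addr0 oppr0. Qed.

(* The cross entropy relative to the mean w is affine in x and agrees with the
   entropy at w. *)
Lemma binary_entropy_concave x y t : 0 <= x <= 1 -> 0 <= y <= 1 -> 0 < t < 1 ->
  t * binary_entropy x + (1 - t) * binary_entropy y <=
  binary_entropy (t * x + (1 - t) * y).
Proof.
move=> x01 y01 /andP[t0 t1]; set w := t * x + (1 - t) * y.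
have /andP[x0 x1] := x01; have /andP[y0 y1] := y01.
have t1' : 0 < 1 - t by rewrite subr_gt0.
(* At w = 0 or 1 the convention ln 0 = 0 spoils the bound by the cross entropy; there x and y both
   equal w. *)
have [wE|wn0] := eqVneq w 0.
  have [tx ty] : t * x = 0 /\ (1 - t) * y = 0.
    have := mulr_ge0 (ltW t0) x0; have := mulr_ge0 (ltW t1') y0.
    by move: wE; rewrite /w; lra.
  have -> : x = 0 by move/eqP: tx; rewrite mulf_eq0 gt_eqF//= => /eqP.
  have -> : y = 0 by move/eqP: ty; rewrite mulf_eq0 gt_eqF//= => /eqP.
  by rewrite wE binary_entropy0 !mulr0 addr0.
have [wE|wn1] := eqVneq w 1.
  have [tx ty] : t * (1 - x) = 0 /\ (1 - t) * (1 - y) = 0.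
    have x1' : 0 <= 1 - x by rewrite subr_ge0.
    have y1' : 0 <= 1 - y by rewrite subr_ge0.
    have := mulr_ge0 (ltW t0) x1'; have := mulr_ge0 (ltW t1') y1'.
    by move: wE; rewrite /w; lra.
  have -> : x = 1 by move/eqP: tx; rewrite mulf_eq0 gt_eqF//= subr_eq0 => /eqP.
  have -> : y = 1 by move/eqP: ty; rewrite mulf_eq0 gt_eqF//= subr_eq0 => /eqP.
  by rewrite wE binary_entropy1 !mulr0 addr0.
have w01 : 0 < w < 1.
  rewrite !lt_neqAle eq_sym wn0 wn1 /= /w.
  have := mulr_ge0 (ltW t0) x0; have := mulr_ge0 (ltW t1') y0.
  have := ler_wpM2l (ltW t0) x1; have := ler_wpM2l (ltW t1') y1.
  by move=> *; apply/andP; split; lra.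
have hx := ler_wpM2l (ltW t0) (binary_entropy_le_cross x01 w01).
have hy := ler_wpM2l (ltW t1') (binary_entropy_le_cross y01 w01).
apply: le_trans (lerD hx hy) _; rewrite /cross_entropy /binary_entropy /w.
by rewrite le_eqVlt; apply/orP; left; apply/eqP; ring.
Qed.

Lemma binary_entropy_strictly_concave x y t :
  0 < x < 1 -> 0 < y < 1 -> x != y -> 0 < t < 1 ->
  t * binary_entropy x + (1 - t) * binary_entropy y <
  binary_entropy (t * x + (1 - t) * y).
Proof.
move=> x01 y01 xy /andP[t0 t1]; set w := t * x + (1 - t) * y.
have /andP[x0 x1] := x01; have /andP[y0 y1] := y01.
have t1' : 0 < 1 - t by rewrite subr_gt0.
have w01 : 0 < w < 1.
  rewrite /w; have := mulr_gt0 t0 x0; have := mulr_gt0 t1' y0.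
  have : t * x < t * 1 by rewrite ltr_pM2l.
  have : (1 - t) * y < (1 - t) * 1 by rewrite ltr_pM2l.
  by move=> *; apply/andP; split; lra.
have xw : x != w.
  rewrite -subr_eq0 (_ : x - w = (1 - t) * (x - y)); last by rewrite /w; ring.
  by rewrite mulf_neq0 ?(gt_eqF t1')// subr_eq0.
have y01' : 0 <= y <= 1 by rewrite !ltW.
have hx : t * binary_entropy x < t * cross_entropy w x.
  by rewrite ltr_pM2l// binary_entropy_lt_cross.
have hy := ler_wpM2l (ltW t1') (binary_entropy_le_cross y01' w01).
apply: lt_le_trans (ltr_leD hx hy) _; rewrite /cross_entropy /binary_entropy /w.
by rewrite le_eqVlt; apply/orP; left; apply/eqP; ring.
Qed.

Lemma mul_ln_continuous : continuous (fun x : R => x * ln x).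
Proof.
move=> x; have [x0|x0|->] := ltgtP x 0.
- suff : {near x, cst 0 =1 (fun u : R => u * ln u)}.
    move=> H; have := nbhs_singleton H; rewrite /prop_for /continuous_at => <-.
    by move/near_eq_cvg/cvg_trans : H; apply; exact: cvg_cst.
  have /= : open_nbhs x [set u : R | u < 0] by split=> //; exact: open_lt.
  by move=> /open_nbhs_nbhs; apply: filterS => u /= u0; rewrite ln0 ?mulr0// ltW.
- by apply: continuousM; [exact: cvg_id|exact: continuous_ln].
(* [mul_ln_ratio_le] at w = e / 2 reads - t ln t <= e / 2 - t - t ln (e / 2), and the last term is
   at most e / 2 for t small. *)
- rewrite /prop_for /continuous_at mul0r; apply/cvgrPdist_le => e e0.
  have e2 : 0 < e / 2 by rewrite divr_gt0.
  have L0 : 0 < `|ln (e / 2)| + 1 by rewrite ltr_wpDl.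
  have N1 := @nbhs0_le _ R^o 1 ltr01.
  have N2 := @nbhs0_le _ R^o _ (divr_gt0 e2 L0).
  apply: filterS (filterI N1 N2) => t [t1 tL]; rewrite sub0r normrN.
  have [t0|t0] := leP t 0; first by rewrite ln0// mulr0 normr0 ltW.
  rewrite gtr0_norm// in t1 tL.
  have lt0 : ln t <= 0 by exact: ln_le0.
  rewrite normrM (gtr0_norm t0) (ler0_norm lt0).
  have := mul_ln_ratio_le (ltW t0) e2.
  have : t * - ln (e / 2) <= e / 2.
    rewrite ler_pdivlMr// in tL; apply: le_trans tL; rewrite ler_pM2l//.
    by apply: le_trans (ler_norm _) _; rewrite normrN lerDl.
  lra.
Qed.

Lemma binary_entropy_continuous : continuous (@binary_entropy R).
Proof.
move=> x; apply: cvgN; apply: cvgD; first exact: mul_ln_continuous.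
apply: (@continuous_comp _ _ _ (fun x : R => 1 - x) (fun x => x * ln x)).
  by apply: cvgB; [exact: cvg_cst|exact: cvg_id].
exact: mul_ln_continuous.
Qed.

End BinaryEntropyShape.

(** * The entropy function of the first letter *)

Lemma ks_entropy_ge0 (R : realType) (Y : pointedMetricType R) (S : Y -> Y)
  (mu : probability (borel Y) R) : (0 <= ks_entropy S mu)%E.
Proof.
pose A (i : 'I_1) : set (borel Y) := setT.
have jA n : join_entropy S mu A n = 0.
  rewrite /join_entropy big1 ?oppr0// => w _ /=.
  have -> : \bigcap_(i in [set: 'I_n]) iter i S @^-1` A (w i) = setT :> set (borel Y).
    by apply/seteqP; split.
  by rewrite [mu _]probability_setT ln1 mulr0.
apply: ereal_sup_ubound; exists 1%N, A.
  split=> [i|i j _ _ _|]; [exact: measurableT|by rewrite !ord1|].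
  by apply/seteqP; split=> // y _; exists ord0.
rewrite /partition_entropy (_ : (fun n => _) = cst 0) ?lim_cst//.
by apply/funext => n; rewrite jA mulr0.
Qed.

Section BinaryEntropy.
Variable R : realType.
Local Notation X := (shift_space R).
Local Notation T := (@shift_map R).
Implicit Types mu : probability (borel X) R.

Definition first_letter (i : 'I_1) (x : X) : R := (x 0%N)%:R.

Let mletter : finite_valued (fun x : borel X => x 0%N).
Proof. by apply: (@finite_valued_agree _ _ 1) => x y; apply. Qed.

Lemma mean_first_letter mu : mean first_letter mu = const_mx (letter_law mu true).
Proof.
apply/rowP => i; rewrite !mxE /Rintegral /letter_law /law.
rewrite -[in RHS](setIT [set x | _]) -integral_indic//; congr (fine _).
apply: eq_integral => x _; rewrite /first_letter indicE /=.
case x0 : (x 0%N); first by rewrite mem_set.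
by rewrite memNset//= x0.
Qed.

Lemma letter_law_false mu : letter_law mu false = 1 - letter_law mu true.
Proof.
by rewrite -(law_sum1 mu mletter) big_bool /= addrAC subrr add0r.
Qed.

Lemma letter_law_itv mu : 0 <= letter_law mu true <= 1.
Proof.
have := law_ge0 mu (fun x : borel X => x 0%N) false.
rewrite -/(letter_law mu false) letter_law_false subr_ge0 => ->.
by rewrite law_ge0.
Qed.

Lemma ks_entropy_le_binary mu : Defs.invariant T mu ->
  (ks_entropy T mu <= (binary_entropy (letter_law mu true))%:E)%E.
Proof.
move=> imu; have /andP[z0 z1] := letter_law_itv mu.
set z := letter_law mu true in z0 z1 *.
have cE q : letter_cost mu q = - (z * ln q + (1 - z) * ln (1 - q)).
  by rewrite /letter_cost letter_law_false.
(* For z = 0 or 1 the parameter q = z is excluded; q is taken close to z so that the cost is exactly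
   e. *)
have [zE|zn0] := eqVneq z 0.
  rewrite zE /binary_entropy mul0r add0r subr0 ln1 mulr0 oppr0.
  apply/lee_addgt0Pr => e e0; rewrite add0e.
  apply: le_trans (ks_entropy_le imu (q := 1 - expR (- e)) _) _.
    by rewrite subr_gt0 expR_lt1 oppr_lt0 e0 /= gtrBl expR_gt0.
  by rewrite cE zE mul0r add0r subr0 mul1r opprB addrC subrK expRK opprK.
have [zE|zn1] := eqVneq z 1.
  rewrite zE /binary_entropy subrr mul0r addr0 ln1 mulr0 oppr0.
  apply/lee_addgt0Pr => e e0; rewrite add0e.
  apply: le_trans (ks_entropy_le imu (q := expR (- e)) _) _.
    by rewrite expR_gt0 expR_lt1 oppr_lt0.
  by rewrite cE zE subrr mul0r addr0 mul1r expRK opprK.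
rewrite /binary_entropy -cE; apply: ks_entropy_le => //.
by rewrite !lt_neqAle eq_sym zn0 z0 zn1 z1.
Qed.

Lemma letter_law_bernoulli (p : R) (p01 : 0 <= p <= 1) :
  letter_law (bernoulli_shift p01) true = p.
Proof.
rewrite /letter_law /law (_ : mkset _ = @cylinder R [:: true]).
  by rewrite bernoulli_cylinder /word_weight big_cons big_nil mulr1.
apply/seteqP; split=> x /=; first by move=> x0 [|[]].
by move=> /(_ 0%N isT).
Qed.

(** For the partition by the first letter the law of a name is a product, so the join entropy is
    exactly n times that of one letter. *)
Lemma bernoulli_entropy_ge (p : R) (p01 : 0 <= p <= 1) : 0 < p < 1 ->
  ((binary_entropy p)%:E <= ks_entropy T (bernoulli_shift p01))%E.
Proof.
move=> /andP[p0 p1]; set mu := bernoulli_shift p01.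
have imu : Defs.invariant T mu by exact: bernoulli_invariant.
pose o (c : bool) : 'I_2 := if c then ord_max else ord0.
have oE c : (o c == ord_max) = c by case: c.
have Eo (j : 'I_2) : o (j == ord_max) = j.
  by apply: val_inj; case: j => -[|[|[]]].
pose a (x : borel X) := o (x 0%N).
pose A (i : 'I_2) : set (borel X) := [set x | a x = i].
have ma : finite_valued a by apply: (finite_valued_comp o mletter).
have beta0 c : 0 < letter_weight p c by case: c => //=; rewrite subr_gt0.
pose N n (x : borel X) := [ffun i : 'I_n => a (iter i T x)].
have mN n : finite_valued (N n).
  by apply: finite_valued_ffun => i; exact: finite_valued_iter.
have lawN n (w : {ffun 'I_n -> 'I_2}) :
    law mu (N n) w = \prod_i letter_weight p (w i == ord_max).
  rewrite (eq_bigr (fun i => letter_weight p ([ffun i => w i == ord_max] i))); last first.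
    by move=> i _; rewrite ffunE.
  rewrite -law_bernoulli; congr (fine (mu _)); apply/seteqP; split=> x /=.
    by move=> <-; apply/ffunP => i; rewrite !ffunE oE iter_shift_map addn0.
  move=> /ffunP xw; apply/ffunP => i; have := xw i; rewrite !ffunE => xi.
  by rewrite /a iter_shift_map addn0 xi Eo.
have letterE i c : law mu (fun x : borel X => x i) c = letter_law mu c.
  rewrite /letter_law -(law_iter imu i c mletter); congr (fine (mu _)).
  by apply/seteqP; split=> x /=; rewrite iter_shift_map addn0.
have jA n : join_entropy T mu A n = n%:R * binary_entropy p.
  rewrite /join_entropy (eq_bigr (fun w => \sum_(i < n)
      law mu (N n) w * ln (letter_weight p (w i == ord_max)))); last first.
    move=> w _; rewrite -mulr_sumr -ln_prod// -lawN.
    rewrite (_ : \bigcap_(i in _) _ = [set x | N n x = w])//.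
    apply/seteqP; split=> x /=.
      by move=> H; apply/ffunP => i; rewrite ffunE; exact: H.
    by move=> <- i _ /=; rewrite ffunE.
  rewrite exchange_big/= (eq_bigr (fun=> - binary_entropy p)).
    by rewrite sumr_const card_ord mulNrn opprK mulr_natl.
  move=> i _; rewrite (sum_law_comp mu (fun w : {ffun 'I_n -> 'I_2} => w i == ord_max)
    (fun c => ln (letter_weight p c)) (mN n)) big_bool /=.
  have lE c : law mu ((fun w : {ffun 'I_n -> 'I_2} => w i == ord_max) \o N n) c = letter_law mu c.
    rewrite -(letterE i); congr (fine (mu _)).
    by apply/seteqP; split=> x /=; rewrite ffunE /a oE iter_shift_map addn0.
  by rewrite !lE letter_law_false letter_law_bernoulli /binary_entropy opprK.
apply: ereal_sup_ubound; exists 2%N, A.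
  split=> [i|i j _ _ [x [/= <- <-]]//|]; first exact: ma.
  by apply/seteqP; split=> // x _; exists (a x).
congr _%:E; apply/esym; apply: cvg_lim => //.
apply: (@cvg_trans _ (cst (binary_entropy p) @ \oo)); last exact: cvg_cst.
apply: near_eq_cvg; exists 1%N => // n /= n1.
by rewrite jA mulKf// pnatr_eq0 -lt0n.
Qed.

End BinaryEntropy.

Section ShiftEntropy.
Variable R : realType.
Local Notation X := (shift_space R).
Local Notation T := (@shift_map R).

Lemma bernoulli_entropy (p : R) (p01 : 0 <= p <= 1) :
  ks_entropy T (bernoulli_shift p01) = (binary_entropy p)%:E.
Proof.
apply/eqP; rewrite eq_le; apply/andP; split.
  rewrite -[in leRHS](letter_law_bernoulli p01).
  by apply: ks_entropy_le_binary; exact: bernoulli_invariant.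
have /andP[p0 p1] := p01.
have [pE|pn0] := eqVneq p 0.
  rewrite {1}pE /binary_entropy mul0r add0r subr0 ln1 mulr0 oppr0.
  exact: ks_entropy_ge0.
have [pE|pn1] := eqVneq p 1.
  rewrite {1}pE /binary_entropy subrr mul0r addr0 ln1 mulr0 oppr0.
  exact: ks_entropy_ge0.
by apply: bernoulli_entropy_ge; rewrite !lt_neqAle eq_sym pn0 p0 pn1 p1.
Qed.

Lemma bernoulli_mean (p : R) (p01 : 0 <= p <= 1) :
  mean (@first_letter R) (bernoulli_shift p01) = const_mx p.
Proof. by rewrite mean_first_letter letter_law_bernoulli. Qed.

Lemma rV1E (z : 'rV[R]_1) : z = const_mx (z 0 0).
Proof. by apply/rowP => i; rewrite mxE ord1. Qed.

Lemma entropy_first_letter (z : 'rV[R]_1) :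
  entropy_function T (@first_letter R) z =
  if 0 <= z 0 0 <= 1 then (binary_entropy (z 0 0))%:E else -oo%E.
Proof.
case: ifPn => [z01|nz01].
  apply/eqP; rewrite eq_le; apply/andP; split.
    apply: ub_ereal_sup => _ [mu [imu muz] <-]; rewrite -muz mean_first_letter mxE.
    exact: ks_entropy_le_binary.
  apply: ereal_sup_ubound; exists (bernoulli_shift z01); last exact: bernoulli_entropy.
  by split; [exact: bernoulli_invariant|rewrite bernoulli_mean -rV1E].
rewrite /entropy_function; set S := (X in ereal_sup X).
have -> : S = set0; last exact: ereal_sup0.
apply/seteqP; split=> // t [mu [imu muz] _]; exfalso.
by move/negP: nz01; apply; rewrite -muz mean_first_letter mxE letter_law_itv.
Qed.

(** With 1 / m <= eps, points that share their first n + m letters stay within eps during n steps,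
    so a separated set injects into words. *)
Lemma separated_card n (eps : R) (S : {fset X}) : 0 < eps -> Defs.separated T n eps S ->
  (#|` S| <= 2 ^ (n + (Num.truncn eps^-1).+1))%N.
Proof.
move=> e0 sS; set m := (Num.truncn eps^-1).+1.
pose w (x : X) := [ffun j : 'I_(n + m) => x j].
have winj : {in S &, injective w}.
  move=> x y Sx Sy /ffunP wxy; apply/eqP; apply: contraT => xy.
  have := sS x y Sx Sy xy; rewrite ltNge => /negP; apply: contra_notT => _.
  apply: bigmax_le => [|i _]; first exact: ltW.
  apply: (@le_trans _ _ m%:R^-1).
    apply/ltW/first_diff_distP => j jm; rewrite !iter_shift_map.
    have ijnm : (i + j < n + m)%N by rewrite -addnS leq_add// ltnW.
    by have := wxy (Ordinal ijnm); rewrite !ffunE.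
  by rewrite invf_ple ?posrE ?ltr0n// ltW// truncnS_gt.
have -> : (2 ^ (n + m) = #|{ffun 'I_(n + m) -> bool}|)%N.
  by rewrite card_ffun card_bool card_ord.
have us : uniq [seq w x | x <- (S : seq X)] by rewrite map_inj_in_uniq ?fset_uniq.
by have := max_card (mem [seq w x | x <- (S : seq X)]); rewrite (card_uniqP us) size_map.
Qed.

Lemma shift_topological_entropy : topological_entropy T \is a fin_num.
Proof.
rewrite fin_numElt; apply/andP; split.
  apply: (@lt_le_trans _ _ 0%E); first by rewrite ltNyr.
  apply: (@le_trans _ _ (limn_esup (fun n => (n%:R^-1)%:E * lne (max_separated T n 1))%E)).
    apply: limf_esup_ge0 => [|n]; first by move=> [N _ /(_ N (leqnn N))].
    rewrite mule_ge0 ?lee_fin// lne_ge0.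
    apply: ereal_sup_ubound; exists [fset (point : X)]%fset; last by rewrite cardfs1.
    by move=> x y /fset1P -> /fset1P ->; rewrite eqxx.
  by apply: ereal_sup_ubound; exists (1 : R) => //=; exact: ltr01.
(* Only finiteness matters: (n + m) / n <= 2 as soon as n >= m. *)
apply: (@le_lt_trans _ _ (2 * ln 2)%:E); last exact: ltry.
apply: ub_ereal_sup => _ [eps /= e0 <-].
set m := (Num.truncn eps^-1).+1.
pose V := [set n : nat | (m <= n)%N].
have ln20 : 0 <= ln 2 :> R by rewrite ln_ge0// ler1n.
apply: (@le_trans _ _ (ereal_sup ((fun n => (n%:R^-1)%:E * lne (max_separated T n eps))%E @` V))).
  by apply: ereal_inf_lbound; exists V => //; exists m.
apply: ub_ereal_sup => _ [n /= mn <-].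
have n0 : 0 < n%:R :> R by rewrite ltr0n (leq_trans _ mn).
have ms : (max_separated T n eps <= ((2 ^ (n + m))%:R)%:E)%E.
  by apply: ub_ereal_sup => _ [S sS <-]; rewrite lee_fin ler_nat separated_card.
have ms0 : (0 <= max_separated T n eps)%E.
  by apply: ereal_sup_ubound; exists fset0; rewrite ?cardfs0// => x y; rewrite inE.
have H : (lne (max_separated T n eps) <= ((n + m)%:R * ln 2)%:E)%E.
  have -> : ((n + m)%:R * ln 2)%:E = lne ((2 ^ (n + m))%:R : R)%:E.
    by rewrite lne_EFin ?ltr0n ?expn_gt0// natrX lnXn// mulr_natl.
  by rewrite lee_lne ?in_itv/= ?ms0 ?leey ?lee_fin ?ler0n.
apply: (@le_trans _ _ ((n%:R^-1)%:E * ((n + m)%:R * ln 2)%:E)%E).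
  by rewrite lee_wpmul2l ?lee_fin ?invr_ge0.
rewrite -EFinM lee_fin mulrA ler_wpM2r// ler_pdivrMl//.
by rewrite -natrM ler_nat muln2 -addnn leq_add2l.
Qed.

End ShiftEntropy.

(** * The binary entropy is of Legendre type *)

Section BinaryEntropyLegendre.
Variable R : realType.
Implicit Types z : 'rV[R]_1.

Definition binary_entropy_rV z : \bar R :=
  if 0 <= z 0 0 <= 1 then (binary_entropy (z 0 0))%:E else -oo%E.

Local Notation g := binary_entropy_rV.
Local Notation O := [set z : 'rV[R]_1 | 0 < z 0 0 < 1].

Lemma domgE : dom g = [set z | 0 <= z 0 0 <= 1].
Proof. by apply/seteqP; split=> z; rewrite /dom /= /g; case: ifP. Qed.

Lemma norm_rV1 z : `|z| = `|z 0 0|.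
Proof.
apply/eqP; rewrite eq_le norm_coord_le andbT.
by apply: rV_norm_le => // i; rewrite ord1.
Qed.

Lemma open_unit : open O.
Proof.
have c := @coord_continuous R 1 1 0 0.
rewrite (_ : mkset _ = [set z : 'rV[R]_1 | 0 < z 0 0] `&` [set z : 'rV[R]_1 | z 0 0 < 1]).
  apply: openI.
    exact: (@open_comp _ _ (fun z : 'rV[R]_1 => z 0 0) [set t | 0 < t] (fun w _ => c w) (@open_gt _ _)).
  exact: (@open_comp _ _ (fun z : 'rV[R]_1 => z 0 0) [set t | t < 1] (fun w _ => c w) (@open_lt _ _)).
by apply/seteqP; split=> z /=; [move/andP|move=> /andP].
Qed.

Lemma interior_domg : (dom g)° = O.
Proof.
rewrite domgE; apply/seteqP; split=> z.
  move=> /nbhs_ballP[e /= e0 eO]; have e2 : 0 < e / 2 by rewrite divr_gt0.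
  have zb c : `|c| <= e / 2 -> 0 <= (z + const_mx c) 0 0 <= 1.
    move=> ce; apply: eO; rewrite -ball_normE /= opprD addNKr normrN norm_rV1 mxE.
    by apply: le_lt_trans ce _; rewrite ltr_pdivrMr// ltr_pMr// ltr1n.
  have := zb (e / 2); have := zb (- (e / 2)); rewrite normrN (gtr0_norm e2) lexx !mxE.
  move=> /(_ isT)/andP[h1 h2] /(_ isT)/andP[h3 h4]; apply/andP; split; lra.
move=> zO; apply: filterS (open_nbhs_nbhs (conj open_unit zO)) => w /andP[w0 w1].
by rewrite /= !ltW.
Qed.

Lemma fine_g z : O z -> (fine \o g) z = binary_entropy (z 0 0).
Proof. by move=> /andP[z0 z1]; rewrite /= /g !ltW. Qed.

Let Ck_z k : Ck k (fun z => z 0 0) O. Proof. exact: Ck_coord. Qed.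

Let Ck_1z k : Ck k (fun z => 1 - z 0 0) O.
Proof. exact: (CkB open_unit (Ck_cst k 1 _) (Ck_z k)). Qed.

Let z_gt0 z : O z -> 0 < z 0 0. Proof. by move=> /andP[]. Qed.

Let z_lt1 z : O z -> 0 < 1 - z 0 0. Proof. by move=> /andP[_]; rewrite subr_gt0. Qed.

Lemma Ck_binary_entropy k : Ck k (fine \o g) O.
Proof.
have oO := open_unit.
have lz := Ck_ln oO z_gt0 (Ck_z k); have l1z := Ck_ln oO z_lt1 (Ck_1z k).
apply: (Ck_eq oO _ (CkN oO (CkD oO (CkM oO (Ck_z k) lz) (CkM oO (Ck_1z k) l1z)))).
by move=> z /set_mem Oz; rewrite fine_g.
Qed.

Let dz z : is_derive z (delta_mx 0 0) (fun z : 'rV[R]_1 => z 0 0) 1.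
Proof. by have := is_derive_coord 0 0 z; rewrite eqxx. Qed.

Let d1z z : is_derive z (delta_mx 0 0) (fun z : 'rV[R]_1 => 1 - z 0 0) (- 1).
Proof. exact: is_derive_eq (is_deriveB (is_derive_cst (1 : R) _ _) (dz z)) (sub0r _). Qed.

Lemma partial_binary_entropy z : O z ->
  partial 0 (fine \o g) z = ln (1 - z 0 0) - ln (z 0 0).
Proof.
move=> Oz; have [z0 z1] := (z_gt0 Oz, z_lt1 Oz).
have nfg : \near z, (fine \o g) z = - (z 0 0 * ln (z 0 0) + (1 - z 0 0) * ln (1 - z 0 0)).
  by apply: filterS (open_nbhs_nbhs (conj open_unit Oz)) => w Ow; rewrite fine_g.
rewrite /partial (near_eq_derive _ nfg).
have [zd zE] := dz z; have [zd' zE'] := d1z z.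
have dl := @is_derive_ln_comp R _ (fun w : 'rV[R]_1 => w 0 0) z _ z0 zd.
have dl' := @is_derive_ln_comp R _ (fun w : 'rV[R]_1 => 1 - w 0 0) z _ z1 zd'.
rewrite zE in dl; rewrite zE' in dl'.
have [_ ->] := is_deriveN (is_deriveD (is_deriveM (dz z) dl) (is_deriveM (d1z z) dl')).
by rewrite /GRing.scale/=; field; rewrite !gt_eqF.
Qed.

Lemma hessian_binary_entropy z : O z ->
  partial 0 (partial 0 (fine \o g)) z = - ((1 - z 0 0)^-1 + (z 0 0)^-1).
Proof.
move=> Oz; have [z0 z1] := (z_gt0 Oz, z_lt1 Oz).
have nfg : \near z, partial 0 (fine \o g) z = ln (1 - z 0 0) - ln (z 0 0).
  by apply: filterS (open_nbhs_nbhs (conj open_unit Oz)) => w Ow; rewrite partial_binary_entropy.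
rewrite /partial (near_eq_derive _ nfg).
have [zd zE] := dz z; have [zd' zE'] := d1z z.
have dl := @is_derive_ln_comp R _ (fun w : 'rV[R]_1 => w 0 0) z _ z0 zd.
have dl' := @is_derive_ln_comp R _ (fun w : 'rV[R]_1 => 1 - w 0 0) z _ z1 zd'.
rewrite zE in dl; rewrite zE' in dl'.
have [_ ->] := is_deriveB dl' dl.
by rewrite mulrN1 mulr1 -opprD.
Qed.

Let concave_itv (x y : 'rV[R]_1) (t : R) : 0 <= x 0 0 <= 1 -> 0 <= y 0 0 <= 1 ->
  0 < t < 1 -> 0 <= (t *: x + (1 - t) *: y) 0 0 <= 1.
Proof.
move=> /andP[x0 x1] /andP[y0 y1] /andP[t0 t1]; rewrite !mxE.
have s0 : 0 <= 1 - t by lra.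
have := mulr_ge0 (ltW t0) x0; have := mulr_ge0 s0 y0.
have := ler_wpM2l (ltW t0) x1; have := ler_wpM2l s0 y1.
by move=> *; apply/andP; split; lra.
Qed.

Let g_lty z : (g z < +oo)%E.
Proof. by rewrite /g; case: ifP; rewrite ?ltry ?ltNyr. Qed.

Let g_usc : upper_semicontinuous g.
Proof.
apply/upper_semicontinuousP => a.
have c := @coord_continuous R 1 1 0 0.
have cH : continuous (fun z : 'rV[R]_1 => binary_entropy (z 0 0)).
  by move=> z; apply: continuous_comp; [exact: c|exact: binary_entropy_continuous].
have -> : [set z | (g z < a%:E)%E] = ~` ([set z | 0 <= z 0 0] `&` [set z | z 0 0 <= 1] `&`
    [set z | a <= binary_entropy (z 0 0)]).
  apply/seteqP; split=> z /=; rewrite /g.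
    by case: ifP => [_|/negP nz _ [[z0 z1] _]]; [rewrite lte_fin ltNge => /negP za [_]|apply: nz; rewrite z0 z1].
  case: ifP => [/andP[z0 z1] H|_ _]; last exact: ltNyr.
  by rewrite lte_fin ltNge; apply/negP => za; apply: H.
apply: closed_openC; apply: closedI; first apply: closedI.
- exact: (@closed_comp _ _ (fun z : 'rV[R]_1 => z 0 0) [set t | 0 <= t] (fun w _ => c w) (@closed_ge _ _)).
- exact: (@closed_comp _ _ (fun z : 'rV[R]_1 => z 0 0) [set t | t <= 1] (fun w _ => c w) (@closed_le _ _)).
- exact: (@closed_comp _ _ _ [set t | a <= t] (fun w _ => cH w) (@closed_ge _ _)).
Qed.

Let g_concave : concave g.
Proof.
move=> x y t /andP[t0 t1].
have [->|tn0] := eqVneq t 0; first by rewrite mul0e subr0 mul1e add0e scale0r add0r scale1r.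
have [->|tn1] := eqVneq t 1; first by rewrite subrr mul0e mul1e adde0 scale0r addr0 scale1r.
have t01 : 0 < t < 1 by rewrite !lt_neqAle eq_sym tn0 t0 tn1 t1.
have /andP[t0' t1'] := t01; have s0 : 0 < 1 - t by rewrite subr_gt0.
have [xd|nxd] := boolP (0 <= x 0 0 <= 1); last first.
  rewrite {1}/g (negbTE nxd) mulrNy gtr0_sg// mul1e addNye ?leNye//.
have [yd|nyd] := boolP (0 <= y 0 0 <= 1); last first.
  rewrite {2}/g (negbTE nyd) mulrNy gtr0_sg// mul1e addeNy leNye//.
have wd := concave_itv xd yd t01.
rewrite /g xd yd wd -!EFinM -EFinD lee_fin !mxE.
exact: binary_entropy_concave.
Qed.

Lemma binary_entropy_legendre r : concave_legendre_type r g.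
Proof.
have OE := interior_domg.
split=> //.
- rewrite OE; split.
  + by exists (const_mx 2^-1); rewrite /= mxE; apply/andP; split; lra.
  + move=> x y t Ox Oy xy t01.
    have /andP[t0 t1] := t01.
    have xy' : x 0 0 != y 0 0.
      by apply: contra_neq xy => xy; apply/rowP => i; rewrite ord1.
    have [x01 y01] : 0 <= x 0 0 <= 1 /\ 0 <= y 0 0 <= 1.
      by split; [move: Ox|move: Oy] => /andP[? ?]; rewrite !ltW.
    rewrite /g x01 y01 (concave_itv x01 y01 t01) -!EFinM -EFinD lte_fin !mxE.
    exact: binary_entropy_strictly_concave.
  + by apply: Cr_Ck => k; exact: Ck_binary_entropy.
  + move=> x Ox v v0; rewrite !mxE big_ord1 !mxE big_ord1 !mxE !ord1.
    have v00 : v 0 0 != 0.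
      by apply: contra_neq v0 => v0; apply/rowP => i; rewrite !mxE ord1.
    rewrite hessian_binary_entropy// mulrAC -expr2 pmulr_rlt0 ?oppr_lt0 ?exprn_even_gt0//.
    by rewrite addr_gt0 ?invr_gt0 ?z_gt0 ?z_lt1.
- move=> x z Ox xz [clz nOz]; rewrite OE in Ox nOz.
  have dz01 : 0 <= z 0 0 <= 1.
    have c := @coord_continuous R 1 1 0 0.
    have cd : closed (dom g).
      rewrite domgE (_ : mkset _ = [set z | 0 <= z 0 0] `&` [set z | z 0 0 <= 1]).
        apply: closedI.
          exact: (@closed_comp _ _ (fun z : 'rV[R]_1 => z 0 0) [set t | 0 <= t] (fun w _ => c w) (@closed_ge _ _)).
        exact: (@closed_comp _ _ (fun z : 'rV[R]_1 => z 0 0) [set t | t <= 1] (fun w _ => c w) (@closed_le _ _)).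
      by apply/seteqP; split=> w /=; [move/andP|move=> /andP].
    by move: clz; rewrite -((closure_id _).1 cd) domgE.
  have tz : (fun n => x n 0 0) @ \oo --> z 0 0.
    exact: (@cvg_comp _ _ _ x (fun w : 'rV[R]_1 => w 0 0) _ _ _ xz (@coord_continuous R 1 1 0 0 z)).
  (* The derivative at s is ln ((1 - s) / s), which exceeds A when s < 1 / (1 + e^A); the end 1
     follows by exchanging s and 1 - s. *)
  have ln_gap (s A : R) : 0 < s -> s < (1 + expR A)^-1 -> A < ln (1 - s) - ln s.
    move=> s0 sA; have A0 := expR_gt0 A.
    have sA' : expR A * s < 1 - s.
      move: sA; rewrite -[_^-1]mul1r ltr_pdivlMr ?addr_gt0//; lra.
    rewrite ltrBrDr -{1}(expRK A) -lnM ?posrE// ltr_ln ?posrE ?mulr_gt0//.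
    by apply: lt_trans sA'; rewrite mulr_gt0.
  apply/cvgryPgt => A; have A1 : 0 < (1 + expR A)^-1.
    by rewrite invr_gt0 addr_gt0 ?expR_gt0.
  have z01 : z 0 0 = 0 \/ z 0 0 = 1.
    have /andP[z0 z1] := dz01.
    have [|z0'] := eqVneq (z 0 0) 0; first by left.
    have [|z1'] := eqVneq (z 0 0) 1; first by right.
    by exfalso; apply: nOz; rewrite /= !lt_neqAle eq_sym z0' z0 z1' z1.
  move/cvgrPdist_lt : tz => /(_ _ A1); apply: filterS => n.
  rewrite norm_rV1 mxE partial_binary_entropy//.
  have [t0 t1] := (z_gt0 (Ox n), z_lt1 (Ox n)).
  case: z01 => ->.
    rewrite sub0r normrN gtr0_norm// => tA.
    by apply: lt_le_trans (ler_norm _); exact: ln_gap.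
  rewrite gtr0_norm// => tA; have := ln_gap _ _ t1 tA.
  have -> : 1 - (1 - x n 0 0) = x n 0 0 by ring.
  rewrite distrC => H.
  exact: lt_le_trans H (ler_norm _).
Qed.

End BinaryEntropyLegendre.

(** * The example *)

Section ShiftLegendre.
Variable R : realType.
Local Notation X := (shift_space R).
Local Notation T := (@shift_map R).
Local Notation phi := (@first_letter R).

Lemma first_letter_continuous i : continuous (phi i : X -> R).
Proof.
move=> x A /nbhs_singleton Ax; apply/nbhs_agree; exists 1%N => y xy.
by rewrite /= /first_letter -xy.
Qed.

Lemma entropy_function_shift : entropy_function T phi = @binary_entropy_rV R.
Proof. by apply/funext => z; exact: entropy_first_letter. Qed.

Lemma shift_legendre r : legendre_system T phi r.
Proof.
split; last first.
- by rewrite entropy_function_shift; exact: (@binary_entropy_legendre R r).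
- exact: shift_topological_entropy.
have sub : dom (@binary_entropy_rV R) `<=` rotation_set T phi.
  move=> z; rewrite domgE /= => z01; exists (bernoulli_shift z01).
    exact: bernoulli_invariant.
  by rewrite bernoulli_mean -rV1E.
have [_ _ [[z Oz] _ _ _] _] := @binary_entropy_legendre R r.
by exists z; apply: filterS Oz.
Qed.

Lemma uncountable_equilibrium_measures (r : option nat) :
  (if r is Some k then (2 <= k)%N else true) ->
  exists F, nonlinearity T phi r setT F /\ ~ countable (equilibrium_measures T phi F).
Proof.
move=> hr; have hL := shift_legendre r.
have cX := @shift_space_compact R.
have d0 : (0 < 1)%N by [].
pose P := fine \o pressure T phi.
have [_ Gi _ GO _] := pressure_gradient_facts hr cX d0 first_letter_continuous hL.
pose E := [set y : 'rV[R]_1 | `|y| <= 1].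
have cE : compact E.
  apply: bounded_closed_compact.
    by exists 1; split; rewrite ?num_real// => M M1 y /= yE; exact: le_trans yE (ltW M1).
  rewrite (_ : E = Num.norm @^-1` [set t | t <= 1])//.
  by apply: closed_comp => [x _|]; [exact: norm_continuous|exact: closed_le].
have nE : E !=set0 by exists 0; rewrite /E /= normr0.
have [F [nF FE]] := prescribed_maximizing_parameters hr cX d0 first_letter_continuous hL nE cE.
exists F; split=> // /countable_injP[f finj].
(* The Bernoulli measure of parameter z = grad P (t) has mean z and entropy h(z), so it attains the
   supremum of h + F. *)
have eqm (t : R) : 0 <= t <= 1 -> exists mu, equilibrium_measures T phi F mu /\
    mean phi mu = gradient P (const_mx t).
  move=> /andP[t0 t1].
  have Et : E (const_mx t) by rewrite /E /= norm_rV1 mxE ger0_norm.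
  have := Et; rewrite -FE => -[_]; set z := gradient _ _ => zmax.
  have z01 : 0 <= z 0 0 <= 1.
    have := interior_subset (GO (const_mx t)).
    by rewrite entropy_function_shift domgE.
  exists (bernoulli_shift z01); rewrite bernoulli_mean -rV1E; split=> //.
  split=> [|nu inu]; first exact: bernoulli_invariant.
  rewrite bernoulli_mean -rV1E bernoulli_entropy.
  have hz : entropy_function T phi z = (binary_entropy (z 0 0))%:E.
    by rewrite entropy_first_letter z01.
  rewrite -hz -/(nonlinear_objective T phi F z) zmax.
  apply: (@le_trans _ _ (nonlinear_objective T phi F (mean phi nu))).
    by rewrite leeD2r// ks_le_entropy.
  by apply: ereal_sup_ubound; exists (mean phi nu).
have /choice[m mP] (t : R) : exists mu, 0 <= t <= 1 -> equilibrium_measures T phi F mu /\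
    mean phi mu = gradient P (const_mx t).
  have [/eqm[mu muP]|nt] := boolP (0 <= t <= 1); first by exists mu.
  have p01 : 0 <= (0 : R) <= 1 by rewrite lexx ler01.
  by exists (bernoulli_shift p01) => t01; case/negP: nt.
(* An injection of the equilibrium measures into the integers would number [0, 1], which has
   positive Lebesgue measure. *)
have : countable (`[0, 1]%classic : set R).
  apply/countable_injP; exists (fun t => f (m t)) => s t.
  rewrite !inE/= !in_itv/= => /mP[sF ms] /mP[tF mt] /finj; rewrite !inE => /(_ sF tF) st.
  have : gradient P (const_mx s) = gradient P (const_mx t) by rewrite -ms -mt st.
  by move=> /Gi/rowP/(_ 0); rewrite !mxE.
move=> /countable_lebesgue_measure0; rewrite lebesgue_measure_itv/= lte_fin ltr01.
by rewrite -EFinB subr0 => /eqP; rewrite eqe oner_eq0.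
Qed.

End ShiftLegendre.

Theorem corollary4p22 (R : realType) (r : option nat)
    (hr : if r is Some k then (2 <= k)%N else true) :
  (forall (X : pointedMetricType R) (T : X -> X)
      (d : nat) (phi : 'I_d -> X -> R),
    compact [set: X] -> continuous T ->
    (0 < d)%N -> (forall i, continuous (phi i)) ->
    legendre_system T phi r ->
    forall E : set 'rV[R]_d, E !=set0 -> compact E ->
    exists (U : set 'rV[R]_d) (F : 'rV[R]_d -> R),
      nonlinearity T phi r U F /\ maximizing_parameters T phi F = E)
  /\
  (exists (X : pointedMetricType R) (T : X -> X)
      (d : nat) (phi : 'I_d -> X -> R),
    [/\ compact [set: X], continuous T,
        (0 < d)%N /\ (forall i, continuous (phi i)),
        legendre_system T phi r &
        exists (U : set 'rV[R]_d) (F : 'rV[R]_d -> R),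
          nonlinearity T phi r U F /\
          ~ countable (equilibrium_measures T phi F)]).
Proof.
split=> [X T d phi cX _ d0 phi_c hL E nE cE|].
  have [F FE] := prescribed_maximizing_parameters hr cX d0 phi_c hL nE cE.
  by exists setT, F.
exists (shift_space R), (@shift_map R), 1%N, (@first_letter R); split=> //.
- exact: shift_space_compact.
- exact: shift_map_continuous.
- by split=> //; exact: first_letter_continuous.
- exact: shift_legendre.
- have [F [nF cF]] := @uncountable_equilibrium_measures R r hr.
  by exists setT, F.
Qed.
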